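(* Let $G$ be a discrete group acting on a directed graph $E=(E^0,E^1,r,s)$, and let $\varphi\colon G\times E^1\to G$ be a cocycle for this action. Let $\{P_v,S_e,U_g\}$ be a CK-representation of $(E,G,\varphi)$ in a $C^*$-algebra $D$. If $E$ is row-finite, then there is a unique surjective homomorphism $\Phi\colon\mathcal O_{Y^\varphi}\to D$ such that \[ \Phi(p'_v)=P_v,\quad \Phi(s'_e)=S_e,\quad\text{and}\quad \overline{\Phi}(u'_g)=U_g \] for all $v\in E^0$, $e\in E^1$, and $g\in G$, where $\overline\Phi\colon M(\mathcal O_{Y^\varphi})\to M(D)$ is the canonical extension of $\Phi$ to multiplier algebras, and $p'_v=k_B(i_A(\delta_v))$, $s'_e=k_{Y^\varphi}(\chi_{e,1})$, $u'_g=\overline{k_B}(i_G(g))$ are the canonical elements described in the context.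
   Context: $E$ is row-finite if $|r^{-1}(v)|<\infty$ for all $v\in E^0$. An action of $G$ on the directed graph $E$ is an action on the sets $E^0$ and $E^1$ with $r(ge)=g\,r(e)$, $s(ge)=g\,s(e)$. A cocycle for the action is a map $\varphi\colon G\times E^1\to G$ with $\varphi(gh,e)=\varphi(g,he)\varphi(h,e)$ and $\varphi(g,e)s(e)=g\,s(e)$ for all $g,h\in G$, $e\in E^1$. A Cuntz-Krieger $E$-family in a $C^*$-algebra $D$ consists of mutually orthogonal projections $P_v$ ($v\in E^0$) and partial isometries $S_e$ ($e\in E^1$) in $D$ such that $S_e^*S_e=P_{s(e)}$ for all $e$; $\sum_{e\in\Lambda}S_eS_e^*\le P_v$ for every $v$ and every finite $\Lambda\subset r^{-1}(v)$; and $P_v=\sum_{r(e)=v}S_eS_e^*$ whenever $0<|r^{-1}(v)|<\infty$. A CK-representation of $(E,G,\varphi)$ in $D$ is a family $\{P_v,S_e,U_g: v\in E^0,e\in E^1,g\in G\}$ such that: (1) $\{P_v,S_e\}$ is a Cuntz-Krieger $E$-family in $D$; (2) $g\mapsto U_g$ is a unitary representation of $G$ in the multiplier algebra $M(D)$; (3) $U_gP_v=P_{gv}U_g$ and $U_gS_e=S_{ge}U_{\varphi(g,e)}$ for all $g,v,e$; (4) $D$ is generated as a $C^*$-algebra by $\{P_vU_g: v\in E^0,g\in G\}\cup\{S_eU_g: e\in E^1,g\in G\}$. Let $A=C_0(E^0)=c_0(E^0)$, $\alpha_g(a)(v)=a(g^{-1}v)$, $B=A\rtimes_\alpha G$ (full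 crossed product), with universal covariant homomorphism $(i_A,i_G)$ of $(A,G)$ in $M(B)$. Let $\delta_v\in A$ be the characteristic function of $\{v\}$ and $\delta_{v,g}=i_A(\delta_v)i_G(g)\in B$. The $B$-correspondence $Y^\varphi$ is the completion of $C_c(E^1\times G)=\mathrm{span}\{\chi_{e,g}\}$, where $\chi_{e,g}$ is the characteristic function of $\{(e,g)\}$, with operations determined by: $\langle\chi_{e,g},\chi_{e',h}\rangle=0$ if $e\ne e'$ and $\langle\chi_{e,g},\chi_{e,h}\rangle=\delta_{g^{-1}s(e),\,g^{-1}h}$; $\chi_{e,h}\cdot\delta_{v,g}=\chi_{e,hg}$ if $s(e)=hv$ and $0$ otherwise; $\delta_{v,g}\cdot\chi_{e,h}=\chi_{ge,\varphi(g,e)h}$ if $v=r(ge)$ and $0$ otherwise. Write $\phi\colon B\to\mathcal L(Y^\varphi)$ for the left action. A Toeplitz representation of $(Y^\varphi,B)$ in a $C^*$-algebra $D$ is a pair $(\psi,\zeta)$ of a linear map $\psi\colon Y^\varphi\to D$ and a $*$-homomorphism $\zeta\colon B\to D$ with $\psi(\xi)^*\psi(\eta)=\zeta(\langle\xi,\eta\rangle)$ and $\zeta(b)\psi(\xi)=\psi(b\cdot\xi)$. It induces a homomorphism $\psi^{(1)}\colon\mathcal K(Y^\varphi)\to D$ with $\psi^{(1)}(\theta_{\xi,\eta})=\psi(\xi)\psi(\eta)^*$, where $\theta_{\xi,\eta}(\zeta')=\xi\cdot\langle\eta,\zeta'\rangle$. The Katsura ideal is $J_{Y^\varphi}=\phi^{-1}(\mathcal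 K(Y^\varphi))\cap(\ker\phi)^\perp$, where $I^\perp=\{b\in B:bI=0\}$. The representation is Cuntz-Pimsner covariant if $\psi^{(1)}(\phi(b))=\zeta(b)$ for all $b\in J_{Y^\varphi}$. The Cuntz-Pimsner algebra $\mathcal O_{Y^\varphi}$ is the $C^*$-algebra generated by a universal Cuntz-Pimsner covariant representation, denoted $(k_{Y^\varphi},k_B)$. The homomorphism $k_B\colon B\to\mathcal O_{Y^\varphi}$ is nondegenerate, and $\overline{k_B}\colon M(B)\to M(\mathcal O_{Y^\varphi})$ is its extension to multipliers. $1$ denotes the identity of $G$. *)

(* Defs.v *)
From HB Require Import structures.
From mathcomp Require Import all_boot all_order all_algebra.
From mathcomp Require Import complex.
From mathcomp Require Import all_classical all_reals all_analysis.

Set Implicit Arguments.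
Unset Strict Implicit.
Unset Printing Implicit Defensive.

Import Order.TTheory GRing.Theory Num.Theory.
Import numFieldNormedType.Exports.

Local Open Scope classical_set_scope.
Local Open Scope ring_scope.

Reserved Notation "a ** b" (at level 40, left associativity).

(* C*-algebras need not be unital, so the product is not that of a ring type. *)
HB.mixin Record isStarAlgebra (R : realType) A of GRing.Lmodule R[i] A := {
  smul : A -> A -> A;
  star : A -> A;
  smulA : forall a b c, smul a (smul b c) = smul (smul a b) c;
  smulDl : forall a b c, smul (a + b) c = smul a c + smul b c;
  smulDr : forall a b c, smul a (b + c) = smul a b + smul a c;
  smulZl : forall (z : R[i]) a b, smul (z *: a) b = z *: smul a b;
  smulZr : forall (z : R[i]) a b, smul a (z *: b) = z *: smul a b;
  starK : forall a, star (star a) = a;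
  starD : forall a b, star (a + b) = star a + star b;
  starZ : forall (z : R[i]) a, star (z *: a) = z^* *: star a;
  starM : forall a b, star (smul a b) = smul (star b) (star a)
}.

#[short(type="starAlgType")]
HB.structure Definition StarAlgebra (R : realType) :=
  {A of GRing.Lmodule R[i] A & isStarAlgebra R A}.

Notation "a ** b" := (smul a b) : ring_scope.

HB.mixin Record StarAlgebra_isCStar (R : realType) A
    of CompleteNormedModule R[i] A & StarAlgebra R A := {
  normsM : forall a b : A, `|a ** b| <= `|a| * `|b|;
  norm_cstar : forall a : A, `|star a ** a| = `|a| ^+ 2
}.

#[short(type="cstarAlgType")]
HB.structure Definition CStarAlgebra (R : realType) :=
  {A of CompleteNormedModule R[i] A & StarAlgebra R A
      & StarAlgebra_isCStar R A}.

(* A *-homomorphism between C*-algebras is automatically norm-decreasing, so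
   no continuity is required. *)
Definition star_hom (R : realType) (A B : starAlgType R) (f : A -> B) :=
  [/\ forall (z : R[i]) x y, f (z *: x + y) = z *: f x + f y,
      forall x y, f (x ** y) = f x ** f y
    & forall x, f (star x) = star (f x)].

Definition sa_pos (R : realType) (A : starAlgType R) (a : A) :=
  exists c, a = star c ** c.

Definition sa_le (R : realType) (A : starAlgType R) (a b : A) := sa_pos (b - a).

Definition projection (R : realType) (A : starAlgType R) (p : A) :=
  star p = p /\ p ** p = p.

Definition partial_isometry (R : realType) (A : starAlgType R) (s : A) :=
  s ** star s ** s = s.

Definition closed_subspace (R : realType) (V : normedModType R[i])
    (W : set V) :=
  [/\ closed W, W 0 & forall (z : R[i]) x y, W x -> W y -> W (z *: x + y)].

Definition closed_span (R : realType) (V : normedModType R[i]) (X : set V) :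
  set V := smallest (@closed_subspace R V) X.

Definition cstar_subalgebra (R : realType) (A : cstarAlgType R) (W : set A) :=
  [/\ closed_subspace W, forall x y, W x -> W y -> W (x ** y)
    & forall x, W x -> W (star x)].

Definition cstar_gen (R : realType) (A : cstarAlgType R) (X : set A) : set A :=
  smallest (@cstar_subalgebra R A) X.

(* Inner products are linear in the second variable. *)
HB.mixin Record isHilbertModule (R : realType) (B : cstarAlgType R) Y
    of CompleteNormedModule R[i] Y := {
  ract : Y -> B -> Y;
  hip : Y -> Y -> B;
  ractA : forall x b c, ract (ract x b) c = ract x (b ** c);
  ractDl : forall x y b, ract (x + y) b = ract x b + ract y b;
  ractDr : forall x b c, ract x (b + c) = ract x b + ract x c;
  ractZl : forall (z : R[i]) x b, ract (z *: x) b = z *: ract x b;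
  ractZr : forall (z : R[i]) x b, ract x (z *: b) = z *: ract x b;
  hipDr : forall x y z, hip x (y + z) = hip x y + hip x z;
  hipZr : forall (z : R[i]) x y, hip x (z *: y) = z *: hip x y;
  hip_ract : forall x y b, hip x (ract y b) = hip x y ** b;
  hip_star : forall x y, star (hip x y) = hip y x;
  hip_pos : forall x, sa_pos (hip x x);
  norm_hip : forall x : Y, `|x| ^+ 2 = `|hip x x|
}.

#[short(type="hilbertModType")]
HB.structure Definition HilbertModule (R : realType) (B : cstarAlgType R) :=
  {Y of CompleteNormedModule R[i] Y & isHilbertModule R B Y}.

Section StarAlgebraTheory.
Variables (R : realType) (A : cstarAlgType R).

Lemma smulr0 (a : A) : a ** 0 = 0.
Proof. by apply: (addrI (a ** 0)); rewrite -smulDr !addr0. Qed.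

Lemma smulrN (a b : A) : a ** (- b) = - (a ** b).
Proof. by apply: (addrI (a ** b)); rewrite -smulDr !subrr smulr0. Qed.

Lemma star_eq0 (a : A) : star a ** a = 0 -> a = 0.
Proof.
move=> h; apply/eqP; rewrite -normr_eq0 -sqrf_eq0 -norm_cstar h normr0.
exact/eqP.
Qed.

End StarAlgebraTheory.

Section HilbertModuleTheory.
Variables (R : realType) (B : cstarAlgType R) (Y : hilbertModType B).
Implicit Types x y z : Y.

Lemma hip0r x : hip x 0 = 0 :> B.
Proof. by apply: (addrI (hip x 0)); rewrite -hipDr !addr0. Qed.

Lemma hipDl x y z : hip (x + y) z = hip x z + hip y z :> B.
Proof. by rewrite -hip_star hipDr starD !hip_star. Qed.

Lemma hipZl (c : R[i]) x y : hip (c *: x) y = c^* *: hip x y :> B.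
Proof. by rewrite -hip_star hipZr starZ !hip_star. Qed.

Lemma hip_inj x y : (forall z, hip z x = hip z y :> B) -> x = y.
Proof.
move=> h; apply/eqP; rewrite -subr_eq0 -normr_eq0 -sqrf_eq0 (norm_hip (s := Y)).
have /eqP : hip (x - y) (x - y) = 0 :> B.
  rewrite hipDr h -hipDr subrr; exact: hip0r.
by rewrite -normr_eq0.
Qed.

End HilbertModuleTheory.

(* An adjointable operator together with its adjoint, which it determines. *)
Record adjop (R : realType) (B : cstarAlgType R) (Y : hilbertModType B) :=
  AdjOp {
    aop :> Y -> Y;
    aadj : Y -> Y;
    _ : forall x y, hip (aop x) y = hip x (aadj y) :> B }.

Section AdjointableOperators.
Variables (R : realType) (B : cstarAlgType R) (Y : hilbertModType B).
Local Notation L := (adjop Y).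
Implicit Types S T : L.

Lemma aopP T x y : hip (T x) y = hip x (aadj T y) :> B.
Proof. by case: T. Qed.

Lemma aadjP T x y : hip (aadj T x) y = hip x (T y) :> B.
Proof. by rewrite -hip_star -aopP hip_star. Qed.

Lemma adjop_ext S T : (forall x, S x = T x) -> S = T.
Proof.
move=> e; have e' : aadj S = aadj T.
  apply/funext => x; apply: (@hip_inj _ _ Y) => z.
  by rewrite -!aopP e.
case: S T e e' => [s s' sP] [t t' tP] /= /funext e e'.
by subst; congr AdjOp; apply: Prop_irrelevance.
Qed.

Lemma aop_linear T (c : R[i]) x y : T (c *: x + y) = c *: T x + T y.
Proof.
apply: (@hip_inj _ _ Y) => z.
by rewrite -aadjP !hipDr !hipZr !aadjP.
Qed.

Lemma aadj_linear T (c : R[i]) x y :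
  aadj T (c *: x + y) = c *: aadj T x + aadj T y.
Proof.
apply: (@hip_inj _ _ Y) => z.
by rewrite -aopP !hipDr !hipZr !aopP.
Qed.

Lemma adj0P x y : hip (0 : Y) y = hip x (0 : Y) :> B.
Proof. by rewrite -hip_star !hip0r -[0 in LHS](scale0r 0) starZ rmorph0 scale0r. Qed.
Definition adj0 : L := AdjOp (fun x y => adj0P x y).

Definition adj1 : L := @AdjOp _ _ Y id id (fun _ _ => erefl).

Lemma adjDP S T x y :
  hip (S x + T x) y = hip x (aadj S y + aadj T y) :> B.
Proof. by rewrite hipDl hipDr !aopP. Qed.
Definition adjD S T : L := AdjOp (adjDP S T).

Lemma adjZP (c : R[i]) T x y : hip (c *: T x) y = hip x (c^* *: aadj T y) :> B.
Proof. by rewrite hipZl hipZr aopP. Qed.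
Definition adjZ c T : L := AdjOp (adjZP c T).

Lemma adjMP S T x y : hip (S (T x)) y = hip x (aadj T (aadj S y)) :> B.
Proof. by rewrite !aopP. Qed.
Definition adjM S T : L := AdjOp (adjMP S T).

Definition adj_star T : L := AdjOp (aadjP T).

HB.instance Definition _ := gen_eqMixin L.
HB.instance Definition _ := gen_choiceMixin L.

Let adjDA : associative adjD.
Proof. by move=> S T U; apply: adjop_ext => x /=; rewrite addrA. Qed.
Let adjDC : commutative adjD.
Proof. by move=> S T; apply: adjop_ext => x /=; rewrite addrC. Qed.
Let adj0D : left_id adj0 adjD.
Proof. by move=> S; apply: adjop_ext => x /=; rewrite add0r. Qed.
Let adjND : left_inverse adj0 (adjZ (- 1)) adjD.
Proof. by move=> S; apply: adjop_ext => x /=; rewrite scaleN1r addNr. Qed.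

HB.instance Definition _ := GRing.isZmodule.Build L adjDA adjDC adj0D adjND.

Let adjZA a b T : adjZ a (adjZ b T) = adjZ (a * b) T.
Proof. by apply: adjop_ext => x /=; rewrite scalerA. Qed.
Let adjZ1 : left_id 1 adjZ.
Proof. by move=> T; apply: adjop_ext => x /=; rewrite scale1r. Qed.
Let adjZDr : right_distributive adjZ +%R.
Proof. by move=> a S T; apply: adjop_ext => x /=; rewrite scalerDr. Qed.
Let adjZDl T : {morph adjZ^~ T : a b / a + b}.
Proof. by move=> a b; apply: adjop_ext => x /=; rewrite scalerDl. Qed.

HB.instance Definition _ :=
  GRing.Zmodule_isLmodule.Build R[i] L adjZA adjZ1 adjZDr adjZDl.

Let adjMA S T U : adjM S (adjM T U) = adjM (adjM S T) U.
Proof. exact: adjop_ext. Qed.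
Let adjMDl S T U : adjM (S + T) U = adjM S U + adjM T U.
Proof. exact: adjop_ext. Qed.
Let adjMDr S T U : adjM S (T + U) = adjM S T + adjM S U.
Proof.
apply: adjop_ext => x /=.
by have := aop_linear S 1 (T x) (U x); rewrite !scale1r.
Qed.
Let adjMZl (z : R[i]) S T : adjM (z *: S) T = z *: adjM S T.
Proof. exact: adjop_ext. Qed.
Let aop0 S : S 0 = 0.
Proof. by have := aop_linear S (- 1) 0 0; rewrite !scaleN1r !addNr. Qed.
Let adjMZr (z : R[i]) S T : adjM S (z *: T) = z *: adjM S T.
Proof.
apply: adjop_ext => x /=.
by have := aop_linear S z (T x) 0; rewrite aop0 !addr0.
Qed.
Let adj_starK S : adj_star (adj_star S) = S.
Proof. exact: adjop_ext. Qed.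
Let adj_starD S T : adj_star (S + T) = adj_star S + adj_star T.
Proof. exact: adjop_ext. Qed.
Let adj_starZ (z : R[i]) S : adj_star (z *: S) = z^* *: adj_star S.
Proof. exact: adjop_ext. Qed.
Let adj_starM S T : adj_star (adjM S T) = adjM (adj_star T) (adj_star S).
Proof. exact: adjop_ext. Qed.

HB.instance Definition _ := isStarAlgebra.Build R L
  adjMA adjMDl adjMDr adjMZl adjMZr adj_starK adj_starD adj_starZ adj_starM.

Lemma thetaP (xi eta x y : Y) :
  hip (ract xi (hip eta x)) y = hip x (ract eta (hip xi y)) :> B.
Proof. by rewrite -hip_star !hip_ract starM !hip_star. Qed.

Definition theta (xi eta : Y) : L :=
  AdjOp (thetaP xi eta).

(* The closure of the span of the [theta xi eta] in the operator norm; scalars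
   are absorbed into [xi]. *)
Definition compact_op : set L := [set T | forall e : R[i], 0 < e ->
  exists s : seq (Y * Y), forall x,
    `|T x - (\sum_(p <- s) theta p.1 p.2 : L) x| <= e * `|x|].

End AdjointableOperators.

Arguments adj1 {R B Y}.

(* [D] as a Hilbert module over itself: [x . b = x b] and [<x, y> = x^* y]. *)
Definition hself (R : realType) (D : cstarAlgType R) : Type := D.

Section SelfModule.
Variables (R : realType) (D : cstarAlgType R).

HB.instance Definition _ := CompleteNormedModule.on (hself D).

Let hsmulA (x b c : D) : x ** b ** c = x ** (b ** c). Proof. by rewrite smulA. Qed.
Let hipDr_ (x y z : D) : star x ** (y + z) = star x ** y + star x ** z.
Proof. by rewrite smulDr. Qed.
Let hipZr_ (c : R[i]) (x y : D) : star x ** (c *: y) = c *: (star x ** y).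
Proof. by rewrite smulZr. Qed.
Let hip_ract_ (x y b : D) : star x ** (y ** b) = star x ** y ** b.
Proof. by rewrite smulA. Qed.
Let hip_star_ (x y : D) : star (star x ** y) = star y ** x.
Proof. by rewrite starM starK. Qed.
Let hip_pos_ (x : D) : sa_pos (star x ** x). Proof. by exists x. Qed.
Let norm_hip_ (x : D) : `|x| ^+ 2 = `|star x ** x|.
Proof. by rewrite norm_cstar. Qed.

HB.instance Definition _ := @isHilbertModule.Build R D (hself D)
  (fun x b => (x : D) ** b) (fun x y => star (x : D) ** (y : D))
  hsmulA (@smulDl _ D) (@smulDr _ D) (@smulZl _ D) (@smulZr _ D)
  hipDr_ hipZr_ hip_ract_ hip_star_ hip_pos_ norm_hip_.

Definition multiplier := adjop (hself D : hilbertModType D).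
HB.instance Definition _ := StarAlgebra.on multiplier.

Lemma toMP (a x y : D) : star (a ** x) ** y = star x ** (star a ** y).
Proof. by rewrite starM smulA. Qed.

(* The inclusion of [D] in its multiplier algebra. *)
Definition toM (a : D) : multiplier :=
  @AdjOp R D (hself D) (fun x => a ** (x : D)) (fun x => star a ** (x : D))
    (toMP a).

(* The element of [D] which the multiplier [m] is, when there is one. *)
Definition fromM (m : multiplier) : D := xget 0 [set a | toM a = m].

End SelfModule.

Definition nondegenerate (R : realType) (A D : cstarAlgType R)
    (X : hilbertModType D) (f : A -> adjop X) :=
  closed_span [set f a x | a in [set: A] & x in [set: X]] = setT.

(* The canonical extension of a nondegenerate *-homomorphism [f] to multiplier
   algebras: [mext f m] is the unique [n] with [n (f a x) = f (m a) x]. A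
   homomorphism [f] into [D] is extended by [mext (toM \o f)]. *)
Definition mext (R : realType) (A D : cstarAlgType R) (X : hilbertModType D)
    (f : A -> adjop X) (m : multiplier A) : adjop X :=
  xget 0 [set n : adjop X | forall a x, n (f a x) = f (m a) x].

Definition unitary_rep (R : realType) (G : groupType) (D : cstarAlgType R)
    (U : G -> multiplier D) :=
  [/\ U 1%g = adj1, forall g h, U (g * h)%g = U g ** U h
    & forall g, star (U g) ** U g = adj1 /\ U g ** star (U g) = adj1].

(* Only the *-algebra structure of [c0 V] is set up: its *-homomorphisms into
   C*-algebras do not depend on a choice of norm, being automatically
   norm-decreasing for the supremum norm. *)
Record c0 (R : realType) (V : choiceType) := C0 {
  c0_fun :> V -> R[i];
  c0P : forall e : R[i], 0 < e -> finite_set [set v | e <= `|c0_fun v|] }.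

Section C0Algebra.
Variables (R : realType) (V : choiceType).
Local Notation A := (c0 R V).
Implicit Types a b : A.

Lemma c0_ext a b : (forall v, a v = b v) -> a = b.
Proof.
case: a b => [a aP] [b bP] /= /funext e; subst.
by congr C0; apply: Prop_irrelevance.
Qed.

Let c0_0P (e : R[i]) : 0 < e -> finite_set [set v : V | e <= `|0 : R[i]|].
Proof.
move=> e0; rewrite (_ : [set _ | _] = set0); first exact: finite_set0.
by rewrite -subset0 => v /=; rewrite normr0 lt_geF.
Qed.
Definition c0_0 : A := C0 c0_0P.

Let c0_addP a b (e : R[i]) : 0 < e -> finite_set [set v | e <= `|a v + b v|].
Proof.
move=> e0; have e20 : 0 < e / 2 by rewrite divr_gt0.
apply: (sub_finite_set _ (_ : finite_set
  ([set v | e / 2 <= `|a v|] `|` [set v | e / 2 <= `|b v|]))); last first.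
  by rewrite finite_setU; split; apply: c0P.
move=> v /= ev; apply/orP; apply/negPn/negP; rewrite negb_or.
rewrite -!real_ltNge ?normr_real ?real1 ?(gtr0_real e0) ?(gtr0_real e20)// => /andP[av bv].
have := le_lt_trans (ler_normD (a v) (b v)) (ltrD av bv).
by rewrite -splitr => /lt_geF; rewrite ev.
Qed.
Definition c0_add a b : A := C0 (@c0_addP a b).

Let c0_mulP a b (e : R[i]) : 0 < e -> finite_set [set v | e <= `|a v * b v|].
Proof.
move=> e0; apply: (sub_finite_set _ (_ : finite_set
  ([set v | e <= `|a v|] `|` [set v | 1 <= `|b v|]))); last first.
  by rewrite finite_setU; split; apply: c0P.
move=> v /= ev; apply/orP; apply/negPn/negP; rewrite negb_or.
rewrite -!real_ltNge ?normr_real ?real1 ?(gtr0_real e0)// => /andP[av bv].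
move: ev; rewrite normrM lt_geF// -[ltRHS]mulr1.
by rewrite ltr_pM ?normr_ge0.
Qed.
Definition c0_mul a b : A := C0 (@c0_mulP a b).

Let c0_scaleP (z : R[i]) a (e : R[i]) :
  0 < e -> finite_set [set v | e <= `|z * a v|].
Proof.
move=> e0; have z0 : 0 < `|z| + 1 by rewrite ltr_wpDl.
apply: (sub_finite_set _ (_ : finite_set [set v | e / (`|z| + 1) <= `|a v|])).
  move=> v /= ev; rewrite ler_pdivrMr// (le_trans ev)// normrM mulrC.
  by rewrite ler_wpM2l// lerDl.
by apply: c0P; rewrite divr_gt0.
Qed.
Definition c0_scale z a : A := C0 (@c0_scaleP z a).

Let c0_starP a (e : R[i]) : 0 < e -> finite_set [set v | e <= `|(a v)^*|].
Proof.
move=> e0; apply: sub_finite_set (c0P a e0) => v /=.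
by rewrite norm_conjC.
Qed.
Definition c0_star a : A := C0 (@c0_starP a).

HB.instance Definition _ := gen_eqMixin A.
HB.instance Definition _ := gen_choiceMixin A.

Let c0_addA : associative c0_add.
Proof. by move=> a b c; apply: c0_ext => v /=; rewrite addrA. Qed.
Let c0_addC : commutative c0_add.
Proof. by move=> a b; apply: c0_ext => v /=; rewrite addrC. Qed.
Let c0_add0 : left_id c0_0 c0_add.
Proof. by move=> a; apply: c0_ext => v /=; rewrite add0r. Qed.
Let c0_addN : left_inverse c0_0 (c0_scale (- 1)) c0_add.
Proof. by move=> a; apply: c0_ext => v /=; rewrite mulN1r addNr. Qed.

HB.instance Definition _ :=
  GRing.isZmodule.Build A c0_addA c0_addC c0_add0 c0_addN.

Let c0_scaleA x y a : c0_scale x (c0_scale y a) = c0_scale (x * y) a.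
Proof. by apply: c0_ext => v /=; rewrite mulrA. Qed.
Let c0_scale1 : left_id 1 c0_scale.
Proof. by move=> a; apply: c0_ext => v /=; rewrite mul1r. Qed.
Let c0_scaleDr : right_distributive c0_scale +%R.
Proof. by move=> x a b; apply: c0_ext => v /=; rewrite mulrDr. Qed.
Let c0_scaleDl a : {morph c0_scale^~ a : x y / x + y}.
Proof. by move=> x y; apply: c0_ext => v /=; rewrite mulrDl. Qed.

HB.instance Definition _ := GRing.Zmodule_isLmodule.Build R[i] A
  c0_scaleA c0_scale1 c0_scaleDr c0_scaleDl.

Let c0_mulA a b c : c0_mul a (c0_mul b c) = c0_mul (c0_mul a b) c.
Proof. by apply: c0_ext => v /=; rewrite mulrA. Qed.
Let c0_mulDl a b c : c0_mul (a + b) c = c0_mul a c + c0_mul b c.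
Proof. by apply: c0_ext => v /=; rewrite mulrDl. Qed.
Let c0_mulDr a b c : c0_mul a (b + c) = c0_mul a b + c0_mul a c.
Proof. by apply: c0_ext => v /=; rewrite mulrDr. Qed.
Let c0_mulZl (z : R[i]) a b : c0_mul (z *: a) b = z *: c0_mul a b.
Proof. by apply: c0_ext => v /=; rewrite mulrA. Qed.
Let c0_mulZr (z : R[i]) a b : c0_mul a (z *: b) = z *: c0_mul a b.
Proof. by apply: c0_ext => v /=; rewrite mulrCA. Qed.
Let c0_starK a : c0_star (c0_star a) = a.
Proof. by apply: c0_ext => v /=; rewrite conjCK. Qed.
Let c0_starD a b : c0_star (a + b) = c0_star a + c0_star b.
Proof. by apply: c0_ext => v /=; rewrite rmorphD. Qed.
Let c0_starZ (z : R[i]) a : c0_star (z *: a) = z^* *: c0_star a.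
Proof. by apply: c0_ext => v /=; rewrite rmorphM. Qed.
Let c0_starM a b : c0_star (c0_mul a b) = c0_mul (c0_star b) (c0_star a).
Proof. by apply: c0_ext => v /=; rewrite rmorphM mulrC. Qed.

HB.instance Definition _ := isStarAlgebra.Build R A
  c0_mulA c0_mulDl c0_mulDr c0_mulZl c0_mulZr
  c0_starK c0_starD c0_starZ c0_starM.

Let c0_deltaP (v : V) (e : R[i]) :
  0 < e -> finite_set [set w | e <= `|(w == v)%:R : R[i]|].
Proof.
move=> e0; apply: (sub_finite_set _ (finite_set1 v)) => w /=.
by case: eqP => // _; rewrite normr0 lt_geF.
Qed.
Definition c0_delta (v : V) : A := C0 (@c0_deltaP v).

End C0Algebra.

Record digraph := Digraph {
  vert : choiceType;
  edge : choiceType;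
  rng : edge -> vert;
  src : edge -> vert }.

Definition row_finite (E : digraph) :=
  forall v : vert E, finite_set [set e | rng e = v].

Definition is_action (G : groupType) (X : Type) (act : G -> X -> X) :=
  (forall x, act 1%g x = x) /\
  (forall g h x, act (g * h)%g x = act g (act h x)).

Record digraph_action (G : groupType) (E : digraph) := DigraphAction {
  actv : G -> vert E -> vert E;
  acte : G -> edge E -> edge E;
  actv_action : is_action actv;
  acte_action : is_action acte;
  rng_act : forall g e, rng (acte g e) = actv g (rng e);
  src_act : forall g e, src (acte g e) = actv g (src e) }.

Definition is_cocycle (G : groupType) (E : digraph) (act : digraph_action G E)
    (phi : G -> edge E -> G) :=
  (forall g h e, phi (g * h)%g e = (phi g (acte act h e) * phi h e)%g) /\
  (forall g e, actv act (phi g e) (src e) = actv act g (src e)).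

Section C0Action.
Variables (R : realType) (G : groupType) (E : digraph).
Variable act : digraph_action G E.

Let c0_actP (g : G) (a : c0 R (vert E)) (e : R[i]) :
  0 < e -> finite_set [set v | e <= `|a (actv act g^-1%g v)|].
Proof.
move=> e0; have [act1 actM] := actv_action act.
apply: (@finite_preimage _ _ [set v | e <= `|a v|] (actv act g^-1%g));
  last exact: c0P.
move=> v w _ _ /(congr1 (actv act g)).
by rewrite -!actM mulgV !act1.
Qed.
Definition c0_act (g : G) (a : c0 R (vert E)) : c0 R (vert E) := C0 (@c0_actP g a).

End C0Action.

Section CrossedProduct.
Variables (R : realType) (G : groupType) (A : starAlgType R).
Variable alpha : G -> A -> A.

Definition covariant_hom (D : cstarAlgType R)
    (pi : A -> multiplier D) (U : G -> multiplier D) :=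
  [/\ star_hom pi,
      closed_span [set pi a d | a in [set: A] & d in [set: hself D]] = setT,
      unitary_rep U
    & forall g a, pi (alpha g a) = U g ** pi a ** star (U g)].

(* As [G] is discrete, the products [iA a ** iG g] lie in [B]. *)
Definition is_crossed_product (B : cstarAlgType R)
    (iA : A -> multiplier B) (iG : G -> multiplier B) :=
  [/\ covariant_hom iA iG,
      forall a g, exists b, toM b = iA a ** iG g,
      closed_span [set fromM (iA a ** iG g) | a in [set: A] & g in [set: G]]
        = setT
    & forall (D : cstarAlgType R) (pi : A -> multiplier D)
        (U : G -> multiplier D), covariant_hom pi U ->
      exists f : B -> multiplier D,
        [/\ star_hom f, nondegenerate f,
            forall a, mext f (iA a) = pi a
          & forall g, mext f (iG g) = U g] ].

End CrossedProduct.

(* A correspondence is a Hilbert module [Y] over [B] with a *-homomorphism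
   [phi : B -> adjop Y]. *)
Section CuntzPimsner.
Variables (R : realType) (B : cstarAlgType R) (Y : hilbertModType B).
Variable phi : B -> adjop Y.

Definition toeplitz_rep (D : cstarAlgType R) (psi : Y -> D) (zeta : B -> D) :=
  [/\ forall (z : R[i]) x y, psi (z *: x + y) = z *: psi x + psi y,
      star_hom zeta,
      forall x y, star (psi x) ** psi y = zeta (hip x y)
    & forall b x, zeta b ** psi x = psi (phi b x)].

(* [psi1] is only meaningful on compact operators. *)
Definition compact_extension (D : cstarAlgType R) (psi : Y -> D)
    (psi1 : adjop Y -> D) :=
  [/\ forall (z : R[i]) S T, compact_op S -> compact_op T ->
        psi1 (z *: S + T) = z *: psi1 S + psi1 T,
      forall S T, compact_op S -> compact_op T ->
        psi1 (S ** T) = psi1 S ** psi1 T,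
      forall S, compact_op S -> psi1 (star S) = star (psi1 S)
    & forall x y, psi1 (theta x y) = psi x ** star (psi y)].

Definition katsura_ideal : set B :=
  [set b | compact_op (phi b) /\ forall c, phi c = 0 -> b ** c = 0].

Definition cp_covariant_rep (D : cstarAlgType R) (psi : Y -> D) (zeta : B -> D) :=
  toeplitz_rep psi zeta /\
  exists psi1, compact_extension psi psi1 /\
    forall b, katsura_ideal b -> psi1 (phi b) = zeta b.

Definition is_cuntz_pimsner (O : cstarAlgType R) (kY : Y -> O) (kB : B -> O) :=
  [/\ cp_covariant_rep kY kB,
      cstar_gen (range kY `|` range kB) = setT
    & forall (D : cstarAlgType R) (psi : Y -> D) (zeta : B -> D),
        cp_covariant_rep psi zeta ->
        exists f : O -> D,
          [/\ star_hom f, forall x, f (kY x) = psi x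
            & forall b, f (kB b) = zeta b] ].

End CuntzPimsner.

Section GraphCocycle.
Variables (R : realType) (G : groupType) (E : digraph).
Variables (act : digraph_action G E) (phi : G -> edge E -> G).

Definition cp_delta (B : cstarAlgType R) (iA : c0 R (vert E) -> multiplier B)
    (iG : G -> multiplier B) (v : vert E) (g : G) : B :=
  fromM (iA (c0_delta R v) ** iG g).

(* [Y], with left action [lact] and elements [chi e g], is the completion of
   $C_c(E^1 \times G)$, where [chi e g] is the image of the characteristic
   function of $\{(e, g)\}$. *)
Definition is_cocycle_correspondence (B : cstarAlgType R)
    (iA : c0 R (vert E) -> multiplier B) (iG : G -> multiplier B)
    (Y : hilbertModType B) (lact : B -> adjop Y) (chi : edge E -> G -> Y) :=
  let delta := cp_delta iA iG in
  [/\ star_hom lact,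
      closed_span [set chi e g | e in [set: edge E] & g in [set: G]] = setT,
      forall e e' g h, hip (chi e g) (chi e' h) =
        (if e == e' then delta (actv act g^-1%g (src e)) (g^-1 * h)%g else 0),
      forall e h v g, ract (chi e h) (delta v g) =
        (if src e == actv act h v then chi e (h * g)%g else 0)
    & forall v g e h, lact (delta v g) (chi e h) =
        (if v == rng (acte act g e) then chi (acte act g e) (phi g e * h)%g
         else 0)].

Definition cuntz_krieger_family (D : cstarAlgType R)
    (P : vert E -> D) (S : edge E -> D) :=
  [/\ (forall v, projection (P v)) /\ (forall v w, v != w -> P v ** P w = 0),
      forall e, partial_isometry (S e),
      forall e, star (S e) ** S e = P (src e),
      forall v (F : set (edge E)), finite_set F -> F `<=` [set e | rng e = v] ->
        sa_le (\sum_(e \in F) (S e ** star (S e))) (P v)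
    & forall v, finite_set [set e : edge E | rng e = v] ->
        [set e : edge E | rng e = v] !=set0 ->
        P v = \sum_(e \in [set e | rng e = v]) (S e ** star (S e))].

Definition CK_representation (D : cstarAlgType R)
    (P : vert E -> D) (S : edge E -> D) (U : G -> multiplier D) :=
  [/\ cuntz_krieger_family P S,
      unitary_rep U,
      forall g v, U g ** toM (P v) = toM (P (actv act g v)) ** U g,
      forall g e, U g ** toM (S e) = toM (S (acte act g e)) ** U (phi g e)
    & cstar_gen
        ([set fromM (toM (P v) ** U g) | v in [set: vert E] & g in [set: G]] `|`
         [set fromM (toM (S e) ** U g) | e in [set: edge E] & g in [set: G]])
        = setT].

End GraphCocycle.

(* Main.v *)
Require Import Defs.
From mathcomp Require Import all_boot all_order all_algebra.
From mathcomp Require Import complex finmap ring lra zify.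
From mathcomp Require Import cyclotomic separable cyclic.
From mathcomp Require Import all_classical all_reals all_analysis.

Set Implicit Arguments.
Unset Strict Implicit.
Unset Printing Implicit Defensive.

Import Order.TTheory GRing.Theory Num.Theory.
Import numFieldNormedType.Exports.

Local Open Scope classical_set_scope.
Local Open Scope ring_scope.

(** The homomorphism comes from two universal properties, and its uniqueness
    from the generators of [O].

    The Cuntz-Krieger relations make the [P v] orthogonal projections, so [a] in
    [c0] acts on [D] by the norm convergent sum of the [a v *: P v] ([c0_sum]).
    With the unitaries [U g] this is a covariant pair, which integrates to a
    homomorphism [zeta] from [B] to [D] ([crossed_product_rep]). The rule [psi
    (chi e g) = S e U g] is compatible with inner products, because distinct
    edges have orthogonal range projections ([ck_orth]), and extends to a
    Toeplitz representation of [Y]. It is Cuntz-Pimsner covariant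
    ([covariant_of_local], [toeplitz_rep_of_CK]): for [b] in the Katsura ideal,
    compare the two sides after multiplication by each [P v]. If [v] receives no
    edge, then [lact] kills the projection [delta v], hence so does [b], and
    both sides vanish. Otherwise row-finiteness makes [P v] the finite sum of
    the [S f ** star (S f)] over the edges [f] into [v], and both sides are the
    sum of the [psi (lact b (chi f 1)) ** star (S f)].

    The universal property of [O] now gives [Phi]. Its range is closed and
    contains the generators of [D]. Conversely the prescribed values determine a
    homomorphism: its value at the image of [a] in [c0] is found from its
    products with the [P v], the unitaries give its values on [B], and [chi e g]
    is [chi e 1] times an element of [B] ([pimsner_hom_eq], [pimsner_hom_elt]).

    The facts about C*-algebras behind this are proved from the C*-identity and
    completeness, without spectra or positive elements. Homomorphisms are
    bounded because a self-adjoint contraction is the real part of a unitary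
    ([cos_sin_contraction], with a square root found as a fixed point). Their
    ranges are closed because [h (1 + i h)^-1] is a bounded element whose image
    is close to a small image of [h] ([star_hom_closed_range]). Projections with
    sum a projection are orthogonal because the unit is an extreme point of the
    unit ball ([one_extreme], [compressed_sum_eq0]). The map on compact
    operators induced by [psi] is bounded because the norm of a self-adjoint
    element is the growth rate of its powers ([spow_growth],
    [rank_one_sum_bound]). *)

(** * Norms with real values, limits and fixed points *)

Section RealNorm.
Variable R : realType.

(** Norms of complex spaces have values in [R[i]], whose order is partial; the
    estimates below are carried out in the totally ordered field [R]. *)
Definition nrm (V : normedZmodType R[i]) (x : V) : R := complex.Re `|x|.

Lemma nrmE (V : normedZmodType R[i]) (x : V) : `|x| = (nrm x)%:C%C.
Proof. by rewrite /nrm RRe_real// normr_real. Qed.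

Variable V : normedZmodType R[i].
Implicit Types x y z : V.

Lemma nrm_ge0 x : 0 <= nrm x.
Proof. by rewrite -lecR -nrmE; exact: normr_ge0. Qed.

Lemma nrm0 : nrm (0 : V) = 0.
Proof. by rewrite /nrm normr0. Qed.

Lemma nrm_eq0 x : nrm x = 0 -> x = 0.
Proof. by move=> h; apply/normr0_eq0; rewrite nrmE h. Qed.

Lemma nrmD x y : nrm (x + y) <= nrm x + nrm y.
Proof. by rewrite -lecR rmorphD /= -!nrmE ler_normD. Qed.

Lemma nrmN x : nrm (- x) = nrm x.
Proof. by rewrite /nrm normrN. Qed.

Lemma nrmC x y : nrm (x - y) = nrm (y - x).
Proof. by rewrite -nrmN opprB. Qed.

Lemma nrmB x y : nrm (x - y) <= nrm x + nrm y.
Proof. by rewrite -[nrm y]nrmN nrmD. Qed.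

Lemma nrm_tri x y z : nrm (x - z) <= nrm (x - y) + nrm (y - z).
Proof. by have := nrmD (x - y) (y - z); rewrite addrA subrK. Qed.

Lemma nrm_le_sub x y : nrm x <= nrm (x - y) + nrm y.
Proof. by have := nrmD (x - y) y; rewrite subrK. Qed.

Lemma nrm_sum (I : Type) (s : seq I) (F : I -> V) :
  nrm (\sum_(i <- s) F i) <= \sum_(i <- s) nrm (F i).
Proof.
elim: s => [|i s ih]; first by rewrite !big_nil nrm0.
by rewrite !big_cons; apply: (le_trans (nrmD _ _)); rewrite lerD2l.
Qed.

Lemma nrm_small x (C : R) : 0 <= C ->
  (forall e : R, 0 < e -> nrm x <= C * e) -> x = 0.
Proof.
move=> C0 h; apply: nrm_eq0; apply/eqP; rewrite eq_le nrm_ge0 andbT.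
apply/ler_addgt0Pr => e e0; rewrite add0r.
have C1 : 0 < C + 1 by rewrite ltr_wpDl.
apply: (le_trans (h (e / (C + 1)) _)); first by rewrite divr_gt0.
by rewrite mulrCA ler_piMr ?(ltW e0)// ler_pdivrMr// mul1r lerDl.
Qed.

Lemma nrm_gt0 x : x != 0 -> 0 < nrm x.
Proof.
by move=> x0; rewrite lt_def nrm_ge0 andbT; apply: contra_neq x0; exact: nrm_eq0.
Qed.

End RealNorm.

Section NormedSpace.
Variables (R : realType) (V : normedModType R[i]).
Implicit Types x y z : V.

Lemma nrmZ (c : R[i]) x : nrm (c *: x) = nrm c * nrm x.
Proof.
apply: (@complexI R) => /=; rewrite rmorphM /= -!nrmE.
by rewrite normrZ.
Qed.

Lemma nrmRC (a : R) : nrm (a%:C%C : R[i]) = `|a|.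
Proof.
apply: (@complexI R) => /=; rewrite -nrmE normc_def/= expr0n/= addr0.
by rewrite sqrtr_sqr.
Qed.

Lemma nrmZR (c : R) x : nrm (c%:C%C *: x) = `|c| * nrm x.
Proof. by rewrite nrmZ nrmRC. Qed.

Lemma nrm1 : nrm (1 : R[i]) = 1.
Proof. by rewrite /nrm normr1. Qed.

Lemma nrmi : nrm ('i%C : R[i]) = 1.
Proof.
apply: (@complexI R) => /=; rewrite -nrmE normc_def/= expr0n/= add0r.
by rewrite expr1n sqrtr1.
Qed.

Lemma nrmZi x : nrm ('i%C *: x) = nrm x.
Proof. by rewrite nrmZ nrmi mul1r. Qed.

Lemma nrmMc (a b : R[i]) : nrm (a * b) = nrm a * nrm b.
Proof. by apply: (@complexI R) => /=; rewrite rmorphM /= -!nrmE normrM. Qed.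

Lemma nrm_conj (a : R[i]) : nrm (a^*) = nrm a.
Proof. by rewrite /nrm norm_conjC. Qed.

Lemma closed_nrm (W : set V) :
  (forall x, (forall e : R, 0 < e -> exists2 w, W w & nrm (x - w) < e) -> W x) ->
  closed W.
Proof.
move=> h x clx; apply: h => e e0.
have e0C : 0 < e%:C%C by have := e0; rewrite -ltcR.
have /clx [w [Ww]] : nbhs x (ball x e%:C%C) by exact: nbhsx_ballx.
rewrite -ball_normE /= => bw; exists w => //.
by rewrite -ltcR -nrmE.
Qed.

Lemma nrm_closed (W : set V) x : closed W ->
  (forall e : R, 0 < e -> exists2 w, W w & nrm (x - w) < e) -> W x.
Proof.
move=> cW h; apply: cW => B /nbhs_ballP [e e0 eB].
have er : e = (complex.Re e)%:C%C by rewrite RRe_real// gtr0_real.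
have [|w Ww xw] := h (complex.Re e).
  by rewrite -ltcR -er.
exists w; split=> //; apply: eB; rewrite -ball_normE /=.
by rewrite nrmE er ltcR.
Qed.

End NormedSpace.

Section Complete.
Variables (R : realType) (V : completeNormedModType R[i]).

Lemma nrm_cauchy (u : nat -> V) :
  (forall e : R, 0 < e -> exists N, forall m n, (N <= m)%N -> (N <= n)%N ->
     nrm (u m - u n) < e) ->
  exists l, forall e : R, 0 < e -> exists N, forall n, (N <= n)%N ->
    nrm (l - u n) < e.
Proof.
move=> cu.
have /cvg_ex [l ul] : cvg (u @ \oo).
  apply: cauchy_cvg; apply: cauchy_exP => e e0.
  have er : e = (complex.Re e)%:C%C by rewrite RRe_real// gtr0_real.
  have [|N hN] := cu (complex.Re e); first by rewrite -ltcR -er.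
  exists (u N); exists N => // n /= Nn.
  by rewrite -ball_normE /= nrmE er ltcR; apply: hN.
exists l => e e0.
have e0C : 0 < e%:C%C by have := e0; rewrite -ltcR.
have /ul [N _ hN] : nbhs l (ball l e%:C%C) by exact: nbhsx_ballx.
exists N => n Nn; have := hN n Nn.
by rewrite /= -ball_normE /= nrmE ltcR.
Qed.

Lemma geometric_small (C e : R) (q : R) : 0 <= q < 1 -> 0 < e -> 0 <= C ->
  exists N, forall n, (N <= n)%N -> C * q ^+ n < e.
Proof.
move=> /andP[q0 q1] e0 C0.
have q01 : `|q| < 1 by rewrite ger0_norm.
have /cvgrPdist_lt h := cvg_expr q01.
have [|N _ hN] := h (e / (C + 1)); first by rewrite divr_gt0// ltr_wpDl.
exists N => n /hN /=; rewrite sub0r normrN normrX ger0_norm// => {}h.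
rewrite (le_lt_trans (_ : _ <= (C + 1) * q ^+ n))//.
  by rewrite ler_wpM2r ?exprn_ge0// lerDl.
by rewrite mulrC -ltr_pdivlMr// ltr_wpDl.
Qed.

Lemma geometric_cauchy_limit (u : nat -> V) (C q : R) : 0 <= q < 1 -> 0 <= C ->
  (forall n, nrm (u n.+1 - u n) <= C * q ^+ n) ->
  exists l, forall n, nrm (l - u n) <= C / (1 - q) * q ^+ n.
Proof.
move=> /andP[q0 q1] C0 hu.
have q10 : 0 < 1 - q by rewrite subr_gt0.
have C' : 0 <= C / (1 - q) by rewrite divr_ge0// ltW.
have hk n k : nrm (u (n + k)%N - u n) <= C / (1 - q) * (q ^+ n - q ^+ (n + k)).
  elim: k => [|k ih]; first by rewrite addn0 !subrr nrm0 mulr0.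
  rewrite addnS; apply: (le_trans (nrm_tri _ (u (n + k)%N) _)).
  apply: (le_trans (lerD (hu _) ih)).
  rewrite exprS (_ : C * _ = C / (1 - q) * ((1 - q) * q ^+ (n + k))); last first.
    by rewrite mulrA divfK// gt_eqF.
  by rewrite -mulrDr ler_wpM2l//; lra.
have hm n m : (n <= m)%N -> nrm (u m - u n) <= C / (1 - q) * q ^+ n.
  move=> nm; rewrite -(subnKC nm); apply: (le_trans (hk _ _)).
  by rewrite ler_wpM2l// gerBl exprn_ge0.
have [|l hl] := @nrm_cauchy u.
  move=> e e0; have [|N hN] := @geometric_small (C / (1 - q)) e q _ e0 C'.
    by rewrite q0.
  exists N => m n Nm Nn; have [mn|/ltnW nm] := leqP m n.
    by rewrite nrmC; apply: le_lt_trans (hm _ _ mn) (hN _ Nm).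
  by apply: le_lt_trans (hm _ _ nm) (hN _ Nn).
exists l => n; apply/ler_addgt0Pr => e e0.
have [N hN] := hl e e0.
apply: (le_trans (nrm_tri _ (u (maxn N n)) _)); rewrite addrC lerD//.
  by apply: hm; rewrite leq_maxr.
by apply/ltW/hN; rewrite leq_maxl.
Qed.

(** Continuous extensions, sums over vertices and the map on compact operators
    are all limits of values [val s] at approximants [s] of an object, where
    [near e s] says that [s] approximates it up to [e]. The last premise makes
    the limit independent of the choice of approximants. *)
Lemma approximation_limit (S : Type) (near : R -> S -> Prop) (val : S -> V) (C : R) :
  0 <= C ->
  (forall e, 0 < e -> exists s, near e s) ->
  (forall e e' s s', near e s -> near e' s' ->
     nrm (val s - val s') <= C * (e + e')) ->
  exists l, forall e s, near e s -> nrm (l - val s) <= C * e.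
Proof.
move=> C0 ex cl.
have pos n : 0 < (2^-1 : R) ^+ n by rewrite exprn_gt0// invr_gt0.
pose s n := projT1 (cid (ex _ (pos n))).
have hs n : near (2^-1 ^+ n) (s n) by rewrite /s; case: cid.
have h2 : 0 <= (2^-1 : R) < 1 by rewrite invr_ge0 invf_lt1//=; lra.
have [|n|l hl] := @geometric_cauchy_limit (val \o s) (C * 2) 2^-1 h2.
- by rewrite mulr_ge0.
- apply: (le_trans (cl _ _ _ _ (hs n.+1) (hs n))).
  rewrite -mulrA ler_wpM2l// exprS.
  have := pos n; lra.
exists l => e t ht; apply/ler_addgt0Pr => d d0.
have C40 : 0 <= C * 2 / (1 - 2^-1) + C.
  by rewrite addr_ge0// divr_ge0 ?mulr_ge0//; lra.
have [N /(_ N (leqnn N)) hN] := geometric_small h2 d0 C40.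
apply: (le_trans (nrm_tri _ (val (s N)) _)).
apply: (le_trans (lerD (hl N) (cl _ _ _ _ (hs N) ht))).
move: hN; rewrite mulrDl mulrDr; lra.
Qed.

(** Square roots and inverses are obtained as fixed points, by this form of the
    Banach principle. *)
Lemma contraction_fixpoint (F : V -> V) (I : set V) (x0 : V) (q : R) :
  0 <= q < 1 -> I x0 -> (forall x, I x -> I (F x)) ->
  (forall x, (forall e : R, 0 < e -> exists2 w, I w & nrm (x - w) < e) -> I x) ->
  (forall x y, I x -> I y -> nrm (F x - F y) <= q * nrm (x - y)) ->
  exists2 x, I x & F x = x.
Proof.
move=> q01 I0 IF cI cF.
have [q0 q1] := andP q01.
pose u n := iter n F x0.
have Iu n : I (u n) by elim: n => //= n; apply: IF.
have C0 := nrm_ge0 (u 1%N - u 0%N).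
have [n|l hl] := geometric_cauchy_limit q01 C0 (u := u).
  elim: n => [|n ih]; first by rewrite expr0 mulr1.
  rewrite (le_trans (cF _ _ (Iu n.+1) (Iu n)))// exprS mulrCA.
  by rewrite ler_wpM2l.
set C := _ / _ in hl.
have C1 : 0 <= C by rewrite divr_ge0// subr_ge0 ltW.
have Il : I l.
  apply: cI => e e0; have [N /(_ N (leqnn N)) hN] := geometric_small q01 e0 C1.
  by exists (u N) => //; apply: le_lt_trans (hl _) hN.
exists l => //; apply/eqP; rewrite -subr_eq0; apply/eqP/nrm_eq0/eqP.
rewrite eq_le nrm_ge0 andbT; apply/ler_addgt0Pr => e e0; rewrite add0r.
have e2 : 0 < e / 2 by rewrite divr_gt0.
have [N /(_ N (leqnn N)) hN] := geometric_small q01 e2 C1.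
apply: (le_trans (nrm_tri _ (u N.+1) _)).
rewrite [nrm (u _ - l)]nrmC.
have h1 := cF _ _ Il (Iu N).
have h2 := hl N; have h3 := hl N.+1.
have h4 : q * nrm (l - u N) <= nrm (l - u N).
  by rewrite ler_piMl ?nrm_ge0// ltW.
have h5 : C * q ^+ N.+1 <= C * q ^+ N.
  by rewrite ler_wpM2l// exprS ler_piMl// ?exprn_ge0// ltW.
rewrite /= in h1 h2 h3 h4 *; lra.
Qed.

End Complete.

(** * Norms in C*-algebras and bounded linear maps *)

Section StarAlgebraFacts.
Variables (R : realType) (A : starAlgType R).
Implicit Types (a b c : A).

Lemma smul0r a : a ** 0 = 0.
Proof. by apply: (addrI (a ** 0)); rewrite -smulDr !addr0. Qed.

Lemma smul0l a : 0 ** a = 0.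
Proof. by apply: (addrI (0 ** a)); rewrite -smulDl !addr0. Qed.

Lemma smulNr a b : a ** (- b) = - (a ** b).
Proof. by apply: (addrI (a ** b)); rewrite -smulDr !subrr smul0r. Qed.

Lemma smulNl a b : (- a) ** b = - (a ** b).
Proof. by apply: (addrI (a ** b)); rewrite -smulDl !subrr smul0l. Qed.

Lemma smulBr a b c : a ** (b - c) = a ** b - a ** c.
Proof. by rewrite smulDr smulNr. Qed.

Lemma smulBl a b c : (a - b) ** c = a ** c - b ** c.
Proof. by rewrite smulDl smulNl. Qed.

Lemma smul_sumr (I : Type) (s : seq I) a (F : I -> A) :
  a ** (\sum_(i <- s) F i) = \sum_(i <- s) a ** F i.
Proof.
by elim: s => [|i s ih]; rewrite ?big_nil ?smul0r// !big_cons smulDr ih.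
Qed.

Lemma smul_suml (I : Type) (s : seq I) a (F : I -> A) :
  (\sum_(i <- s) F i) ** a = \sum_(i <- s) F i ** a.
Proof.
by elim: s => [|i s ih]; rewrite ?big_nil ?smul0l// !big_cons smulDl ih.
Qed.

Lemma star0 : star (0 : A) = 0.
Proof. by apply: (addrI (star 0)); rewrite -starD !addr0. Qed.

Lemma starN a : star (- a) = - star a.
Proof. by apply: (addrI (star a)); rewrite -starD !subrr star0. Qed.

Lemma starB a b : star (a - b) = star a - star b.
Proof. by rewrite starD starN. Qed.

Lemma star_sum (I : Type) (s : seq I) (F : I -> A) :
  star (\sum_(i <- s) F i) = \sum_(i <- s) star (F i).
Proof.
by elim: s => [|i s ih]; rewrite ?big_nil ?star0// !big_cons starD ih.
Qed.

Lemma star_inj a b : star a = star b -> a = b.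
Proof. by move=> h; rewrite -[a]starK h starK. Qed.

End StarAlgebraFacts.

Section CStarNorm.
Variables (R : realType) (A : cstarAlgType R).
Implicit Types (a b c : A).

Lemma nrmM a b : nrm (a ** b) <= nrm a * nrm b.
Proof. by rewrite -lecR rmorphM /= -!nrmE; exact: normsM. Qed.

Lemma nrm_cstar a : nrm (star a ** a) = nrm a ^+ 2.
Proof. by apply: (@complexI R); rewrite rmorphXn /= -!nrmE; exact: norm_cstar. Qed.

Lemma nrm_star a : nrm (star a) = nrm a.
Proof.
suff h b : nrm b <= nrm (star b).
  by apply/le_anti; rewrite h andbT -{2}[a]starK h.
have [->|b0] := eqVneq b 0; first by rewrite star0.
have b0' := nrm_gt0 b0.
by rewrite -(ler_pM2r b0') -expr2 -nrm_cstar nrmM.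
Qed.

Lemma nrm_cstar' a : nrm (a ** star a) = nrm a ^+ 2.
Proof. by rewrite -{1}[a]starK nrm_cstar nrm_star. Qed.

End CStarNorm.

Section BoundedLinear.
Variable R : realType.

Definition linear_map (V W : normedModType R[i]) (F : V -> W) :=
  forall (z : R[i]) x y, F (z *: x + y) = z *: F x + F y.

Definition bounded_linear (V W : normedModType R[i]) (F : V -> W) :=
  linear_map F /\ exists2 C, 0 <= C & forall x, nrm (F x) <= C * nrm x.

Section Lin.
Variables (V W : normedModType R[i]) (F : V -> W) (lF : linear_map F).

Lemma lin0 : F 0 = 0.
Proof. by have := lF (- 1) 0 0; rewrite !scaleN1r !addNr. Qed.

Lemma linD x y : F (x + y) = F x + F y.
Proof. by have := lF 1 x y; rewrite !scale1r. Qed.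

Lemma linZ z x : F (z *: x) = z *: F x.
Proof. by have := lF z x 0; rewrite lin0 !addr0. Qed.

Lemma linN x : F (- x) = - F x.
Proof. by rewrite -scaleN1r linZ scaleN1r. Qed.

Lemma linB x y : F (x - y) = F x - F y.
Proof. by rewrite linD linN. Qed.

Lemma lin_sum (I : Type) (s : seq I) (G : I -> V) :
  F (\sum_(i <- s) G i) = \sum_(i <- s) F (G i).
Proof.
by elim: s => [|i s ih]; rewrite ?big_nil ?lin0// !big_cons linD ih.
Qed.

End Lin.

Lemma bounded_linear_comp (V W X : normedModType R[i]) (F : V -> W)
    (G : W -> X) :
  bounded_linear F -> bounded_linear G -> bounded_linear (G \o F).
Proof.
move=> [lF [C C0 hF]] [lG [C' C'0 hG]]; split=> [z x y|] /=.
  by rewrite lF lG.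
exists (C' * C); first by rewrite mulr_ge0.
move=> x /=; apply: (le_trans (hG _)); rewrite -mulrA.
exact: ler_wpM2l.
Qed.

Lemma closed_subspace_preim (V W : normedModType R[i]) (F : V -> W)
    (M : set W) :
  bounded_linear F -> closed_subspace M -> closed_subspace [set x | M (F x)].
Proof.
move=> [lF [C C0 hF]] [cM M0 lM]; split=> /=.
- apply: closed_nrm => x h /=; apply: (nrm_closed cM) => e e0.
  have C1 : 0 < C + 1 by rewrite ltr_wpDl.
  have [|w Mw xw] := h (e / (C + 1)); first by rewrite divr_gt0.
  exists (F w) => //; rewrite -linB//; apply: (le_lt_trans (hF _)).
  move: xw; rewrite ltr_pdivlMr// => xw.
  apply: le_lt_trans xw; rewrite mulrC ler_wpM2l ?nrm_ge0//; lra.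
- by rewrite (lin0 lF).
- by move=> z x y Mx My; rewrite lF; apply: lM.
Qed.

Lemma closed_subspace0 (V : normedModType R[i]) :
  closed_subspace [set x : V | x = 0].
Proof.
split=> //=.
  apply: closed_nrm => x h; apply: nrm_eq0; apply/eqP.
  rewrite eq_le nrm_ge0 andbT; apply/ler_addgt0Pr => e e0.
  by have [w -> ] := h e e0; rewrite subr0 add0r; apply: ltW.
by move=> z x y -> ->; rewrite scaler0 addr0.
Qed.

Lemma closed_subspace_eq (V W : normedModType R[i]) (F G : V -> W) :
  bounded_linear F -> bounded_linear G ->
  closed_subspace [set x | F x = G x].
Proof.
move=> [lF [C C0 hF]] [lG [C' C'0 hG]].
have /closed_subspace_preim/(_ (@closed_subspace0 W)) :
    bounded_linear (fun x => F x - G x).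
  split=> [z x y|].
    by rewrite lF lG scalerBr opprD addrACA.
  exists (C + C'); first exact: addr_ge0.
  by move=> x; apply: (le_trans (nrmB _ _)); rewrite mulrDl lerD.
congr closed_subspace; apply/seteqP; split=> x /=.
  by move/eqP; rewrite subr_eq0 => /eqP.
by move=> ->; rewrite subrr.
Qed.

Lemma closed_subspaceI (V : normedModType R[i]) (M N : set V) :
  closed_subspace M -> closed_subspace N -> closed_subspace (M `&` N).
Proof.
move=> [cM M0 lM] [cN N0 lN]; split=> //; first exact: closedI.
by move=> z x y [Mx Nx] [My Ny]; split; [apply: lM|apply: lN].
Qed.

Lemma closed_subspace_forall (V : normedModType R[i]) (I : Type)
    (M : I -> set V) :
  (forall i, closed_subspace (M i)) ->
  closed_subspace [set x | forall i, M i x].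
Proof.
move=> h; split=> /=.
- apply: closed_nrm => x hx i; have [cM _ _] := h i.
  apply: (nrm_closed cM) => e e0; have [w Mw ?] := hx e e0.
  by exists w => //; apply: Mw.
- by move=> i; have [] := h i.
- by move=> z x y Mx My i; have [_ _] := h i; apply.
Qed.

Lemma closed_span_sub (V : normedModType R[i]) (X M : set V) :
  closed_subspace M -> X `<=` M -> closed_span X `<=` M.
Proof. by move=> cM XM x; apply; split. Qed.

Lemma sub_closed_span (V : normedModType R[i]) (X : set V) :
  X `<=` closed_span X.
Proof. by move=> x Xx M [_]; apply. Qed.

Lemma closed_subspace_span (V : normedModType R[i]) (X : set V) :
  closed_subspace (closed_span X).
Proof.
split=> [|M [[_ M0 _] _]//|z x y hx hy M hM].
  apply: closed_nrm => x h M hM; have [[cM _ _] _] := hM; apply: (nrm_closed cM) => e e0.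
  by have [w hw ?] := h e e0; exists w => //; apply: hw.
by have [[_ _ lM] _] := hM; apply: lM; [apply: hx|apply: hy].
Qed.

Lemma bounded_linear_eq (V W : normedModType R[i]) (X : set V) (F G : V -> W) :
  bounded_linear F -> bounded_linear G -> closed_span X = setT ->
  (forall x, X x -> F x = G x) -> forall x, F x = G x.
Proof.
move=> bF bG XT h x.
have : closed_span X x by rewrite XT.
exact: (closed_span_sub (closed_subspace_eq bF bG)).
Qed.

Lemma closed_span_approx (V : normedModType R[i]) (I : Type) (x : I -> V) :
  closed_span (range x) = setT -> forall v (e : R), 0 < e ->
  exists s : seq (R[i] * I), nrm (v - \sum_(p <- s) p.1 *: x p.2) < e.
Proof.
move=> XT v; have : closed_span (range x) v by rewrite XT.
move: v; apply: closed_span_sub; last first.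
  move=> _ [i _ <-] e e0; exists [:: (1, i)].
  by rewrite big_seq1 scale1r subrr nrm0.
split=> /=.
- apply: closed_nrm => v h e e0.
  have e2 : 0 < e / 2 by rewrite divr_gt0.
  have [w hw vw] := h _ e2; have [s hs] := hw _ e2.
  exists s; apply: (le_lt_trans (nrm_tri _ w _)); lra.
- by move=> e e0; exists [::]; rewrite big_nil subrr nrm0.
- move=> z v w hv hw e e0.
  have e2 : 0 < e / 2 by rewrite divr_gt0.
  have z1 : 0 < nrm z + 1 by rewrite ltr_wpDl ?nrm_ge0.
  have [|s hs] := hv (e / 2 / (nrm z + 1)); first by rewrite divr_gt0.
  have [t ht] := hw _ e2.
  exists ([seq (z * p.1, p.2) | p <- s] ++ t).
  rewrite big_cat big_map /= opprD addrACA.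
  rewrite (_ : z *: v - _ = z *: (v - \sum_(p <- s) p.1 *: x p.2)); last first.
    rewrite scalerBr scaler_sumr; congr (_ - _); apply: eq_bigr => p _.
    by rewrite scalerA.
  apply: (le_lt_trans (nrmD _ _)); rewrite nrmZ.
  rewrite [ltRHS](splitr e) ltr_leD// ?ltW//.
  move: hs; rewrite ltr_pdivlMr// => hs; apply: le_lt_trans hs.
  by rewrite mulrC ler_wpM2l ?nrm_ge0//; lra.
Qed.

(** The bound on combinations makes [F] well defined as well as continuous. *)
Lemma bounded_extension (V : normedModType R[i]) (W : completeNormedModType R[i])
    (I : Type) (x : I -> V) (w : I -> W) (C : R) :
  0 <= C -> closed_span (range x) = setT ->
  (forall s : seq (R[i] * I),
     nrm (\sum_(p <- s) p.1 *: w p.2) <= C * nrm (\sum_(p <- s) p.1 *: x p.2)) ->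
  exists F : V -> W, [/\ linear_map F, forall i, F (x i) = w i
    & forall v, nrm (F v) <= C * nrm v].
Proof.
move=> C0 XT hC.
pose X (s : seq (R[i] * I)) := \sum_(p <- s) p.1 *: x p.2.
pose Wv (s : seq (R[i] * I)) := \sum_(p <- s) p.1 *: w p.2.
have lcX z s t : X ([seq (z * p.1, p.2) | p <- s] ++ t) = z *: X s + X t.
  rewrite /X big_cat big_map /= scaler_sumr; congr (_ + _).
  by apply: eq_bigr => p _; rewrite scalerA.
have lcW z s t : Wv ([seq (z * p.1, p.2) | p <- s] ++ t) = z *: Wv s + Wv t.
  rewrite /Wv big_cat big_map /= scaler_sumr; congr (_ + _).
  by apply: eq_bigr => p _; rewrite scalerA.
have dW s t : nrm (Wv s - Wv t) <= C * nrm (X s - X t).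
  have := hC ([seq ((- 1) * p.1, p.2) | p <- t] ++ s).
  rewrite -/(Wv _) -/(X _) lcW lcX !scaleN1r.
  by rewrite addrC [in X in _ -> X]addrC ![- _ + _]addrC.
have ex v : exists l, forall e s, nrm (v - X s) <= e -> nrm (l - Wv s) <= C * e.
  apply: (@approximation_limit _ _ _ (fun e s => nrm (v - X s) <= e) Wv C) => //.
    by move=> e e0; have [s hs] := closed_span_approx XT v e0; exists s; apply: ltW.
  move=> e e' s s' hs hs'; apply: (le_trans (dW _ _)); rewrite ler_wpM2l//.
  apply: (le_trans (nrm_tri _ v _)); rewrite nrmC; exact: lerD.
pose F v := projT1 (cid (ex v)).
have hF v e s : nrm (v - X s) <= e -> nrm (F v - Wv s) <= C * e.
  by rewrite /F; case: cid => l /= h /h.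
have FX s : F (X s) = Wv s.
  apply/eqP; rewrite -subr_eq0; apply/eqP/nrm_eq0/eqP.
  rewrite eq_le nrm_ge0 andbT (le_trans (hF _ 0 s _)) ?mulr0//.
  by rewrite subrr nrm0.
exists F; split.
- move=> z u v; apply/eqP; rewrite -subr_eq0; apply/eqP/(nrm_small C0) => e e0.
  have z0 := nrm_ge0 z.
  pose d := e / (2 * (nrm z + 1)).
  have d0 : 0 < d by rewrite divr_gt0// mulr_gt0// ltr_wpDl.
  have de : 2 * (nrm z * d + d) = e.
    by rewrite /d; field; rewrite gt_eqF// ltr_wpDl.
  have [s /ltW hs] := closed_span_approx XT u d0.
  have [t /ltW ht] := closed_span_approx XT v d0.
  have hst : nrm (z *: u + v - X ([seq (z * p.1, p.2) | p <- s] ++ t))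
      <= nrm z * d + d.
    rewrite lcX opprD addrACA -scalerBr (le_trans (nrmD _ _))// lerD//.
    by rewrite nrmZ ler_wpM2l.
  have {}hst := hF _ _ _ hst; have {}hs := hF _ _ _ hs; have {}ht := hF _ _ _ ht.
  rewrite lcW in hst.
  apply: (le_trans (nrm_tri _ (z *: Wv s + Wv t) _)).
  rewrite -de (_ : C * _ = C * (nrm z * d + d) + (nrm z * (C * d) + C * d));
    last by ring.
  rewrite lerD// nrmC opprD addrACA -scalerBr (le_trans (nrmD _ _))// lerD//.
  by rewrite nrmZ ler_wpM2l.
- by move=> i; have := FX [:: (1, i)]; rewrite /X /Wv !big_seq1 !scale1r.
- move=> v; apply/ler_addgt0Pr => e e0.
  have C1 : 0 < C + 1 by rewrite ltr_wpDl.
  pose d := e / (2 * (C + 1)).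
  have d0 : 0 < d by rewrite divr_gt0// mulr_gt0.
  have [s /ltW hs] := closed_span_approx XT v d0.
  have {}h1 := hF _ _ _ hs.
  apply: (le_trans (nrm_le_sub _ (Wv s))).
  have h2 : nrm (Wv s) <= C * (nrm v + d).
    apply: (le_trans (hC _)); rewrite ler_wpM2l//.
    by apply: (le_trans (nrm_le_sub _ v)); rewrite addrC lerD2l nrmC.
  have de : C * d <= e / 2.
    have -> : e / 2 = (C + 1) * d by rewrite /d; field; rewrite gt_eqF.
    rewrite ler_wpM2r ?ltW//; lra.
  lra.
Qed.

End BoundedLinear.

(** * Hilbert modules and multipliers *)

Section HilbertFacts.
Variables (R : realType) (B : cstarAlgType R) (Y : hilbertModType B).
Implicit Types (x y z : Y) (b : B).

Lemma nrm_hip x : nrm (hip x x : B) = nrm x ^+ 2.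
Proof.
by apply: (@complexI R); rewrite rmorphXn /= -!nrmE; rewrite (norm_hip (s := Y)).
Qed.

Lemma hipNr x y : hip x (- y) = - hip x y :> B.
Proof. by rewrite -scaleN1r hipZr scaleN1r. Qed.

Lemma hipBr x y z : hip x (y - z) = hip x y - hip x z :> B.
Proof. by rewrite hipDr hipNr. Qed.

Lemma hip0l x : hip (0 : Y) x = 0 :> B.
Proof. by rewrite -hip_star hip0r star0. Qed.

Lemma hip_sumr (I : Type) (s : seq I) x (F : I -> Y) :
  hip x (\sum_(i <- s) F i) = \sum_(i <- s) hip x (F i) :> B.
Proof.
by elim: s => [|i s ih]; rewrite ?big_nil ?hip0r// !big_cons hipDr ih.
Qed.

Lemma hip_suml (I : Type) (s : seq I) x (F : I -> Y) :
  hip (\sum_(i <- s) F i) x = \sum_(i <- s) hip (F i) x :> B.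
Proof. by rewrite -hip_star hip_sumr star_sum; under eq_bigr do rewrite hip_star. Qed.

Lemma hip_ractl x y b : hip (ract x b) y = star b ** hip x y :> B.
Proof. by rewrite -hip_star hip_ract starM hip_star. Qed.

Lemma nrm_ract x b : nrm (ract x b) <= nrm x * nrm b.
Proof.
rewrite -(@ler_pXn2r _ 2)// ?nnegrE ?mulr_ge0 ?nrm_ge0//.
rewrite -nrm_hip hip_ractl hip_ract exprMn -nrm_hip.
apply: (le_trans (nrmM _ _)); rewrite nrm_star mulrC expr2 mulrA.
by rewrite ler_wpM2r ?nrm_ge0// nrmM.
Qed.

Lemma hipBl x y z : hip (x - y) z = hip x z - hip y z :> B.
Proof. by rewrite -hip_star hipBr starB !hip_star. Qed.

Lemma hip_diff x y :
  hip (x + y) (x + y) - hip (x - y) (x - y) = (hip x y + hip y x) *+ 2 :> B.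
Proof.
rewrite hipDl hipBl !hipBr !hipDr.
set a : B := hip x x; set b : B := hip x y; set c : B := hip y x.
set d : B := hip y y.
have -> : a + b = a - b + b *+ 2 by rewrite mulr2n addrA subrK.
have -> : c + d = - (c - d) + c *+ 2.
  by rewrite opprB mulr2n addrA subrK addrC.
by rewrite addrACA [_ + (_ *+ 2 + _)]addrC addrK mulrnDl.
Qed.

(** Polarization bounds the inner product up to a constant, and the constant is
    immaterial below; the Cauchy-Schwarz inequality would rest on the theory of
    positive elements. *)
Lemma hip_polar x y :
  (hip x y : B) *+ 4 =
  (hip (x + y) (x + y) - hip (x - y) (x - y))
  - 'i%C *: (hip (x + 'i%C *: y) (x + 'i%C *: y)
             - hip (x - 'i%C *: y) (x - 'i%C *: y)) :> B.
Proof.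
rewrite !hip_diff hipZr hipZl.
have -> : ('i%C : R[i])^* = - 'i%C by rewrite /Num.conj /=; simpc.
rewrite -scalerMnr scalerDr !scalerA mulrN -expr2 sqr_i opprK scaleN1r scale1r.
rewrite -mulrnBl opprD opprK addrACA subrr addr0 -mulr2n -mulrnA.
by [].
Qed.

(** Each of the four terms of the polarization identity has norm at most [(nrm x
    + nrm y) ^+ 2]; rescaling [y] to the norm of [x] turns this into a product. *)
Lemma nrm_hip_le x y : nrm (hip x y : B) <= 4 * (nrm x * nrm y).
Proof.
have h (u v : Y) : nrm (hip u v : B) <= (nrm u + nrm v) ^+ 2.
  have q (w : Y) : nrm w <= nrm u + nrm v ->
      nrm (hip w w : B) <= (nrm u + nrm v) ^+ 2.
    by move=> hw; rewrite nrm_hip ler_pXn2r// nnegrE ?addr_ge0 ?nrm_ge0.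
  rewrite -(@ler_pMn2r _ 4)//.
  have -> : nrm (hip u v : B) *+ 4 = nrm ((hip u v : B) *+ 4).
    by rewrite -[in RHS]scaler_nat nrmZ -[LHS]mulr_natl; congr (_ * _);
       rewrite /nrm normr_nat raddfMn.
  rewrite hip_polar (le_trans (nrmB _ _))// nrmZi.
  have := q (u + v) (nrmD _ _); have := q (u - v) (nrmB _ _).
  have h1 := nrmD u ('i%C *: v); have h2 := nrmB u ('i%C *: v).
  rewrite nrmZi in h1; rewrite nrmZi in h2.
  have := q _ h1; have := q _ h2.
  have := nrmB (hip (u + v) (u + v) : B) (hip (u - v) (u - v)).
  have := nrmB (hip (u + 'i%C *: v) (u + 'i%C *: v) : B)
               (hip (u - 'i%C *: v) (u - 'i%C *: v)).
  rewrite -mulr_natl; lra.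
have [->|x0] := eqVneq x 0; first by rewrite hip0l !nrm0 mul0r mulr0.
have [->|y0] := eqVneq y 0; first by rewrite hip0r !nrm0 !mulr0.
have nx := nrm_gt0 x0.
have ny := nrm_gt0 y0.
have := h x ((nrm x / nrm y)%:C%C *: y).
rewrite hipZr !nrmZR ger0_norm ?divr_ge0 ?nrm_ge0// divfK ?gt_eqF//.
rewrite mulrAC ler_pdivrMr// -(ler_pM2l nx).
rewrite (_ : (_ + _) ^+ 2 * _ = nrm x * (4 * (nrm x * nrm y))); last by ring.
by rewrite !(ler_pM2l nx).
Qed.

Lemma hip_bounded x : bounded_linear (fun y => hip x y : B).
Proof.
split=> [z u v|]; first by rewrite hipDr hipZr.
exists (4 * nrm x); first by rewrite mulr_ge0 ?nrm_ge0.
by move=> y; rewrite -mulrA nrm_hip_le.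
Qed.

Lemma aopDE (S T : adjop Y) x : (S + T) x = S x + T x. Proof. by []. Qed.
Lemma aopZE c (T : adjop Y) x : (c *: T) x = c *: T x. Proof. by []. Qed.
Lemma aopME (S T : adjop Y) x : (S ** T) x = S (T x). Proof. by []. Qed.
Lemma aop0E x : (0 : adjop Y) x = 0. Proof. by []. Qed.
Lemma aop1E x : (Defs.adj1 : adjop Y) x = x. Proof. by []. Qed.
Lemma aopNE (T : adjop Y) x : (- T) x = - T x.
Proof. by rewrite -scaleN1r aopZE scaleN1r. Qed.
Lemma aopBE (S T : adjop Y) x : (S - T) x = S x - T x.
Proof. by rewrite aopDE aopNE. Qed.
Lemma aop_sumE (I : Type) (s : seq I) (F : I -> adjop Y) x :
  (\sum_(i <- s) F i) x = \sum_(i <- s) F i x.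
Proof. by elim: s => [|i s ih]; rewrite ?big_nil// !big_cons aopDE ih. Qed.

Lemma aop_lin (T : adjop Y) : linear_map T.
Proof. by move=> z x y; exact: aop_linear. Qed.

Lemma hip_aop (T : adjop Y) x y : hip (T x) y = hip x (star T y) :> B.
Proof. exact: aopP. Qed.

Lemma aop_hip (T : adjop Y) x y : hip x (T y) = hip (star T x) y :> B.
Proof. by rewrite hip_aop starK. Qed.

Lemma aop_ract (T : adjop Y) x b : T (ract x b) = ract (T x) b.
Proof.
apply: (@hip_inj _ _ Y) => z.
by rewrite aop_hip !hip_ract -aop_hip.
Qed.

(** No bound on [S] or [T] is at hand, but [hip z (S x)] is continuous in [x],
    being [hip (star S z) x]. *)
Lemma aop_eq_closed (S T : adjop Y) : closed_subspace [set x | S x = T x].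
Proof.
have -> : [set x | S x = T x] =
    [set x | forall z, (hip (star S z) x : B) = hip (star T z) x].
  apply/seteqP; split=> x /=; first by move=> e z; rewrite -!aop_hip e.
  by move=> h; apply: (@hip_inj _ _ Y) => z; rewrite !aop_hip h.
apply: closed_subspace_forall => z.
exact: (closed_subspace_eq (hip_bounded _) (hip_bounded _)).
Qed.

Lemma adjop_span_ext (X : set Y) (S T : adjop Y) :
  closed_span X = setT -> (forall x, X x -> S x = T x) -> S = T.
Proof.
move=> XT h; apply: adjop_ext => x.
have : closed_span X x by rewrite XT.
exact: (closed_span_sub (aop_eq_closed S T)).
Qed.

End HilbertFacts.

Section Multipliers.
Variables (R : realType) (D : cstarAlgType R).
Implicit Types (a b x : D) (m n : multiplier D).

Lemma toME a x : toM a x = a ** x. Proof. by []. Qed.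

Lemma toM_linear (z : R[i]) a b : toM (z *: a + b) = z *: toM a + toM b.
Proof. by apply: adjop_ext => x /=; rewrite smulDl smulZl. Qed.

Lemma toMZ (z : R[i]) a : toM (z *: a) = z *: toM a.
Proof. by apply: adjop_ext => x /=; rewrite smulZl. Qed.

Lemma toM_mul a b : toM (a ** b) = toM a ** toM b.
Proof. by apply: adjop_ext => x; rewrite aopME !toME smulA. Qed.

Lemma toM_star a : toM (star a) = star (toM a).
Proof. exact: adjop_ext. Qed.

Lemma smul_inj a b : (forall x, a ** x = b ** x) -> a = b.
Proof.
move=> h; apply/eqP; rewrite -subr_eq0; apply/eqP; apply: star_inj.
by rewrite star0; apply: star_eq0; rewrite starK smulBl h subrr.
Qed.

Lemma toM_inj : injective (@toM R D).
Proof.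
by move=> a b e; apply: smul_inj => x; rewrite -!toME e.
Qed.

Lemma toMK a : fromM (toM a) = a.
Proof.
by rewrite /fromM; apply: xget_unique => // b; exact: toM_inj.
Qed.

Lemma fromMK m : (exists a, toM a = m) -> toM (fromM m) = m.
Proof. by case=> a <-; rewrite toMK. Qed.

Lemma mul_smul m a b : m (a ** b) = (m a : D) ** b.
Proof. exact: (aop_ract m). Qed.

Lemma hip_selfE a b : hip (a : hself D) (b : hself D) = star a ** b :> D.
Proof. by []. Qed.

Lemma mul_star m a b : star (m a : D) ** b = star a ** (star m b : D).
Proof. exact: (hip_aop m). Qed.

Lemma toM_mull m a : m ** toM a = toM (m a).
Proof. by apply: adjop_ext => x; rewrite aopME !toME mul_smul. Qed.

Lemma toM_mulr m a : toM a ** m = toM (star (star m (star a) : D)).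
Proof. by apply: star_inj; rewrite starM -toM_star toM_mull -toM_star starK. Qed.

Lemma smul_boundedl a : bounded_linear (fun x : D => a ** x).
Proof.
split=> [z u v|]; first by rewrite smulDr smulZr.
by exists (nrm a); [exact: nrm_ge0|exact: nrmM].
Qed.

Lemma smul_boundedr a : bounded_linear (fun x : D => x ** a).
Proof.
split=> [z u v|]; first by rewrite smulDl smulZl.
by exists (nrm a) => [|x]; [exact: nrm_ge0|rewrite mulrC nrmM].
Qed.

End Multipliers.

(** * Boundedness of *-homomorphisms *)

Section Contractivity.
Variable R : realType.

(** The element [1 - b] is the square root of [1 - h ** h], written without the
    unit: [b] is a fixed point of [b |-> (h ** h + b ** b) / 2], which contracts
    the ball of radius [nrm h]. *)
Lemma sqrt_one_sub_sq (A : cstarAlgType R) (h : A) : star h = h -> nrm h < 1 ->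
  exists b, [/\ star b = b, b ** h = h ** b & b + b = h ** h + b ** b].
Proof.
move=> hs h1; pose F (b : A) := (2^-1 : R)%:C%C *: (h ** h + b ** b).
pose r := nrm h; have r0 : 0 <= r := nrm_ge0 h.
pose I := [set b : A | [/\ star b = b, b ** h = h ** b & nrm b <= r]].
have nF x : nrm (F x) = 2^-1 * nrm (h ** h + x ** x).
  by rewrite /F nrmZR ger0_norm.
have [||b [bs bh bn]|||b [bs bh _] Fb] := @contraction_fixpoint R A F I 0 r.
- by rewrite r0.
- by rewrite /I /= star0 smul0l smul0r nrm0.
- rewrite /F; split; rewrite ?nF.
  + rewrite starZ starD !starM bs hs; congr (_ *: _).
    exact: conjc_real.
  + by rewrite smulZl smulZr smulDl smulDr -!smulA bh !smulA bh.
  + have h2 : nrm (h ** h) <= r * r := nrmM _ _.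
    have b2 : nrm (b ** b) <= r.
      apply: (le_trans (nrmM _ _)); rewrite -[leRHS]mul1r.
      by rewrite ler_pM ?nrm_ge0// (le_trans bn)// ltW.
    have r2 : r * r <= r by rewrite ler_piMl// ltW.
    have := nrmD (h ** h) (b ** b); lra.
- move=> x hx; split.
  + apply/eqP; rewrite -subr_eq0; apply/eqP/(@nrm_small _ _ _ 2) => // e e0.
    have [w [ws _ _] xw] := hx e e0.
    have -> : star x - x = star (x - w) - (x - w).
      by rewrite starB ws opprB addrA subrK.
    by apply: (le_trans (nrmB _ _)); rewrite nrm_star; lra.
  + apply/eqP; rewrite -subr_eq0; apply/eqP/(@nrm_small _ _ _ (2 * r)).
      by rewrite mulr_ge0.
    move=> e e0; have [w [_ wh _] xw] := hx e e0.
    have -> : x ** h - h ** x = (x - w) ** h - h ** (x - w).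
      by rewrite smulBl smulBr wh opprB addrA subrK.
    have h1' := nrmM (x - w) h; have h2' := nrmM h (x - w).
    have h3 : nrm (x - w) * r <= e * r by rewrite ler_wpM2r// ltW.
    apply: (le_trans (nrmB _ _)); rewrite -/r in h1' h2' *; lra.
  + apply/ler_addgt0Pr => e e0; have [w [_ _ wn] xw] := hx e e0.
    by apply: (le_trans (nrm_le_sub _ w)); lra.
- move=> x y [_ _ xn] [_ _ yn].
  have -> : F x - F y = (2^-1 : R)%:C%C *: (x ** (x - y) + (x - y) ** y).
    rewrite /F -scalerBr; congr (_ *: _).
    by rewrite smulBl smulBr addrA subrK opprD addrACA subrr add0r.
  rewrite nrmZR ger0_norm//.
  have h1' : nrm (x ** (x - y)) <= r * nrm (x - y).
    by apply: (le_trans (nrmM _ _)); rewrite ler_wpM2r ?nrm_ge0.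
  have h2' : nrm ((x - y) ** y) <= r * nrm (x - y).
    by apply: (le_trans (nrmM _ _)); rewrite mulrC ler_wpM2r ?nrm_ge0.
  have := nrmD (x ** (x - y)) ((x - y) ** y); lra.
exists b; split=> //; rewrite -{1 2}Fb /F -scalerDl -rmorphD /=.
by rewrite (_ : 2^-1 + 2^-1 = 1 :> R) ?scale1r//; lra.
Qed.

Lemma conj_i : ('i%C : R[i])^* = - 'i%C.
Proof. by rewrite /Num.conj /=; simpc. Qed.

Lemma mul_ii : 'i%C * 'i%C = - 1 :> R[i].
Proof. by rewrite -expr2 sqr_i. Qed.

Lemma half_sum (V : normedModType R[i]) (x y : V) :
  (2^-1 : R)%:C%C *: ((x + y) + (x - y)) = x.
Proof.
rewrite addrCA addrK -mulr2n -[x *+ 2]scaler_nat scalerA.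
have -> : 2%:R = (2 : R)%:C%C :> R[i] by rewrite rmorphMn rmorph1.
by rewrite -rmorphM /= mulVf ?pnatr_eq0// scale1r.
Qed.

Lemma nrm_half_sum (V : normedModType R[i]) (x y : V) (c : R) :
  nrm (x + y) <= c -> nrm (x - y) <= c -> nrm x <= c.
Proof.
move=> h1 h2; rewrite -[x](half_sum x y) nrmZR ger0_norm//.
by have := nrmD (x + y) (x - y); lra.
Qed.

Section Commuting.
Variables (B : cstarAlgType R) (X : hilbertModType B).

Lemma star_isometry (u : adjop X) x : star u (u x) = x -> nrm (u x) = nrm x.
Proof.
move=> h; apply/eqP; rewrite -(@eqrXn2 _ 2)// ?nrm_ge0//.
by rewrite -!nrm_hip hip_aop h.
Qed.

(** The operators [k + i v] and [k - i v] are mutually adjoint unitaries, and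
    [k] is their mean. *)
Lemma cos_sin_contraction (k v : adjop X) : star k = k -> star v = v ->
  (forall x, k (v x) = v (k x)) -> (forall x, k (k x) + v (v x) = x) ->
  forall x, nrm (k x) <= nrm x.
Proof.
move=> ks vs kv kkvv x.
pose u : adjop X := k + 'i%C *: v; pose w : adjop X := k - 'i%C *: v.
have us : star u = w by rewrite /u starD starZ ks vs conj_i scaleNr.
have ws : star w = u by rewrite -us starK.
have uE y : u y = k y + 'i%C *: v y by [].
have wE y : w y = k y - 'i%C *: v y by rewrite /w aopBE.
have kl := aop_lin k; have vl := aop_lin v.
have wu y : w (u y) = y.
  rewrite wE uE (linD kl) (linD vl) (linZ kl) (linZ vl) scalerDr scalerA.
  rewrite mul_ii scaleN1r opprD opprK kv addrA addrK.
  exact: kkvv.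
have uw y : u (w y) = y.
  rewrite uE wE (linB kl) (linB vl) (linZ kl) (linZ vl) scalerBr scalerA.
  by rewrite mul_ii scaleN1r opprK kv addrA subrK kkvv.
apply: (@nrm_half_sum _ _ ('i%C *: v x)).
- by rewrite -uE star_isometry// us wu.
- by rewrite -wE star_isometry// ws uw.
Qed.

End Commuting.

Section Representation.
Variables (A B : cstarAlgType R) (X : hilbertModType B) (f : A -> adjop X).
Hypothesis hf : star_hom f.

Let fD x y : f (x + y) = f x + f y.
Proof. by have [l _ _] := hf; rewrite -[x]scale1r l !scale1r. Qed.

Let f0 : f 0 = 0.
Proof. by apply: (addrI (f 0)); rewrite -fD !addr0. Qed.

Let fZ z x : f (z *: x) = z *: f x.
Proof. by have [l _ _] := hf; rewrite -[z *: x]addr0 l f0 addr0. Qed.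

(** The image of [1 - h ** h] is a square [v ** v], so [f h] and [v] are the
    cosine and sine of the previous lemma. Since only the equation between [h]
    and [b] is used, it survives the passage through [f] without any continuity. *)
Lemma rep_sa_lt1 h x : star h = h -> nrm h < 1 -> nrm (f h x) <= nrm x.
Proof.
move=> hs h1; have [_ fM fs] := hf.
have [b [bs bh bb]] := sqrt_one_sub_sq hs h1.
pose v : adjop X := Defs.adj1 - f b.
have vE y : v y = y - f b y by rewrite /v aopBE.
apply: (@cos_sin_contraction _ _ (f h) v).
- by rewrite -fs hs.
- by rewrite /v starB -fs bs; congr (_ - _); exact: adjop_ext.
- by move=> y; rewrite !vE (linB (aop_lin _)) -!aopME -!fM bh.
- move=> y; rewrite !vE (linB (aop_lin (f b))).
  set a := f b y; set c := f b a.
  have -> : f h (f h y) = a + a - c.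
    have -> : a + a = f h (f h y) + c.
      by rewrite /c /a -!aopME -!fM -!aopDE -!fD bb.
    by rewrite addrK.
  by rewrite -[a + a - c]addrA addrACA subrr addr0 addrC subrK.
Qed.

Lemma rep_sa h x : star h = h -> nrm (f h x) <= nrm h * nrm x.
Proof.
move=> hs; apply/ler_addgt0Pr => e e0.
have x1 : 0 < nrm x + 1 by rewrite ltr_wpDl ?nrm_ge0.
pose t := nrm h + e / (nrm x + 1).
have et : 0 < e / (nrm x + 1) by rewrite divr_gt0.
have t0 : 0 < t by rewrite ltr_wpDl ?nrm_ge0.
have ti : `|t^-1| = t^-1 by rewrite ger0_norm// invr_ge0 ltW.
have h1 : nrm (f ((t^-1)%:C%C *: h) x) <= nrm x.
  apply: rep_sa_lt1.
    by rewrite starZ hs; congr (_ *: _); exact: conjc_real.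
  by rewrite nrmZR ti mulrC ltr_pdivrMr// mul1r ltrDl.
move: h1; rewrite fZ aopZE nrmZR ti.
rewrite mulrC ler_pdivrMr// => h1; apply: (le_trans h1).
rewrite /t mulrDr mulrC lerD2l mulrA ler_pdivrMr// mulrC.
by rewrite ler_pM2l//; lra.
Qed.

(** The factor [2] is the square root of the constant in the bound on inner
    products. *)
Lemma rep_bounded a x : nrm (f a x) <= 2 * nrm a * nrm x.
Proof.
have [_ fM fs] := hf.
rewrite -(@ler_pXn2r _ 2)// ?nnegrE ?mulr_ge0 ?nrm_ge0//.
rewrite -nrm_hip hip_aop -fs -aopME -fM (le_trans (nrm_hip_le _ _))//.
have /rep_sa : star (star a ** a) = star a ** a by rewrite starM starK.
move=> /(_ x); rewrite nrm_cstar => h.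
rewrite (_ : (2 * _ * _) ^+ 2 = 4 * (nrm x * (nrm a ^+ 2 * nrm x))); last by ring.
by rewrite ler_pM2l// ler_wpM2l ?nrm_ge0.
Qed.

Lemma rep_bounded_linear a : bounded_linear (f a).
Proof.
split; first exact: aop_lin.
by exists (2 * nrm a) => [|x]; rewrite ?mulr_ge0 ?nrm_ge0// rep_bounded.
Qed.

Lemma rep_bounded_linearl x : bounded_linear (fun a => f a x).
Proof.
split=> [z a b|]; first by rewrite fD fZ.
exists (2 * nrm x) => [|a]; first by rewrite mulr_ge0 ?nrm_ge0.
by rewrite mulrAC rep_bounded.
Qed.

End Representation.

(** On self-adjoint elements this is the bound for representations, applied to
    [toM \o f] at the vector [f h]; the C*-identity does the rest. *)
Lemma star_hom_contractive (A D : cstarAlgType R) (f : A -> D) a :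
  star_hom f -> nrm (f a) <= nrm a.
Proof.
move=> [fl fM fs].
have hom : star_hom (@toM R D \o f).
  split=> [z x y|x y|x] /=; first by rewrite fl toM_linear.
    by rewrite fM toM_mul.
  by rewrite fs toM_star.
have sa h : star h = h -> nrm (f h) <= nrm h.
  move=> hs; have [->|f0] := eqVneq (f h) 0; first by rewrite nrm0 nrm_ge0.
  have := rep_sa hom (f h : hself D) hs.
  rewrite /= -{1}hs fs nrm_cstar expr2 ler_pM2r//; exact: nrm_gt0.
have := sa (star a ** a); rewrite starM starK => /(_ erefl).
rewrite fM fs !nrm_cstar => h.
by rewrite -(@ler_pXn2r _ 2)// nnegrE nrm_ge0.
Qed.

Lemma star_hom_bounded (A D : cstarAlgType R) (f : A -> D) :
  star_hom f -> bounded_linear f.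
Proof.
move=> hf; split; first by case: hf.
by exists 1 => // a; rewrite mul1r star_hom_contractive.
Qed.

End Contractivity.

(** * The range of a *-homomorphism is closed *)

Section ResolventAndRange.
Variable R : realType.

(** The cross terms cancel, because [s *: K] is skew-adjoint. *)
Lemma hip_one_addi (B : cstarAlgType R) (X : hilbertModType B) (K : adjop X)
    (s : R[i]) x : star K = K -> s^* = - s ->
  hip (x + s *: K x) (x + s *: K x) = hip x (x - s ^+ 2 *: K (K x)) :> B.
Proof.
move=> Ks sI; rewrite hipDl !hipDr !hipZl !hipZr !hip_aop Ks sI scaleNr hipNr.
rewrite hipZr addrA; congr (_ + _).
  by rewrite -addrA addrN addr0.
by rewrite scalerA mulNr expr2 scaleNr.
Qed.

(** The vectors [(1 + i K) x] and [(1 - i K) x] have equal norms, and [x] is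
    their mean. *)
Lemma nrm_one_addi (B : cstarAlgType R) (X : hilbertModType B) (K : adjop X) x :
  star K = K -> nrm x <= nrm (x + 'i%C *: K x).
Proof.
move=> Ks; have e : nrm (x - 'i%C *: K x) = nrm (x + 'i%C *: K x).
  apply/eqP; rewrite -(@eqrXn2 _ 2)// ?nrm_ge0// -!nrm_hip -scaleNr.
  by rewrite !hip_one_addi ?sqrrN// ?rmorphN/= ?opprK// conj_i ?opprK.
by apply: (@nrm_half_sum _ _ _ ('i%C *: K x)); rewrite ?e.
Qed.

Section Resolvent.
Variables (A : cstarAlgType R) (h : A).
Hypothesis hs : star h = h.

Let N (l : R) (x : A) := x + ('i%C * l%:C%C) *: (h ** x).

Let N_ge l x : nrm x <= nrm (N l x).
Proof.
have := @nrm_one_addi A (hself A) (toM (l%:C%C *: h)) (x : hself A).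
rewrite toME smulZl scalerA; apply; rewrite -toM_star starZ hs.
by congr (toM (_ *: _)); exact: conjc_real.
Qed.

Let N_sub l x y : N l x - N l y = N l (x - y).
Proof. by rewrite /N smulBr scalerBr opprD addrACA. Qed.

Let nrm_il (l : R) : nrm ('i%C * l%:C%C : R[i]) = `|l|.
Proof. by rewrite nrmMc nrmi nrmRC mul1r. Qed.

Let N_small l : 0 <= l -> l * nrm h <= 2^-1 -> forall y, exists x, N l x = y.
Proof.
move=> l0 lh y.
have [|||||x _ hx] := @contraction_fixpoint R A
    (fun x => y - ('i%C * l%:C%C) *: (h ** x)) setT 0 2^-1 => //.
- by rewrite invr_ge0 invf_lt1//=; lra.
- move=> u v _ _.
  rewrite opprB addrC addrA subrK -scalerBr -smulBr nrmZ nrm_il ger0_norm//.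
  rewrite [nrm (u - v)]nrmC.
  apply: (le_trans (ler_wpM2l l0 (nrmM _ _))); rewrite mulrA ler_wpM2r ?nrm_ge0//.
by exists x; rewrite /N -{1}hx subrK.
Qed.

(** The equation [(1 + 2 i l h) x = y] reads [(1 + i l h) x = (x + y) / 2], and
    the inverse of [1 + i l h] does not increase norms; the fixed point equation
    is contractive with factor [1 / 2]. *)
Let N_double l : (forall y, exists x, N l x = y) ->
  forall y, exists x, N (2 * l) x = y.
Proof.
move=> hl y; pose T y := projT1 (cid (hl y)).
have TN z : N l (T z) = z by rewrite /T; case: cid.
have T1 u v : nrm (T u - T v) <= nrm (u - v).
  by apply: (le_trans (N_ge l _)); rewrite -N_sub !TN.
have [|||||x _ hx] := @contraction_fixpoint R A
    (fun x => T ((2^-1 : R)%:C%C *: (y + x))) setT 0 2^-1 => //.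
- by rewrite invr_ge0 invf_lt1//=; lra.
- move=> u v _ _; apply: (le_trans (T1 _ _)).
  by rewrite -scalerBr nrmZR ger0_norm// opprD addrACA subrr add0r.
exists x; have := TN ((2^-1 : R)%:C%C *: (y + x)); rewrite hx.
have c2 : (2^-1 : R)%:C%C + (2^-1 : R)%:C%C = 1 :> R[i].
  by rewrite -rmorphD/= (_ : 2^-1 + 2^-1 = 1 :> R)//; lra.
move=> /(congr1 (fun z => z + z)); rewrite -scalerDl c2 scale1r /N.
rewrite addrACA -scalerDl -mulrDr -rmorphD/= => e.
apply: (addIr x); rewrite -e addrAC (_ : 2 * l = l + l)//; ring.
Qed.

(** Start from [l = 2 ^- n], small against [nrm h], and double [n] times. This
    is the reality of the spectrum of [h]. *)
Lemma resolvent_onto y : exists x, x + 'i%C *: (h ** x) = y.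
Proof.
have [n hn] : exists n, 2^-1 ^+ n * nrm h <= 2^-1.
  have [|||n] := @geometric_small R (nrm h) 2^-1 2^-1; rewrite ?nrm_ge0//.
    by rewrite invr_ge0 invf_lt1//=; lra.
  by move=> /(_ n (leqnn n)) /ltW hn; exists n; rewrite mulrC.
have {hn} : forall y, exists x, N (2^-1 ^+ n) x = y.
  by apply: N_small => //; rewrite exprn_ge0.
elim: n y => [|n ih] y hN.
  by have [x] := hN y; rewrite /N expr0 mulr1 => hx; exists x.
apply: ih => z; have := N_double hN z; rewrite exprS mulrA.
by rewrite mulfV ?pnatr_eq0// mul1r.
Qed.

(** The element is [h (1 + i h)^-1], a bounded function of [h] that agrees with
    [h] to first order at [0]. *)
Lemma resolvent : exists2 y : A, y + 'i%C *: (h ** y) = h & nrm y <= 2.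
Proof.
have [y hy] := resolvent_onto h.
have Ni x : nrm x <= nrm (x + 'i%C *: (h ** x)).
  by have := N_ge 1 x; rewrite /N rmorph1 mulr1.
exists y => //.
have yw w : nrm (y ** w) <= 2 * nrm w.
  have [v hv] := resolvent_onto w.
  have vw : nrm v <= nrm w by rewrite -hv.
  (* h (1 + i h)^-1 = -i (1 - (1 + i h)^-1) *)
  have nq : nrm (- 'i%C *: (w - v)) = nrm (w - v).
    by rewrite nrmZ nrmN nrmi mul1r.
  have e : y ** w = - 'i%C *: (w - v).
    apply/eqP; rewrite -subr_eq0; apply/eqP/nrm_eq0/eqP.
    rewrite eq_le nrm_ge0 andbT (le_trans (Ni _))//.
    set z := _ - _; suff -> : z + 'i%C *: (h ** z) = 0 by rewrite nrm0.
    have h1 : h ** v = - 'i%C *: (w - v).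
      by rewrite -[in RHS]hv addrAC subrr add0r scalerA mulNr mul_ii opprK scale1r.
    have h2 : 'i%C *: (h ** (- 'i%C *: (w - v))) = h ** w - h ** v.
      by rewrite smulZr scalerA mulrN mul_ii opprK scale1r smulBr.
    rewrite /z; move: (- 'i%C *: (w - v)) h1 h2 => q h1 h2.
    rewrite smulBr scalerBr h2 addrACA -opprD.
    have -> : y ** w + 'i%C *: (h ** (y ** w)) = h ** w.
      by rewrite smulA -smulZl -smulDl hy.
    by rewrite -h1 [h ** v + _]addrC subrK subrr.
  by rewrite e nq; have := nrmB w v; lra.
have [->|y0] := eqVneq y 0; first by rewrite nrm0.
have := yw (star y); rewrite nrm_cstar' nrm_star expr2 ler_pM2r//.
exact: nrm_gt0.
Qed.

End Resolvent.

Section ClosedRange.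
Variables (A D : cstarAlgType R) (f : A -> D).
Hypothesis hf : star_hom f.

Let fl : linear_map f. Proof. by case: hf. Qed.
Let fM x y : f (x ** y) = f x ** f y. Proof. by case: hf. Qed.
Let fs x : f (star x) = star (f x). Proof. by case: hf. Qed.

(** The function [t / (1 + i t)] truncates [h] without moving its image much,
    because that image is small. *)
Let lift_sa1 h : star h = h -> nrm (f h) <= 4^-1 ->
  exists2 y, nrm y <= 2 & nrm (f h - f y) <= 3^-1 * 4^-1.
Proof.
move=> hs k4; have [y hy y2] := resolvent hs; exists y => //.
have e : f h - f y = 'i%C *: (f h ** f y).
  by rewrite -{1}hy (linD fl) (linZ fl) fM addrC addKr.
have n1 : nrm (f h - f y) <= 4^-1 * nrm (f y).
  rewrite e nrmZi; apply: (le_trans (nrmM _ _)).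
  by rewrite ler_wpM2r ?nrm_ge0.
have n2 := nrm_le_sub (f y) (f h); rewrite nrmC in n2.
lra.
Qed.

Let lift_sa h t : 0 < t -> star h = h -> nrm (f h) <= t ->
  exists2 y, nrm y <= 8 * t & nrm (f h - f y) <= 3^-1 * t.
Proof.
move=> t0 hs ht; have c0 : 0 < 4 * t by rewrite mulr_gt0.
have ca : `|(4 * t)^-1| = (4 * t)^-1 by rewrite ger0_norm// invr_ge0 ltW.
have [||y y2 hy] := @lift_sa1 (((4 * t)^-1)%:C%C *: h).
- by rewrite starZ hs; congr (_ *: _); exact: conjc_real.
- rewrite (linZ fl) nrmZR ca mulrC ler_pdivrMr// mulrA mulVf ?pnatr_eq0//.
  by rewrite mul1r.
exists ((4 * t)%:C%C *: y).
  rewrite nrmZR gtr0_norm//.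
  by rewrite (_ : 8 * t = 4 * t * 2) ?ler_pM2l//; ring.
have -> : f h - f ((4 * t)%:C%C *: y) =
    (4 * t)%:C%C *: (f (((4 * t)^-1)%:C%C *: h) - f y).
  by rewrite !(linZ fl) scalerBr scalerA -rmorphM /= divff ?gt_eqF// scale1r.
rewrite nrmZR gtr0_norm//; apply: (le_trans (ler_wpM2l (ltW c0) hy)).
by rewrite (_ : 4 * t * _ = 3^-1 * t) //; field.
Qed.

(** Real and imaginary parts are lifted separately. What matters is that the
    error is a fixed fraction below [1] of [t]. *)
Let lift a t : 0 < t -> nrm (f a) <= t ->
  exists2 y, nrm y <= 16 * t & nrm (f a - f y) <= 2 / 3 * t.
Proof.
move=> t0 ft; pose c : R[i] := (2^-1 : R)%:C%C.
have cc : c^* = c by exact: conjc_real.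
pose h := c *: (a + star a); pose k := c *: ('i%C *: (star a - a)).
have hs : star h = h by rewrite /h starZ cc starD starK addrC.
have ks : star k = k.
  by rewrite /k !starZ cc starB starK conj_i scaleNr -scalerN opprB.
have ahk : a = h + 'i%C *: k.
  rewrite /h /k [c *: ('i%C *: _)]scalerA [c * _]mulrC -scalerA scalerA mul_ii.
  rewrite scaleN1r -scalerN opprB -scalerDr.
  exact/esym/half_sum.
have bd b u : nrm (c *: u) = 2^-1 * nrm u -> nrm u <= 2 * b ->
    nrm (c *: u) <= b by move=> ->; lra.
have nc (u : D) : nrm (c *: u) = 2^-1 * nrm u by rewrite nrmZR ger0_norm.
have fa : nrm (f (star a)) <= t by rewrite fs nrm_star.
have [|y1 y1n y1h] := lift_sa t0 hs.
  rewrite /h (linZ fl) nc (linD fl).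
  have := nrmD (f a) (f (star a)); lra.
have [|y2 y2n y2h] := lift_sa t0 ks.
  rewrite /k (linZ fl) nc (linZ fl) nrmZi (linB fl).
  have := nrmB (f (star a)) (f a); lra.
exists (y1 + 'i%C *: y2).
  by apply: (le_trans (nrmD _ _)); rewrite nrmZi; lra.
have -> : f a - f (y1 + 'i%C *: y2) = (f h - f y1) + 'i%C *: (f k - f y2).
  by rewrite {1}ahk !(linD fl) !(linZ fl) opprD addrACA -scalerBr.
by apply: (le_trans (nrmD _ _)); rewrite nrmZi; lra.
Qed.

(** Approximate lifts of controlled norm, applied to successive errors, sum up
    to an exact lift: the argument of the open mapping theorem. *)
Lemma star_hom_closed_range d :
  (forall e : R, 0 < e -> exists a, nrm (d - f a) < e) -> range f d.
Proof.
move=> hd; pose t := nrm d + 1.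
have t0 : 0 < t by rewrite ltr_wpDl ?nrm_ge0.
pose q : R := 3 / 4.
have q0 n : 0 < q ^+ n by rewrite exprn_gt0//; rewrite /q; lra.
(* [s / 100] absorbs the error in approximating [d] by the range, and
     [101 / 100 * (2 / 3)] plus [1 / 100] stays below [q]. *)
have step n u : nrm (d - f u) <= t * q ^+ n ->
    exists2 v, nrm (d - f v) <= t * q ^+ n.+1 &
      nrm (v - u) <= 17 * t * q ^+ n.
  move=> hu; pose s := t * q ^+ n; have s0 : 0 < s by rewrite mulr_gt0.
  have [|b hb] := hd (s / 100); first by rewrite divr_gt0.
  have s1 : 0 < s + s / 100 by rewrite addr_gt0// divr_gt0.
  have [|y yn yh] := lift (a := b - u) s1.
    rewrite (linB fl); apply: (le_trans (nrm_tri _ d _)).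
    by rewrite nrmC addrC lerD// ltW.
  exists (u + y); last first.
    rewrite addrC addKr -mulrA -/s; lra.
  have -> : d - f (u + y) = (d - f b) + (f (b - u) - f y).
    by rewrite (linD fl) (linB fl) addrA addrA subrK opprD addrA.
  rewrite exprS mulrCA -/s /q.
  by apply: (le_trans (nrmD _ _)); lra.
have st n u : exists v, nrm (d - f u) <= t * q ^+ n ->
    nrm (d - f v) <= t * q ^+ n.+1 /\ nrm (v - u) <= 17 * t * q ^+ n.
  case: (leP (nrm (d - f u)) (t * q ^+ n)) => [/step[v h1 h2]|_];
    by [exists v|exists u].
pose g n u := projT1 (cid (st n u)).
pose u := fix u n := if n is m.+1 then g m (u m) else 0.
have hu n : nrm (d - f (u n)) <= t * q ^+ n.
  elim: n => [|n ih] /=.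
    by rewrite (lin0 fl) subr0 expr0 mulr1 /t lerDl.
  by rewrite /g; case: cid => v /= /(_ ih) [].
have hs n : nrm (u n.+1 - u n) <= 17 * t * q ^+ n.
  by rewrite /= /g; case: cid => v /= /(_ (hu n)) [].
have q01 : 0 <= q < 1 by rewrite /q; lra.
have [|l hl] := geometric_cauchy_limit q01 _ hs; first by rewrite mulr_ge0// ltW.
exists l => //; apply/esym/eqP; rewrite -subr_eq0; apply/eqP.
apply: (@nrm_small _ _ _ 1) => // e e0; rewrite mul1r.
set C := _ / _ in hl.
have C0 : 0 <= t + C.
  by rewrite addr_ge0 ?ltW// divr_gt0 ?mulr_gt0// /q; lra.
have [N /(_ N (leqnn N)) hN] := geometric_small q01 e0 C0.
apply: (le_trans (nrm_tri _ (f (u N)) _)); rewrite addrC.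
have := star_hom_contractive (l - u N) hf; rewrite (linB fl) nrmC.
have := hu N; have := hl N; move: hN; rewrite mulrDl addrC; lra.
Qed.

End ClosedRange.
End ResolventAndRange.

(** * Extreme points of the unit ball *)

Section Extreme.
Variable R : realType.

Lemma prim_root_complex (n : nat) : (0 < n)%N ->
  exists w : R[i], n.-primitive_root w.
Proof.
pose p : {poly R[i]} := 'X^n - 1; have [r Dp] := closed_field_poly_normal p.
move=> n0; rewrite (monicP _) ?monicXnsubC // scale1r in Dp.
have rn1 : all n.-unity_root r.
  by apply/allP=> z; rewrite -root_prod_XsubC -Dp.
have sz_r : (n < (size r).+1)%N.
  by rewrite -(size_prod_XsubC r id) -Dp size_XnsubC.
have [|z _ hz] := hasP (has_prim_root n0 rn1 _ sz_r); last by exists z.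
by rewrite -separable_prod_XsubC -Dp separable_Xn_sub_1// pnatr_eq0 -lt0n.
Qed.

Lemma nrmX (z : R[i]) n : nrm (z ^+ n) = nrm z ^+ n.
Proof. by elim: n => [|n ih]; rewrite ?expr0 ?nrm1// !exprS nrmMc ih. Qed.

Lemma nrm_prim_root n (w : R[i]) : n.-primitive_root w -> nrm w = 1.
Proof.
move=> hw; have n0 := prim_order_gt0 hw.
have := nrmX w n; rewrite (prim_expr_order hw) nrm1 => /esym/eqP.
by rewrite pexprn_eq1 ?nrm_ge0// eqn0Ngt n0 => /eqP.
Qed.

(** Cauchy's estimate: averaging [z^-1] times the polynomial over the [n.+1]-th
    roots of unity, scaled by [r], isolates the first coefficient. *)
Lemma cauchy_coef1 (V : normedModType R[i]) (n : nat) (a : nat -> V) (M r : R) :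
  (0 < n)%N -> 0 <= r ->
  (forall z : R[i], nrm z = r -> nrm (\sum_(j < n.+1) z ^+ j *: a j) <= M) ->
  r * nrm (a 1%N) <= M.
Proof.
move=> n0 r0 hM; have [w hw] := @prim_root_complex n.+1 isT.
have w1 := nrm_prim_root hw.
pose c : R[i] := r%:C%C.
have cr : nrm c = r by rewrite nrmRC ger0_norm.
have key : \sum_(i < n.+1) (w ^+ i) ^+ n *:
    (\sum_(j < n.+1) (c * w ^+ i) ^+ j *: a j) = (n.+1%:R * c) *: a 1%N.
  under eq_bigr do rewrite scaler_sumr.
  (* [w ^+ (i * n)] is the inverse of [w ^+ i]. *)
  rewrite exchange_big /=.
  have e (j : 'I_n.+1) (i : 'I_n.+1) :
      (w ^+ i) ^+ n *: ((c * w ^+ i) ^+ j *: a j) =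
      (w ^+ (n + j)) ^+ i *: (c ^+ j *: a j).
    rewrite !scalerA exprMn mulrCA mulrC -exprD -!exprM.
    by rewrite [(i * _)%N]mulnC.
  under eq_bigr do under eq_bigr do rewrite e.
  under eq_bigr do rewrite -scaler_suml.
  have j1 : (1 < n.+1)%N by rewrite ltnS.
  rewrite (bigD1 (Ordinal j1)) //= [X in _ + X]big1 => [|j jn1].
    rewrite addr0 addn1 (prim_expr_order hw) expr1.
    under eq_bigr do rewrite expr1n.
    by rewrite sumr_const card_ord scalerA.
  have wn1 : w ^+ (n + j) != 1.
    rewrite -(prim_order_dvd hw); apply: contra jn1 => /dvdnP [k hk].
    apply/eqP/val_inj => /=; have := ltn_ord j.
    case: k hk => [|[|k]]; rewrite ?mul0n ?mul1n; [lia|lia|].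
    rewrite !mulSn; lia.
  have := subrX1 (w ^+ (n + j)) n.+1.
  rewrite -exprM mulnC exprM (prim_expr_order hw) expr1n subrr => /esym/eqP.
  by rewrite mulf_eq0 subr_eq0 (negbTE wn1) /= => /eqP ->; rewrite scale0r.
have := nrm_sum (index_enum 'I_n.+1) (fun i : 'I_n.+1 => (w ^+ i) ^+ n *:
    (\sum_(j < n.+1) (c * w ^+ i) ^+ j *: a j)).
rewrite key nrmZ nrmMc cr.
have -> : nrm (n.+1%:R : R[i]) = n.+1%:R.
  by rewrite /nrm normr_nat raddfMn.
move=> h; rewrite -(@ler_pM2l _ n.+1%:R) ?ltr0n// mulrA (le_trans h)//.
apply: (@le_trans _ _ (\sum_(i < n.+1) M)).
  apply: ler_sum => i _; rewrite nrmZ !nrmX w1 !expr1n mul1r.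
  by apply: hM; rewrite nrmMc nrmX w1 expr1n mulr1.
by rewrite sumr_const card_ord mulr_natl.
Qed.

Lemma nrm_convex (V : normedModType R[i]) (x y : V) (c s : R) :
  nrm (x + y) <= c -> nrm (x - y) <= c -> `|s| <= 1 ->
  nrm (x + s%:C%C *: y) <= c.
Proof.
move=> h1 h2; rewrite ler_norml => /andP[s1 s2].
have -> : x + s%:C%C *: y = ((1 + s) / 2)%:C%C *: (x + y) +
    ((1 - s) / 2)%:C%C *: (x - y).
  rewrite !scalerDr scalerN addrACA -scalerDl -scalerBl -!rmorphD -rmorphB /=.
  rewrite (_ : (1 + s) / 2 + (1 - s) / 2 = 1) ?scale1r; last by field.
  by rewrite (_ : (1 + s) / 2 - (1 - s) / 2 = s)//; field.
apply: (le_trans (nrmD _ _)); rewrite !nrmZR.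
rewrite !ger0_norm ?divr_ge0//; [|lra|lra].
have s1' : 0 <= (1 + s) / 2 by lra.
have s2' : 0 <= (1 - s) / 2 by lra.
apply: (le_trans (lerD (ler_wpM2l s1' h1) (ler_wpM2l s2' h2))); lra.
Qed.

Lemma expand_power (V : normedModType R[i]) (K : V -> V) x n : linear_map K ->
  exists a : nat -> V, [/\ a 0%N = x, a 1%N = n%:R *: K x,
    forall j, (n < j)%N -> a j = 0 &
    forall z : R[i], iter n (fun y => y + z *: K y) x =
      \sum_(j < n.+1) z ^+ j *: a j].
Proof.
move=> lK; elim: n => [|n [a [a0 a1 an ih]]].
  exists (fun j => if j is 0 then x else 0); split=> //.
  - by rewrite scale0r.
  - by case.
  - by move=> z; rewrite big_ord1 expr0 scale1r.
exists (fun j => if j is i.+1 then a i.+1 + K (a i) else a 0%N); split=> //.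
- by rewrite a0 a1 -[in RHS]addn1 natrD scalerDl scale1r.
- by case=> // j jn; rewrite !an// ?(lin0 lK) ?addr0// ltnW.
- move=> z; rewrite iterS ih [RHS]big_ord_recl /= expr0 scale1r.
  rewrite (lin_sum lK) scaler_sumr.
  under [X in _ = _ + X]eq_bigr do rewrite scalerDr.
  rewrite big_split /= addrA; congr (_ + _); last first.
    by apply: eq_bigr => j _; rewrite (linZ lK) scalerA exprS.
  rewrite big_ord_recl expr0 scale1r; congr (_ + _).
  by rewrite big_ord_recr /= an// scaler0 addr0.
Qed.

(** The unit is an extreme point of the unit ball, in the corner where it acts
    on [Z]. As [K] is self-adjoint, the bounds on [1 + K] and [1 - K] give
    bounds on [1 + i K] and [1 - i K], hence on [1 + z K] and its powers for all
    complex [z] of modulus at most [1 / 2]. The first coefficient of [(1 + z K)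
    ^+ n] is [n K], so Cauchy's estimate bounds [K] by [2 / n] for every [n]. *)
Lemma one_extreme (D : cstarAlgType R) (K : multiplier D) (Z : set D) :
  star K = K ->
  (forall (z : R[i]) x y, Z x -> Z y -> Z (z *: x + y)) ->
  (forall x, Z x -> Z (K x : D)) ->
  (forall x, Z x -> nrm (x + (K x : D)) <= nrm x) ->
  (forall x, Z x -> nrm (x - (K x : D)) <= nrm x) ->
  forall x, Z x -> (K x : D) = 0.
Proof.
move=> Ks Zl ZK hp hm x0 Zx0.
have Kl : linear_map (K : D -> D) := @aop_lin _ _ (hself D) K.
have ZD x y : Z x -> Z y -> Z (x + y).
  by move=> Zx Zy; rewrite -[x]scale1r; apply: Zl.
have ZZ z x : Z x -> Z (z *: x).
  move=> Zx; have Z0 : Z 0 by rewrite -[0](subrr x) addrC -scaleN1r; apply: Zl.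
  by rewrite -[_ *: _]addr0; apply: Zl.
have sq x : Z x -> nrm (x + (K (K x : D) : D)) <= nrm x.
  move=> Zx; apply: (@nrm_half_sum _ _ _ ((K x : D) + K x)).
  - have := hp (x + (K x : D)) (ZD _ _ Zx (ZK _ Zx)).
    rewrite (linD Kl) => h; apply: le_trans (hp _ Zx); apply: le_trans h.
    by rewrite [(K x : D) + K (K x)]addrC addrACA.
  - have Zx' : Z (x - (K x : D)).
      by rewrite addrC -scaleN1r; apply: Zl => //; apply: ZK.
    have := hm _ Zx'; rewrite (linB Kl) => h.
    apply: le_trans (hm _ Zx); apply: le_trans h.
    by rewrite opprB opprD addrACA.
have tw (s : R[i]) x : s^* = - s -> s ^+ 2 = -1 -> Z x ->
    nrm (x + s *: (K x : D)) <= nrm x.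
  move=> sI s2 Zx; rewrite -(@ler_pXn2r _ 2)// ?nnegrE ?nrm_ge0//.
  have := @nrm_hip R D (hself D) (x + s *: (K x : D)).
  rewrite (hip_one_addi (X := hself D))// s2 scaleN1r opprK => <-.
  rewrite hip_selfE expr2; apply: (le_trans (nrmM _ _)).
  by rewrite nrm_star ler_wpM2l ?nrm_ge0// sq.
have ti x : Z x -> nrm (x + 'i%C *: (K x : D)) <= nrm x.
  by apply: tw; rewrite ?conj_i// sqr_i.
have tni x : Z x -> nrm (x - 'i%C *: (K x : D)) <= nrm x.
  by rewrite -scaleNr; apply: tw; rewrite ?sqrrN ?sqr_i// rmorphN/= conj_i.
have tz z x : nrm z <= 2^-1 -> Z x -> nrm (x + z *: (K x : D)) <= nrm x.
  move=> hz Zx.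
  have zr : `|complex.Re z| <= nrm z by rewrite -lecR -nrmE normc_ge_Re.
  have zi : `|complex.Im z| <= nrm z.
    rewrite -[nrm z]mul1r -[1]nrmi -nrmMc -lecR -nrmE.
    rewrite (_ : complex.Im z = - complex.Re ('i%C * z)); last first.
      by case: (z) => a b; simpc.
    by rewrite normrN normc_ge_Re.
  have hr : `|2 * complex.Re z| <= 1 by rewrite normrM ger0_norm//; lra.
  have hi : `|2 * complex.Im z| <= 1 by rewrite normrM ger0_norm//; lra.
  have hr' := nrm_convex (hp _ Zx) (hm _ Zx) hr.
  have hi' := nrm_convex (ti _ Zx) (tni _ Zx) hi.
  have -> : x + z *: (K x : D) = (2^-1 : R)%:C%C *:
      ((x + (2 * complex.Re z)%:C%C *: (K x : D)) +
       (x + (2 * complex.Im z)%:C%C *: ('i%C *: (K x : D)))).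
    have ez : (2 * complex.Re z)%:C%C + (2 * complex.Im z)%:C%C * 'i%C = z + z.
      case: (z) => a b; apply/eqP; rewrite eq_complex /=.
      by apply/andP; split; apply/eqP; ring.
    rewrite addrACA [(2 * complex.Im z)%:C%C *: _]scalerA -scalerDl ez scalerDl.
    rewrite addrACA; have := half_sum (x + z *: (K x : D)) 0.
    by rewrite addr0 subr0.
  rewrite nrmZR ger0_norm//.
  by apply: (le_trans (ler_wpM2l _ (nrmD _ _))) => //; lra.
have it z x n : nrm z <= 2^-1 -> Z x ->
    Z (iter n (fun y => y + z *: (K y : D)) x) /\
    nrm (iter n (fun y => y + z *: (K y : D)) x) <= nrm x.
  move=> hz Zx; elim: n => [|n [Zn hn]] //=; split.
    by apply: ZD => //; apply/ZZ/ZK.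
  exact: le_trans (tz _ _ hz Zn) hn.
apply: (@nrm_small _ _ _ (2 * nrm x0)) => [|e e0]; first by rewrite mulr_ge0 ?nrm_ge0.
pose n := (Num.bound e^-1).+1.
have en : e^-1 < n%:R.
  by rewrite (lt_trans (archi_boundP _)) ?invr_ge0 ?ltW// ltr_nat.
have [a [_ a1 _ ha]] := expand_power x0 n Kl.
have := @cauchy_coef1 D n a (nrm x0) 2^-1 isT.
rewrite invr_ge0 a1 nrmZ => /(_ _ _) h.
have {h} : 2^-1 * (nrm (n%:R : R[i]) * nrm (K x0 : D)) <= nrm x0.
  apply: h => // z hz; rewrite -ha.
  by have [] := it z x0 n _ Zx0; rewrite ?hz.
have -> : nrm (n%:R : R[i]) = n%:R by rewrite /nrm normr_nat raddfMn.
move=> h.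
have h2 : nrm (K x0 : D) <= e * (n%:R * nrm (K x0 : D)).
  rewrite mulrA -[leLHS]mul1r ler_wpM2r ?nrm_ge0//.
  by rewrite mulrC -ler_pdivrMr// div1r ltW.
apply: (le_trans h2).
rewrite [leRHS]mulrC ler_pM2l//.
by move: h; move: (_ * nrm (K x0 : D)) => t; lra.
Qed.

End Extreme.

(** * Sums of projections, and norms of powers *)

Lemma sum_const_seq (V : nmodType) (T : Type) (s : seq T) (x : V) :
  \sum_(i <- s) x = x *+ size s.
Proof. by elim: s => [|i s ih]; rewrite ?big_nil// big_cons ih mulrS. Qed.

Section Projections.
Variables (R : realType) (D : cstarAlgType R).

Lemma mul_proj_contraction (e : multiplier D) (x : D) :
  star e = e -> e ** e = e -> nrm (e x : D) <= nrm x.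
Proof.
move=> es ee; have [->|x0] := eqVneq (e x : D) 0; first by rewrite nrm0 nrm_ge0.
rewrite -(ler_pM2r (nrm_gt0 x0)) -expr2.
have := @nrm_hip R D (hself D) (e x); rewrite hip_aop es -aopME ee => <-.
by rewrite hip_selfE (le_trans (nrmM _ _))// nrm_star.
Qed.

(** The operator [1 - 2 p] is a self-adjoint unitary. *)
Lemma nrm_reflection (p x : D) : projection p ->
  nrm (x - (p ** x + p ** x)) = nrm x.
Proof.
move=> [ps pp]; pose u : multiplier D := Defs.adj1 - (toM p + toM p).
have us : star u = u.
  rewrite /u starB starD -toM_star ps; congr (_ - _); exact: adjop_ext.
have uE y : (u y : D) = y - (p ** y + p ** y) by rewrite /u aopBE.
have := @star_isometry R D (hself D) u x.
rewrite us !uE; apply; rewrite smulBr !smulDr smulA pp.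
set a := p ** x; have -> : a - (a + a) = - a by rewrite opprD addrA subrr add0r.
by rewrite -opprD opprK subrK.
Qed.

(** This stands for the fact that positive elements with sum [0] vanish. For a
    compressed projection [k = e p e], the reflection [1 - 2 p] gives [nrm (e -
    2 k) <= 1]. Summing these bounds over the other projections, whose
    compressions add up to [- k], gives [nrm (n e + 2 k) <= n]. Thus [e] is the
    midpoint of [e + (2 / n) k] and [e - (2 / n) k] in the unit ball, and
    extremality yields [k = 0]. *)
Lemma compressed_sum_eq0 (T : eqType) (s : seq T) (p : T -> D)
    (e : multiplier D) :
  star e = e -> e ** e = e -> (forall i, projection (p i)) ->
  (forall x : D, (e x : D) = x -> (e (\sum_(i <- s) p i ** x) : D) = 0) ->
  forall i x, i \in s -> (e x : D) = x -> p i ** x = 0.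
Proof.
move=> es ee hp h0 i x0 si ex0.
have el : linear_map (e : D -> D) := @aop_lin _ _ (hself D) e.
pose k j (x : D) : D := e (p j ** x).
have eK x : e (e x) = e x by rewrite -aopME ee.
have bA j (x : D) : (e x : D) = x -> nrm (x - (k j x + k j x)) <= nrm x.
  move=> ex; rewrite -{1}ex /k -(linD el) -(linB el).
  by rewrite (le_trans (mul_proj_contraction _ es ee))// nrm_reflection.
pose n := size s; have n0 : 0 < n%:R :> R.
  by rewrite ltr0n /n; case: (s) si.
have bB (x : D) : (e x : D) = x -> nrm (n%:R *: x + (k i x + k i x)) <= n%:R * nrm x.
  move=> ex.
  have sk : \sum_(j <- s) (x - (k j x + k j x)) = n%:R *: x.
    rewrite big_split /= sum_const_seq scaler_nat sumrN big_split /=.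
    have -> : \sum_(j <- s) k j x = 0.
      by rewrite -(lin_sum el) h0.
    by rewrite addr0 subr0.
  rewrite -sk (big_rem i)//= addrAC subrK.
  apply: (le_trans (nrmD _ _)).
  have -> : n%:R * nrm x = nrm x + \sum_(j <- rem i s) nrm x.
    rewrite sum_const_seq size_rem// mulr_natl -/n.
    by case: (n) n0 => [|m _]; rewrite ?ltxx// mulrS.
  rewrite lerD2l (le_trans (nrm_sum _ _))// ler_sum// => j _; exact: bA.
pose c : R := 2 / n%:R.
have c0 : 0 <= c by rewrite divr_ge0// ltW.
have [K [Ks KE]] : exists K : multiplier D, star K = K /\
    forall x : D, (e x : D) = x -> (K x : D) = c%:C%C *: k i x.
  exists (c%:C%C *: (e ** toM (p i) ** e)); split.
    rewrite starZ !starM es -toM_star (proj1 (hp i)) smulA.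
    by congr (_ *: _); exact: conjc_real.
  by move=> x ex; rewrite aopZE !aopME ex.
have := @one_extreme R D K [set x : D | (e x : D) = x].
have c2 (x : D) : c%:C%C *: x = (n%:R^-1)%:C%C *: (x + x).
  by rewrite scalerDr -scalerDl -rmorphD/=; congr (_%:C%C *: _); rewrite /c; ring.
have nn (x : D) : x = (n%:R^-1)%:C%C *: (n%:R *: x).
  have -> : n%:R = (n%:R : R)%:C%C :> R[i] by rewrite rmorphMn rmorph1.
  by rewrite scalerA -rmorphM /= mulVf ?gt_eqF// scale1r.
have ni : `|n%:R^-1| = n%:R^-1 :> R by rewrite ger0_norm// invr_ge0 ltW.
move=> /(_ Ks _ _ _ _ x0 ex0) => h.
have {h} : (K x0 : D) = 0.
  apply: h => /=.
  - by move=> z x y ex ey; rewrite el ex ey.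
  - by move=> x ex; rewrite KE// (linZ el) /k eK.
  - move=> x ex; rewrite KE// c2 {1}[x]nn -scalerDr nrmZR ni.
    by rewrite mulrC ler_pdivrMr// mulrC bB.
  - move=> x ex; rewrite KE// c2.
    have -> : x - (n%:R^-1)%:C%C *: (k i x + k i x) =
       (n%:R^-1)%:C%C *: (x - (k i x + k i x)) + (1 - n%:R^-1)%:C%C *: x.
      by rewrite scalerBr rmorphB rmorph1 /= scalerBl scale1r [RHS]addrC addrA subrK.
    apply: (le_trans (nrmD _ _)); rewrite !nrmZR ni.
    have n1 : n%:R^-1 <= 1 :> R by rewrite invf_le1// ler1n -(ltr0n R).
    rewrite [ `|1 - _|]ger0_norm ?subr_ge0//.
    have := bA i x ex; have : 0 <= n%:R^-1 :> R by rewrite -ni normr_ge0.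
    move=> h1 /(ler_wpM2l h1); lra.
rewrite KE// => /eqP; rewrite scaler_eq0 => /orP[/eqP cz|/eqP hk].
  have c1 : 0 < c by rewrite divr_gt0.
  by move: c1; rewrite (_ : c = 0) ?ltxx//; apply: (@complexI R).
apply: star_eq0; rewrite starM (proj1 (hp i)) -smulA [p i ** (_ ** _)]smulA.
by rewrite (proj2 (hp i)) -{1}ex0 mul_star es -/(k i x0) hk smul0r.
Qed.

End Projections.

Section Growth.
Variables (R : realType) (A : cstarAlgType R).

(** The exponent is shifted by one, because [A] has no unit. *)
Fixpoint spow (h : A) m := if m is k.+1 then h ** spow h k else h.

Lemma spowD h m n : spow h m ** spow h n = spow h (m + n).+1.
Proof. by elim: m => //= m ih; rewrite -smulA ih. Qed.

Lemma star_spow h m : star h = h -> star (spow h m) = spow h m.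
Proof.
move=> hs; elim: m => //= m ih; rewrite starM ih hs.
by have := spowD h m 0; rewrite addn0.
Qed.

Lemma nrm_spow h k : star h = h -> nrm (spow h (2 ^ k).-1) = nrm h ^+ (2 ^ k).
Proof.
move=> hs; elim: k => [|k ih] //=.
rewrite expnS mul2n -addnn exprD -ih -expr2 -nrm_cstar star_spow// spowD.
congr (nrm (spow _ _)).
by have := expn_gt0 2 k; case: (2 ^ k)%N => // m _; rewrite addSn addnS.
Qed.

(** The C*-identity makes the norm of the power [2 ^ k] exactly multiplicative,
    so a factor [C] in the growth of powers is harmless. This plays the role of
    the spectral radius formula. *)
Lemma spow_growth h (C M : R) : star h = h -> 0 < M ->
  (forall m, nrm (spow h m) <= C * M ^+ m) -> nrm h <= M.
Proof.
move=> hs M0 hM; rewrite leNgt; apply/negP => hlt.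
have h0 : 0 < nrm h := lt_trans M0 hlt.
have C0 : 0 <= C by have := hM 0%N; rewrite mulr1; apply/le_trans/nrm_ge0.
pose q := M / nrm h.
have q01 : 0 <= q < 1 by rewrite divr_ge0 ?ltW//= ltr_pdivrMr// mul1r.
have CM : 0 <= C / M by rewrite divr_ge0// ltW.
have [N /(_ (2 ^ N)%N (ltnW (ltn_expl _ _))) hN] := geometric_small q01 ltr01 CM.
have := hM (2 ^ N).-1; rewrite nrm_spow// leNgt => /negP; apply.
have : C / M * q ^+ (2 ^ N) < 1 by exact: hN.
rewrite /q expr_div_n mulrA ltr_pdivrMr ?exprn_gt0// mul1r.
apply: le_lt_trans; rewrite -mulrA ler_wpM2l//.
have := expn_gt0 2 N; case: (2 ^ N)%N => // m _.
by rewrite exprS mulrA mulVf ?mul1r// gt_eqF.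
Qed.

End Growth.

(** * Cuntz-Krieger families and sums over vertices *)

Section CuntzKrieger.
Variables (R : realType) (E : digraph) (D : cstarAlgType R).
Variables (P : vert E -> D) (S : edge E -> D).
Hypothesis CK : cuntz_krieger_family P S.
Hypothesis rf : row_finite E.

Let Pp v : projection (P v). Proof. by have [[]] := CK. Qed.
Let Ps v : star (P v) = P v. Proof. by have [] := Pp v. Qed.
Let PP v : P v ** P v = P v. Proof. by have [] := Pp v. Qed.
Let SS e : S e ** star (S e) ** S e = S e.
Proof. by have [_ h _ _ _] := CK; exact: h. Qed.

Let p e := S e ** star (S e).

Let ps e : star (p e) = p e. Proof. by rewrite /p starM starK. Qed.
Let pS e : p e ** S e = S e. Proof. exact: SS. Qed.
Let pp e : projection (p e).
Proof. by split=> //; rewrite {2}/p smulA pS. Qed.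

Lemma ck_sum e : exists s : seq (edge E),
  [/\ uniq s, e \in s, forall f, (f \in s) = (rng f == rng e)
    & P (rng e) = \sum_(f <- s) S f ** star (S f)].
Proof.
have [_ _ _ _ /(_ (rng e) (rf _)) h] := CK.
pose F := fset_set [set f | rng f = rng e].
have m f : (f \in F) = (rng f == rng e).
  rewrite in_fset_set; last exact: rf.
  by apply/idP/eqP => [/set_mem|h']; [|exact/mem_set].
exists (finmap.enum_fset F); split=> //.
- by change (e \in F); rewrite m.
- by rewrite h; [rewrite fsbig_finite//; exact: rf|exists e].
Qed.

(** Compressed by [1 - P v], the range projections of the edges into [v] sum to
    the compression of [P v], that is to [0]. *)
Let pP e : p e ** P (rng e) = p e.
Proof.
have [s [us es ms hs]] := ck_sum e.
set v := rng e in hs *.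
pose q : multiplier D := Defs.adj1 - toM (P v).
have qE (x : D) : (q x : D) = x - P v ** x by rewrite /q aopBE.
have q0 (x : D) : (q x : D) = x -> P v ** x = 0.
  by rewrite qE => /(congr1 (fun z => x - z)); rewrite opprB addrC subrK subrr.
have qs : star q = q.
  rewrite /q starB -toM_star Ps; congr (_ - _); exact: adjop_ext.
have qq : q ** q = q.
  apply: adjop_ext => x; rewrite aopME !qE.
  by rewrite smulBr smulA PP subrr subr0.
have h := @compressed_sum_eq0 R D _ s p q qs qq pp _ e _ es.
apply: smul_inj => d; rewrite -smulA; apply/eqP; rewrite eq_sym -subr_eq0 -smulBr.
apply/eqP/h.
  move=> x /q0 Px; rewrite -smul_suml -hs Px; exact: (lin0 (@aop_lin _ _ (hself D) q)).
by rewrite qE smulBr smulA PP subrr subr0.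
Qed.

Lemma ck_range e : P (rng e) ** S e = S e.
Proof.
have Pp' : P (rng e) ** p e = p e by apply: star_inj; rewrite starM Ps ps pP.
by rewrite -{1}[S e]pS smulA Pp' pS.
Qed.

(** For two edges into the same vertex, compress by [p e]: the range projections
    of the other edges sum to [P v - p e], whose compression is [0]. *)
Lemma ck_orth e f : e != f -> star (S e) ** S f = 0.
Proof.
move=> ef; have [rr|rr] := eqVneq (rng e) (rng f); last first.
  rewrite -(ck_range e) -(ck_range f) starM Ps -smulA [P _ ** (_ ** _)]smulA.
  by have [[_ ->]//] := CK; rewrite smul0l smul0r.
have [s [us fs ms hs]] := ck_sum f.
have es : e \in rem f s by rewrite rem_filter// mem_filter /= ef ms rr eqxx.
have ff : toM (p f) ** toM (p f) = toM (p f) by rewrite -toM_mul (proj2 (pp f)).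
have fst : star (toM (p f)) = toM (p f) by rewrite -toM_star ps.
have h := @compressed_sum_eq0 R D _ (rem f s) p (toM (p f)) fst ff pp _ e (S f) es.
have -> : star (S e) ** S f = star (S e) ** (p e ** S f).
  have -> : star (S e) ** (p e ** S f) = star (S e ** star (S e) ** S e) ** S f.
    by rewrite !starM starK !smulA.
  by rewrite SS.
rewrite h ?smul0r//; last by rewrite toME pS.
move=> x; rewrite !toME => px.
have e1 : \sum_(i <- rem f s) p i ** x = P (rng f) ** x - p f ** x.
  by rewrite hs [X in _ = X ** _ - _](big_rem f)//= smulDl addrC addKr smul_suml.
by rewrite e1 smulBr px smulA pP subrr.
Qed.

End CuntzKrieger.

Section C0Representation.
Variables (R : realType) (V : choiceType) (D : cstarAlgType R) (P : V -> D).
Hypothesis Pp : forall v, projection (P v).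
Hypothesis Po : forall v w, v != w -> P v ** P w = 0.

Let orth_mul (s : seq V) (c d : V -> R[i]) : uniq s ->
  (\sum_(v <- s) c v *: P v) ** (\sum_(v <- s) d v *: P v) =
  \sum_(v <- s) (c v * d v) *: P v.
Proof.
move=> us; rewrite smul_suml; apply: eq_big_seq => v vs.
rewrite smul_sumr (big_rem v)//= smulZl smulZr (proj2 (Pp v)) scalerA.
rewrite big_seq big1 ?addr0// => w; rewrite rem_filter// mem_filter /= => /andP[wv _].
by rewrite smulZl smulZr Po ?scaler0// eq_sym.
Qed.

(** The power [m.+1] of [star t ** t] is the same sum with coefficients at most
    [M ^+ (2 * m.+1)], hence grows no faster than a constant times [M ^+ (2 *
    m)]. *)
Lemma nrm_orth_sum (s : seq V) (c : V -> R[i]) (M : R) : uniq s -> 0 < M ->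
  (forall v, v \in s -> nrm (c v) <= M) -> nrm (\sum_(v <- s) c v *: P v) <= M.
Proof.
move=> us M0 cM; set t := \sum_(v <- s) _.
pose k v : R[i] := (c v)^* * c v.
have kn v : nrm (k v) = nrm (c v) ^+ 2 by rewrite nrmMc nrm_conj.
have tt : star t ** t = \sum_(v <- s) k v *: P v.
  rewrite star_sum -orth_mul//; congr (_ ** _); apply: eq_bigr => v _.
  by rewrite starZ (proj1 (Pp v)).
have pw m : spow (star t ** t) m = \sum_(v <- s) (k v ^+ m.+1) *: P v.
  elim: m => [|m ih] /=.
    by rewrite tt; apply: eq_bigr => v _; rewrite expr1.
  by rewrite ih tt orth_mul//; apply: eq_bigr => v _; rewrite [in RHS]exprS.
rewrite -(@ler_pXn2r _ 2)// ?nnegrE ?nrm_ge0 ?(ltW M0)// -nrm_cstar.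
apply: (@spow_growth _ _ _ (\sum_(v <- s) M ^+ 2 * nrm (P v))).
- by rewrite starM starK.
- by rewrite exprn_gt0.
move=> m; rewrite pw (le_trans (nrm_sum _ _))// mulr_suml.
rewrite big_seq [leRHS]big_seq ler_sum// => v vs.
rewrite nrmZ nrmX kn mulrAC -exprS ler_wpM2r ?nrm_ge0//.
rewrite ler_pXn2r ?nnegrE ?exprn_ge0 ?nrm_ge0 ?(ltW M0)//.
by rewrite ler_pXn2r ?cM ?nnegrE ?nrm_ge0 ?(ltW M0).
Qed.

(** As [a] vanishes at infinity, the finite sums of the [a v *: P v] converge in
    norm; so the sum is an element of [D] and not only a multiplier. *)
Lemma c0_sum (a : c0 R V) : exists d : D, forall v, P v ** d = a v *: P v.
Proof.
pose val (s : seq V) := \sum_(v <- s) a v *: P v.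
pose near (e : R) (s : seq V) :=
  [/\ 0 < e, uniq s & forall v, v \notin s -> nrm (a v) <= e].
have sub e e' s s' : near e s -> near e' s' -> nrm (val s - val s') <= 1 * (e + e').
  move=> [e0 us hs] [e'0 us' hs'].
  pose u := undup (s ++ s').
  have restrict (t : seq V) : uniq t -> {subset t <= u} ->
      val t = \sum_(v <- u) (if v \in t then a v else 0) *: P v.
    move=> ut tu.
    rewrite (eq_bigr (fun v => if v \in t then a v *: P v else 0)); last first.
      by move=> v _; case: ifP => // _; rewrite scale0r.
    rewrite -big_mkcond -big_filter /=; apply: perm_big; apply: uniq_perm => //.
      by rewrite filter_uniq// undup_uniq.
    move=> v; rewrite mem_filter; apply/idP/andP => [vt|[]//].
    by split=> //; apply: tu.
  rewrite mul1r (restrict s)//; last first.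
    by move=> v vs; rewrite mem_undup mem_cat vs.
  rewrite (restrict s')//; last first.
    by move=> v vs; rewrite mem_undup mem_cat vs orbT.
  rewrite -sumrB; under eq_bigr do rewrite -scalerBl.
  apply: nrm_orth_sum; rewrite ?undup_uniq// ?addr_gt0//.
  move=> v _; case: ifPn => vs; case: ifPn => vs'.
  - by rewrite subrr nrm0 ltW// addr_gt0.
  - by rewrite subr0 (le_trans (hs' _ vs'))// lerDr ltW.
  - by rewrite sub0r nrmN (le_trans (hs _ vs))// lerDl ltW.
  - by rewrite subrr nrm0 ltW// addr_gt0.
have ex e : 0 < e -> exists s, near e s.
  move=> e0; have eC : 0 < e%:C%C by have := e0; rewrite -ltcR.
  have fin := c0P a eC; pose F := fset_set [set v | e%:C%C <= `|a v|].
  exists (finmap.enum_fset F); split=> //.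
  move=> v; change (v \notin F -> nrm (a v) <= e).
  rewrite in_fset_set// notin_setE /= nrmE lecR => /negP.
  by rewrite -ltNge => /ltW.
have [d hd] := approximation_limit ler01 ex sub.
exists d => v; apply/eqP; rewrite -subr_eq0; apply/eqP.
apply: (nrm_small (nrm_ge0 (P v))) => e e0.
have [s [_ us hs]] := ex _ e0; pose t := undup (v :: s).
have nt : near e t.
  split=> //; first exact: undup_uniq.
  move=> w; rewrite mem_undup inE negb_or => /andP[_]; exact: hs.
have vt : v \in t by rewrite mem_undup mem_head.
have Pt : P v ** val t = a v *: P v.
  rewrite /val smul_sumr (big_rem v)//= smulZr (proj2 (Pp v)).
  rewrite big_seq big1 ?addr0// => w.
  rewrite rem_filter ?undup_uniq// mem_filter /= => /andP[wv _].
  by rewrite smulZr Po ?scaler0// eq_sym.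
rewrite -Pt -smulBr (le_trans (nrmM _ _))// ler_wpM2l ?nrm_ge0//.
by have := hd _ _ nt; rewrite mul1r.
Qed.

End C0Representation.

(** * Nondegenerate maps and extension to multipliers *)

Section Nondegenerate.
Variable R : realType.

Lemma closed_subspace_star (D : cstarAlgType R) (M : set D) :
  closed_subspace M -> closed_subspace [set x | M (star x)].
Proof.
move=> [cM M0 lM]; split=> /=; last 2 first.
- by rewrite star0.
- by move=> z x y Mx My; rewrite starD starZ; apply: lM.
apply: closed_nrm => x h /=; apply: (nrm_closed cM) => e e0.
by have [w Mw xw] := h e e0; exists (star w) => //; rewrite -starB nrm_star.
Qed.

(** The elements of the closed right ideal whose adjoints also belong to it form
    a C*-subalgebra. *)
Lemma right_ideal_span (D : cstarAlgType R) (X Q : set D) :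
  let W := closed_span [set p ** x | p in Q & x in [set: D]] in
  cstar_gen X = setT -> (forall x, X x -> W x /\ W (star x)) -> W = setT.
Proof.
move=> W XT h; apply/seteqP; split=> // d _.
have cW : closed_subspace W := closed_subspace_span _.
have Wr x y : W x -> W (x ** y).
  move: x; apply: closed_span_sub.
    exact: (closed_subspace_preim (smul_boundedr y) cW).
  move=> _ [p Qp [x _ <-]] /=; apply: sub_closed_span.
  by exists p => //; exists (x ** y) => //; rewrite smulA.
have : cstar_gen X d by rewrite XT.
suff: cstar_subalgebra [set x | W x /\ W (star x)].
  by move=> hW hd; have [] := hd _ (conj hW h).
split.
- exact: (closed_subspaceI cW (closed_subspace_star cW)).
- by move=> x y [Wx Wsx] [Wy Wsy]; split; [apply: Wr|rewrite starM; apply: Wr].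
- by move=> x [Wx Wsx]; split=> //; rewrite starK.
Qed.

Lemma right_ideal_faithful (D : cstarAlgType R) (Q : set D) (d : D) :
  closed_span [set p ** x | p in Q & x in [set: D]] = setT ->
  (forall p, Q p -> star p ** d = 0) -> d = 0.
Proof.
move=> WT h; apply: star_eq0.
have : closed_span [set p ** x | p in Q & x in [set: D]] d by rewrite WT.
suff hy : closed_span [set p ** x | p in Q & x in [set: D]] `<=`
    [set y | star d ** y = 0] by move=> /hy.
apply: closed_span_sub.
  exact: (closed_subspace_preim (smul_boundedl (star d)) (@closed_subspace0 _ _)).
move=> _ [p Qp [x _ <-]] /=.
by rewrite smulA -[star d ** p]starK starM starK h// star0 smul0l.
Qed.

Section Extension.
Variables (A D : cstarAlgType R) (X : hilbertModType D) (f : A -> adjop X).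
Hypothesis hf : star_hom f.
Hypothesis nf : Defs.nondegenerate f.

Let fM x y : f (x ** y) = f x ** f y. Proof. by case: hf. Qed.
Let fs x : f (star x) = star (f x). Proof. by case: hf. Qed.

Let spanf : closed_span (range (fun p : A * X => f p.1 p.2)) = setT.
Proof.
rewrite -nf; congr closed_span; apply/seteqP; split=> y /=.
  by case=> -[a x] _ /= <-; exists a => //; exists x.
by case=> a _ [x _ <-]; exists (a, x).
Qed.

Lemma mext_unique (m : multiplier A) (n : adjop X) :
  (forall a x, n (f a x) = f (m a) x) -> mext f m = n.
Proof.
move=> hn; rewrite /mext; apply: xget_unique => // n' /= hn'.
apply: (adjop_span_ext nf) => _ [a _ [x _ <-]].
by rewrite hn hn'.
Qed.

Lemma mext_toM a : mext f (toM a) = f a.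
Proof. by apply: mext_unique => b x; rewrite -aopME -fM. Qed.

Let isom_ext (m : multiplier A) : star m ** m = Defs.adj1 ->
  exists T : X -> X, bounded_linear T /\ forall a x, T (f a x) = f (m a) x.
Proof.
move=> mm; have mmE a : star m (m a) = a by rewrite -aopME mm.
have [|T [lT Tx bT]] := @bounded_extension R X X _
  (fun p : A * X => f p.1 p.2) (fun p => f (m p.1) p.2) 1 ler01 spanf.
  move=> s; rewrite mul1r le_eqVlt; apply/orP; left.
  rewrite -(@eqrXn2 _ 2)// ?nrm_ge0// -!nrm_hip; apply/eqP; congr nrm.
  rewrite !hip_suml; apply: eq_bigr => -[c [a x]] _.
  rewrite !hip_sumr; apply: eq_bigr => -[d [b y]] _ /=.
  rewrite !hipZl !hipZr !hip_aop -!fs -!aopME -!fM; congr (_ *: (_ *: hip _ (f _ _))).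
  by rewrite mul_star mmE.
exists T; split; last by move=> a x; exact: (Tx (a, x)).
by split=> //; exists 1.
Qed.

(** The inner products of vectors [f a x] only involve products [star a ** b],
    which a unitary multiplier preserves. So [f a x |-> f (m a) x] is isometric,
    hence well defined on the span, and its adjoint is the same map for [star
    m]. *)
Lemma mext_unitary (m : multiplier A) :
  star m ** m = Defs.adj1 -> m ** star m = Defs.adj1 ->
  [/\ forall a x, mext f m (f a x) = f (m a) x,
      star (mext f m) ** mext f m = Defs.adj1
    & mext f m ** star (mext f m) = Defs.adj1].
Proof.
move=> mm mm'.
have [T [bT hT]] := isom_ext mm.
have [|T' [bT' hT']] := isom_ext (m := star m); first by rewrite starK.
have adj x y : hip (T x) y = hip x (T' y) :> D.
  apply: star_inj; rewrite !hip_star.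
  have := @bounded_linear_eq _ _ _ _ _ _
    (bounded_linear_comp bT (hip_bounded y)) (hip_bounded (T' y)) spanf.
  apply => _ [[a u] _ <-] /=; rewrite hT; apply: star_inj; rewrite !hip_star.
  have := @bounded_linear_eq _ _ _ _ _ _ (hip_bounded (f (m a) u))
    (bounded_linear_comp bT' (hip_bounded (f a u))) spanf.
  apply => _ [[b v] _ <-] /=; rewrite hT' !hip_aop -!fs -!aopME -!fM.
  by rewrite mul_star.
pose n : adjop X := AdjOp adj.
have hn a x : n (f a x) = f (m a) x by exact: hT.
have hn' a x : star n (f a x) = f (star m a) x by exact: hT'.
rewrite (mext_unique hn); split=> //.
- apply: (adjop_span_ext nf) => _ [a _ [x _ <-]].
  by rewrite aopME hn hn' -aopME mm.
- apply: (adjop_span_ext nf) => _ [a _ [x _ <-]].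
  by rewrite aopME hn' hn -[m _]aopME mm'.
Qed.

End Extension.

Lemma unitary_isometry (D : cstarAlgType R) (X : hilbertModType D)
  (u : adjop X) x : star u ** u = Defs.adj1 -> nrm (u x) = nrm x.
Proof. by move=> uu; apply: star_isometry; rewrite -aopME uu. Qed.

Lemma unitary_bounded (D : cstarAlgType R) (X : hilbertModType D)
  (u : adjop X) : star u ** u = Defs.adj1 -> bounded_linear u.
Proof.
move=> uu; split; first exact: aop_lin.
by exists 1 => // x; rewrite mul1r unitary_isometry.
Qed.

Section UnitaryRep.
Variables (G : groupType) (D : cstarAlgType R) (U : G -> multiplier D).
Hypothesis hU : unitary_rep U.

Lemma urep1 : U 1%g = Defs.adj1. Proof. by case: hU. Qed.
Lemma urepM g h : U (g * h)%g = U g ** U h. Proof. by case: hU. Qed.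

Lemma urepVK g x : U g (U g^-1%g x) = x.
Proof. by rewrite -aopME -urepM mulgV urep1. Qed.

Lemma urepV g : star (U g) = U g^-1%g.
Proof.
apply: adjop_ext => x; have [_ _ /(_ g) [uu _]] := hU.
by rewrite -{1}[x](urepVK g) -aopME uu.
Qed.

Lemma urep_star g : star (U g) ** U g = Defs.adj1.
Proof. by have [_ _ /(_ g) []] := hU. Qed.

Lemma urep_star' g : U g ** star (U g) = Defs.adj1.
Proof. by have [_ _ /(_ g) []] := hU. Qed.

End UnitaryRep.

End Nondegenerate.

(** * The map induced on compact operators *)

Section ToeplitzCompacts.
Variables (R : realType) (B : cstarAlgType R) (Y : hilbertModType B).
Variables (lact : B -> adjop Y) (D : cstarAlgType R) (psi : Y -> D) (zeta : B -> D).
Hypothesis TR : toeplitz_rep lact psi zeta.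

Let psil : linear_map psi. Proof. by case: TR. Qed.
Let zh : star_hom zeta. Proof. by case: TR. Qed.
Let hpsi x y : star (psi x) ** psi y = zeta (hip x y). Proof. by case: TR. Qed.
Let zpsi b x : zeta b ** psi x = psi (lact b x). Proof. by case: TR. Qed.
Let zM x y : zeta (x ** y) = zeta x ** zeta y. Proof. by case: zh. Qed.
Let zs x : zeta (star x) = star (zeta x). Proof. by case: zh. Qed.

Lemma toeplitz_contractive x : nrm (psi x) <= nrm x.
Proof.
rewrite -(@ler_pXn2r _ 2)// ?nnegrE ?nrm_ge0// -nrm_cstar hpsi -nrm_hip.
exact: star_hom_contractive.
Qed.

Lemma toeplitz_bounded : bounded_linear psi.
Proof. by split=> //; exists 1 => // x; rewrite mul1r toeplitz_contractive. Qed.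

(** The difference [d] of the two sides satisfies [star d ** d = 0]. *)
Lemma toeplitz_ract x b : psi (ract x b) = psi x ** zeta b.
Proof.
apply/eqP; rewrite -subr_eq0; apply/eqP; apply: star_eq0.
set d := psi (ract x b) - _.
have h y : star (psi y) ** d = 0.
  by rewrite smulBr smulA !hpsi hip_ract zM subrr.
by rewrite {1}/d starB starM smulBl h -smulA h smul0r subrr.
Qed.

Let Th (s : seq (Y * Y)) : adjop Y := \sum_(p <- s) theta p.1 p.2.
Let val (s : seq (Y * Y)) : D := \sum_(p <- s) psi p.1 ** star (psi p.2).

Let ThE s x : Th s x = \sum_(p <- s) ract p.1 (hip p.2 x).
Proof. by rewrite /Th aop_sumE. Qed.

Lemma rank_one_sum_psi s z :
  (\sum_(p <- s) psi p.1 ** star (psi p.2)) ** psi z =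
  psi ((\sum_(p <- s) theta p.1 p.2 : adjop Y) z).
Proof.
rewrite smul_suml -/(Th s) ThE (lin_sum psil); apply: eq_bigr => p _.
by rewrite -smulA hpsi toeplitz_ract.
Qed.

Let val_psi s z : val s ** psi z = psi (Th s z).
Proof. exact: rank_one_sum_psi. Qed.

Let comb (z : R[i]) (s t : seq (Y * Y)) := [seq (z *: p.1, p.2) | p <- s] ++ t.
Let swap (s : seq (Y * Y)) := [seq (p.2, p.1) | p <- s].
Let push (T : adjop Y) (s : seq (Y * Y)) := [seq (T p.1, p.2) | p <- s].

Let Th_comb z s t x : Th (comb z s t) x = z *: Th s x + Th t x.
Proof.
rewrite !ThE /comb big_cat big_map /= scaler_sumr; congr (_ + _).
by apply: eq_bigr => p _; rewrite ractZl.
Qed.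

Let val_comb z s t : val (comb z s t) = z *: val s + val t.
Proof.
rewrite /val /comb big_cat big_map /= scaler_sumr; congr (_ + _).
by apply: eq_bigr => p _; rewrite (linZ psil) smulZl.
Qed.

Let Th_swap s : Th (swap s) = star (Th s).
Proof. by rewrite /Th /swap big_map star_sum; apply: eq_bigr => p _; exact: adjop_ext. Qed.

Let val_swap s : val (swap s) = star (val s).
Proof.
by rewrite /val /swap big_map star_sum; apply: eq_bigr => p _; rewrite starM starK.
Qed.

Let Th_push T s x : Th (push T s) x = T (Th s x).
Proof.
rewrite !ThE /push big_map (lin_sum (aop_lin T)); apply: eq_bigr => p _.
by rewrite aop_ract.
Qed.

Let adj_bound (T : adjop Y) c : 0 <= c -> (forall x, nrm (T x) <= c * nrm x) ->
  forall x, nrm (star T x) <= 4 * c * nrm x.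
Proof.
move=> c0 hT x; have [->|x0] := eqVneq (star T x) 0.
  by rewrite nrm0 !mulr_ge0// nrm_ge0.
rewrite -(ler_pM2r (nrm_gt0 x0)) -expr2 -nrm_hip hip_aop starK.
apply: (le_trans (nrm_hip_le _ _)).
rewrite (_ : 4 * c * nrm x * _ = 4 * (nrm x * (c * nrm (star T x)))); last by ring.
by rewrite ler_pM2l// ler_wpM2l ?nrm_ge0.
Qed.

(** Let [t] be the sum in [D] and [T] the sum of rank one operators. Since [t **
    psi x = psi (T x)], the power [m.+1] of [t ** star t] is again a sum of
    terms [psi x ** star (psi y)], with [(T ** star T)] applied [m] times to
    fixed vectors. So the powers grow at the rate of the norm of [T ** star T],
    and that rate is the norm of [t ** star t]. *)
Lemma rank_one_sum_bound s c : 0 < c ->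
  (forall x, nrm ((\sum_(p <- s) theta p.1 p.2 : adjop Y) x) <= c * nrm x) ->
  nrm (\sum_(p <- s) psi p.1 ** star (psi p.2)) <= 2 * c.
Proof.
move=> c0 hT; rewrite -/(Th s) in hT *; rewrite -/(val s).
have hT' := adj_bound (ltW c0) hT.
set t := val s; set T := Th s in hT hT'.
pose H (x : Y) := T (star T x).
have hH x : nrm (H x) <= 4 * c ^+ 2 * nrm x.
  apply: (le_trans (hT _)); rewrite (_ : 4 * _ * _ = c * (4 * c * nrm x)); last by ring.
  by rewrite ler_pM2l.
have hpow m : spow (t ** star t) m =
    \sum_(p <- s) psi (iter m H (T p.2)) ** star (psi p.1).
  elim: m => [|m ih] /=.
    rewrite /t -val_swap /val /swap big_map smul_sumr; apply: eq_bigr => p _.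
    by rewrite smulA -/(val s) val_psi.
  rewrite ih smul_sumr; apply: eq_bigr => p _.
  by rewrite smulA -[t ** _ ** _]smulA -val_swap val_psi Th_swap val_psi.
have hiter m x : nrm (iter m H x) <= (4 * c ^+ 2) ^+ m * nrm x.
  elim: m => [|m ih] /=; first by rewrite mul1r.
  apply: (le_trans (hH _)); rewrite [_ ^+ m.+1]exprS -[leRHS]mulrA ler_wpM2l//.
  by rewrite mulr_ge0// exprn_ge0// ltW.
rewrite -(@ler_pXn2r _ 2)// ?nnegrE ?nrm_ge0 ?mulr_ge0 ?(ltW c0)//.
rewrite -nrm_cstar' exprMn (_ : 2 ^+ 2 = 4 :> R); last by ring.
apply: (@spow_growth _ _ _ (\sum_(p <- s) nrm (T p.2) * nrm p.1)).
- by rewrite starM starK.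
- by rewrite mulr_gt0// exprn_gt0.
move=> m; rewrite hpow (le_trans (nrm_sum _ _))// mulr_suml.
apply: ler_sum => p _; apply: (le_trans (nrmM _ _)); rewrite nrm_star.
rewrite mulrAC ler_pM ?nrm_ge0 ?toeplitz_contractive//.
by rewrite (le_trans (toeplitz_contractive _))// mulrC.
Qed.

Let near (T : adjop Y) (e : R) s := forall x, nrm (T x - Th s x) <= e * nrm x.

Let compactP T : compact_op T -> forall e : R, 0 < e -> exists s, near T e s.
Proof.
move=> cT e e0; have eC : 0 < e%:C%C by have := e0; rewrite -ltcR.
have [s hs] := cT _ eC; exists s => x.
by rewrite -lecR rmorphM /= -!nrmE.
Qed.

Let near_diff T e e' s s' : 0 < e -> 0 < e' -> near T e s -> near T e' s' ->
  nrm (val s - val s') <= 2 * (e + e').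
Proof.
move=> e0 e'0 hs hs'.
have -> : val s - val s' = val (comb (- 1) s' s).
  by rewrite val_comb scaleN1r addrC.
apply: rank_one_sum_bound => [|x]; first exact: addr_gt0.
rewrite -/(Th _) Th_comb scaleN1r addrC mulrDl.
apply: (le_trans (nrm_tri _ (T x) _)).
by rewrite lerD// nrmC.
Qed.

Let is_psi1 T (t : D) :=
  forall e s, 0 < e -> near T e s -> nrm (t - val s) <= 2 * e.

(** The homomorphism often written [psi^(1)], defined as the limit of the sums
    [val s] when the finite rank operators [Th s] tend to [T]. *)
Definition psi_one (T : adjop Y) : D := xget 0 [set t | is_psi1 T t].

Let psi1_ex T : (forall e : R, 0 < e -> exists s, near T e s) ->
  is_psi1 T (psi_one T).
Proof.
move=> hT; rewrite /psi_one; case: xgetP => [t _ //|/= h].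
have [|e e' s s' [e0 hs] [e'0 hs']|l hl] :=
    @approximation_limit R D _ (fun e s => 0 < e /\ near T e s) val 2 (ler0n _ _).
- by move=> e e0; have [s hs] := hT e e0; exists s.
- exact: near_diff e0 e'0 hs hs'.
- by case: (h l) => e s e0 hs; exact: hl.
Qed.

Let psi1_char T t (C : R) : 0 < C ->
  (forall e : R, 0 < e -> exists2 s, near T (C * e) s & nrm (t - val s) <= C * e) ->
  psi_one T = t.
Proof.
move=> C0 h; have hT : is_psi1 T (psi_one T).
  apply: psi1_ex => e e0; have [|s hs _] := h (e / C); first by rewrite divr_gt0.
  by exists s; move: hs; rewrite mulrC divfK// gt_eqF.
apply/eqP; rewrite -subr_eq0; apply/eqP/(@nrm_small _ _ _ (3 * C)).
  by rewrite mulr_ge0// ltW.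
move=> e e0; have [s hs st] := h e e0.
have := hT _ _ (mulr_gt0 C0 e0) hs => h1.
apply: (le_trans (nrm_tri _ (val s) _)); rewrite [nrm (val s - t)]nrmC.
rewrite -mulrA; lra.
Qed.

Lemma psi_one_psi (T : adjop Y) x : compact_op T -> psi_one T ** psi x = psi (T x).
Proof.
move=> /compactP cT; apply/eqP; rewrite -subr_eq0; apply/eqP.
apply: (@nrm_small _ _ _ (3 * nrm x)); first by rewrite mulr_ge0 ?nrm_ge0.
move=> e e0; have [s hs] := cT e e0.
have -> : psi_one T ** psi x - psi (T x) =
    (psi_one T - val s) ** psi x - psi (T x - Th s x).
  by rewrite smulBl (linB psil) val_psi opprB addrA subrK.
apply: (le_trans (nrmB _ _)).
have h1 : nrm ((psi_one T - val s) ** psi x) <= 2 * e * nrm x.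
  apply: (le_trans (nrmM _ _)); rewrite ler_pM ?nrm_ge0 ?toeplitz_contractive//.
  exact: psi1_ex hs.
have h2 : nrm (psi (T x - Th s x)) <= e * nrm x.
  exact: (le_trans (toeplitz_contractive _)).
lra.
Qed.

Let Th_bounded s : exists2 K, 0 <= K & forall x, nrm (Th s x) <= K * nrm x.
Proof.
exists (\sum_(p <- s) nrm p.1 * (4 * nrm p.2)).
  by apply: sumr_ge0 => p _; rewrite !mulr_ge0 ?nrm_ge0.
move=> x; rewrite ThE (le_trans (nrm_sum _ _))// mulr_suml ler_sum// => p _.
apply: (le_trans (nrm_ract _ _)); rewrite -mulrA ler_wpM2l ?nrm_ge0//.
by rewrite -mulrA nrm_hip_le.
Qed.

Let compact_bounded (T : adjop Y) : compact_op T ->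
  exists2 K, 0 <= K & forall x, nrm (T x) <= K * nrm x.
Proof.
move=> /compactP /(_ 1 ltr01) [s hs]; have [K K0 hK] := Th_bounded s.
exists (1 + K); first by rewrite addr_ge0.
move=> x; apply: (le_trans (nrm_le_sub _ (Th s x))).
by rewrite mulrDl lerD.
Qed.

Lemma psi_one_extension : compact_extension psi psi_one.
Proof.
split.
- move=> z S T cS cT.
  have hS := compactP cS; have hT := compactP cT.
  have z0 : 0 < nrm z + 1 by rewrite ltr_wpDl ?nrm_ge0.
  apply: (@psi1_char _ _ (2 * (nrm z + 1))) => [|e e0]; first by rewrite mulr_gt0.
  have [s hs] := hS e e0; have [t ht] := hT e e0.
  exists (comb z s t) => [x|].
    rewrite Th_comb aopDE aopZE opprD addrACA -scalerBr.
    apply: (le_trans (nrmD _ _)); rewrite nrmZ.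
    have h1 := ler_wpM2l (nrm_ge0 z) (hs x); have h2 := ht x.
    have h3 : 0 <= nrm z * (e * nrm x) by rewrite !mulr_ge0 ?nrm_ge0// ltW.
    have h4 : 0 <= e * nrm x by rewrite mulr_ge0 ?nrm_ge0// ltW.
    rewrite (_ : 2 * _ * _ * _ = 2 * (nrm z * (e * nrm x)) + 2 * (e * nrm x));
      [lra|ring].
  rewrite val_comb opprD addrACA -scalerBr.
  apply: (le_trans (nrmD _ _)); rewrite nrmZ.
  have h1 := ler_wpM2l (nrm_ge0 z) (psi1_ex hS e0 hs).
  have h2 := psi1_ex hT e0 ht.
  rewrite (_ : 2 * _ * _ = nrm z * (2 * e) + 2 * e); [lra|ring].
- move=> S T cS cT; have hT := compactP cT.
  have [K K0 hK] := compact_bounded cS.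
  have p0 := nrm_ge0 (psi_one S).
  apply: (@psi1_char _ _ (2 * nrm (psi_one S) + K + 1)) => [|e e0].
    by rewrite ltr_wpDl// addr_ge0// mulr_ge0.
  have [s hs] := hT e e0; exists (push S s) => [x|].
    rewrite Th_push aopME -(linB (aop_lin S)); apply: (le_trans (hK _)).
    apply: (le_trans (ler_wpM2l K0 (hs x))).
    rewrite mulrA ler_wpM2r ?nrm_ge0// ler_wpM2r ?(ltW e0)//; lra.
  have -> : val (push S s) = psi_one S ** val s.
    rewrite /val /push big_map smul_sumr; apply: eq_bigr => p _.
    by rewrite smulA psi_one_psi.
  rewrite -smulBr; apply: (le_trans (nrmM _ _)).
  apply: (le_trans (ler_wpM2l p0 (psi1_ex hT e0 hs))).
  rewrite mulrCA mulrA ler_wpM2r ?(ltW e0)//; lra.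
- move=> T cT; have hT := compactP cT.
  apply: (@psi1_char _ _ 4) => // e e0.
  have [s hs] := hT e e0; exists (swap s) => [x|].
    have hd y : nrm ((T - Th s) y) <= e * nrm y by rewrite aopBE.
    by have := adj_bound (ltW e0) hd x; rewrite starB aopBE Th_swap.
  rewrite val_swap -starB nrm_star; apply: (le_trans (psi1_ex hT e0 hs)).
  by rewrite ler_wpM2r ?ler_nat// ltW.
- move=> x y; apply: (@psi1_char _ _ 1) => // e e0.
  by exists [:: (x, y)] => [z|]; rewrite /Th /val big_seq1 subrr nrm0 mul1r
    ?mulr_ge0 ?nrm_ge0// ltW.
Qed.

Let psi_one_mulr0 (T : adjop Y) c :
  compact_op T -> lact (star c) = 0 -> psi_one T ** zeta c = 0.
Proof.
move=> cT lc; apply: (@nrm_small _ _ _ (2 * nrm (zeta c))).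
  by rewrite mulr_ge0 ?nrm_ge0.
move=> e e0; have hT := compactP cT; have [s hs] := hT e e0.
have v0 : val s ** zeta c = 0.
  rewrite /val smul_suml big1// => p _; rewrite -smulA -[zeta c]starK -starM -zs zpsi.
  by rewrite lc aop0E (lin0 psil) star0 smul0r.
rewrite -[_ ** zeta c]subr0 -v0 -smulBl; apply: (le_trans (nrmM _ _)).
have := ler_wpM2r (nrm_ge0 (zeta c)) (psi1_ex hT e0 hs); lra.
Qed.

(** Covariance at [b] can be tested after multiplication by each [zeta q]. If
    [lact] kills [q], then so does [b], by definition of the Katsura ideal, and
    both sides vanish. If [zeta q] is a sum of terms [psi x ** star (psi y)],
    both sides send it to the sum of the [psi (lact b x) ** star (psi y)]. *)
Lemma covariant_of_local (Q : set B) :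
  closed_span [set q ** x | q in zeta @` Q & x in [set: D]] = setT ->
  (forall q, Q q -> star q = q) ->
  (forall q, Q q -> lact q = 0 \/
     exists s : seq (Y * Y), zeta q = \sum_(p <- s) psi p.1 ** star (psi p.2)) ->
  cp_covariant_rep lact psi zeta.
Proof.
move=> QT Qs hQ; split=> //; exists psi_one; split; first exact: psi_one_extension.
move=> b [cb kb]; apply/eqP; rewrite -subr_eq0; apply/eqP; apply: star_inj.
rewrite star0; apply: (right_ideal_faithful QT) => _ [q Qq <-].
rewrite -starM; apply/eqP; rewrite -(inj_eq (@star_inj _ _)) star0 starK; apply/eqP.
rewrite smulBl; apply/eqP; rewrite subr_eq0; apply/eqP.
case: (hQ q Qq) => [lq|[s hs]].
  by rewrite psi_one_mulr0 ?Qs// -zM kb// (lin0 (star_hom_bounded zh).1).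
rewrite hs !smul_sumr; apply: eq_bigr => p _.
by rewrite !smulA psi_one_psi// zpsi.
Qed.

End ToeplitzCompacts.

(** * The representation of the crossed product *)

Section C0Delta.
Variables (R : realType) (V : choiceType).

Lemma c0_delta_mul (a : c0 R V) v : c0_delta R v ** a = a v *: c0_delta R v.
Proof.
apply: c0_ext => w /=; rewrite [RHS]mulrC.
by case: eqP => [->|]; rewrite ?mul0r ?mul1r.
Qed.

Lemma c0_mul_delta (a : c0 R V) v : a ** c0_delta R v = a v *: c0_delta R v.
Proof. by rewrite -c0_delta_mul; apply: c0_ext => w /=; rewrite mulrC. Qed.

Lemma c0_delta_star (v : V) : star (c0_delta R v) = c0_delta R v.
Proof. by apply: c0_ext => w /=; rewrite conjC_nat. Qed.

(** Used to factor elements of the crossed product. *)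
Lemma c0_sqrt (a : c0 R V) : exists b : c0 R V, b ** b = a.
Proof.
have fin (e : R[i]) : 0 < e -> finite_set [set v | e <= `|sqrtC (a v)|].
  move=> e0; apply: sub_finite_set (c0P a (exprn_gt0 2 e0)) => v /= ev.
  by rewrite -[a v]sqrtCK normrX ler_pXn2r// nnegrE ?normr_ge0// ltW.
exists (C0 fin); apply: c0_ext => v /=.
by rewrite -expr2 sqrtCK.
Qed.

End C0Delta.

Lemma c0_act_delta (R : realType) (G : groupType) (E : digraph)
    (act : digraph_action G E) g v :
  c0_act act g (c0_delta R v) = c0_delta R (actv act g v).
Proof.
have [a1 aM] := actv_action act.
apply: c0_ext => w /=; congr (_%:R); congr (nat_of_bool _).
apply/eqP/eqP => [<-|->]; first by rewrite -aM mulgV a1.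
by rewrite -aM mulVg a1.
Qed.

Lemma closed_span_mono (R : realType) (V : normedModType R[i]) (X X' : set V) :
  X `<=` X' -> closed_span X = setT -> closed_span X' = setT.
Proof.
move=> XX' XT; apply/seteqP; split=> // x _.
have : closed_span X x by rewrite XT.
apply: closed_span_sub; first exact: closed_subspace_span.
by move=> y /XX'; exact: sub_closed_span.
Qed.

(** The norm of a multiplier [toM d] on [D] is that of [d], so a limit of such
    multipliers, in norm, comes from [D] again. *)
Lemma multiplier_rep_range (R : realType) (B D : cstarAlgType R)
    (f : B -> multiplier D) (X : set B) : star_hom f -> closed_span X = setT ->
  (forall b, X b -> exists d, toM d = f b) -> forall b, exists d, toM d = f b.
Proof.
move=> hf XT hX b; have : closed_span X b by rewrite XT.
have bl x := rep_bounded_linearl hf x.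
have fb a x : nrm (f a x : D) <= 2 * nrm a * nrm x := rep_bounded hf a x.
move: b; apply: closed_span_sub hX; split=> /=.
- apply: closed_nrm => b hb.
  pose near (e : R) (p : B * D) := toM p.2 = f p.1 /\ nrm (b - p.1) <= e.
  have hd w w' d d' x : toM d = f w -> toM d' = f w' ->
      (d - d') ** x = f (w - w') x :> D.
    by move=> hw hw'; rewrite (linB (bl x).1) -hw -hw' smulBl.
  have nex e : 0 < e -> exists p, near e p.
    move=> e0; have [w [d dw] bw] := hb e e0.
    by exists (w, d); split=> //=; apply: ltW.
  have [||d hl] := @approximation_limit R D (B * D)%type near snd 2 (ler0n _ _) => //.
    move=> e e' [w d] [w' d'] [/= dw hw] [/= dw' hw'].
    have ww : nrm (w - w') <= e + e'.
      by apply: (le_trans (nrm_tri _ b _)); rewrite nrmC; exact: lerD.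
    have [->|d0] := eqVneq (d - d') 0.
      by rewrite nrm0 mulr_ge0// (le_trans (nrm_ge0 _) ww).
    rewrite -(ler_pM2r (nrm_gt0 d0)) -expr2 -nrm_cstar' (hd w w')//.
    by rewrite (le_trans (fb _ _))// nrm_star ler_wpM2r ?nrm_ge0// ler_pM2l.
  exists d; apply: adjop_ext => x; rewrite toME.
  apply/eqP; rewrite -subr_eq0; apply/eqP; apply: (@nrm_small _ _ _ (4 * nrm x)).
    by rewrite mulr_ge0 ?nrm_ge0.
  move=> e /nex [[w d'] hn]; have := hl _ _ hn; have [/= dw hw] := hn => dd.
  have -> : d ** x - f b x = (d - d') ** x - f (b - w) x.
    by rewrite (linB (bl x).1) -dw toME smulBl opprB addrA subrK.
  apply: (le_trans (nrmB _ _)).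
  have h1 := le_trans (nrmM (d - d') x) (ler_wpM2r (nrm_ge0 x) dd).
  have h2 := le_trans (fb (b - w) x) (ler_wpM2r (nrm_ge0 x) (ler_wpM2l (ler0n R 2) hw)).
  lra.
- by exists 0; apply: adjop_ext => x; rewrite toME smul0l (lin0 (bl x).1).
- move=> z x y [d hd] [d' hd']; exists (z *: d + d').
  by have [fl _ _] := hf; rewrite toM_linear hd hd' fl.
Qed.

(** The element [a m] of [D], for which only multiplication by [m] on the left
    is directly available. *)
Definition rmul (R : realType) (D : cstarAlgType R) (a : D) (m : multiplier D) : D :=
  star (star m (star a) : D).

Lemma toM_rmul (R : realType) (D : cstarAlgType R) (a : D) (m : multiplier D) :
  toM (rmul a m) = toM a ** m.
Proof. by rewrite toM_mulr. Qed.

Lemma rmulZ (R : realType) (D : cstarAlgType R) z (a : D) (m : multiplier D) :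
  rmul (z *: a) m = z *: rmul a m.
Proof.
by rewrite /rmul starZ (linZ (@aop_lin _ _ (hself D) (star m))) starZ conjCK.
Qed.

Lemma rmul1 (R : realType) (D : cstarAlgType R) (a : D) : rmul a Defs.adj1 = a.
Proof. by rewrite /rmul starK. Qed.

Section CKRepresentation.
Variables (R : realType) (G : groupType) (E : digraph).
Variables (act : digraph_action G E) (phi : G -> edge E -> G).
Variables (D : cstarAlgType R) (P : vert E -> D) (S : edge E -> D).
Variable U : G -> multiplier D.
Hypothesis CKr : CK_representation act phi P S U.
Hypothesis rf : row_finite E.

Let CK : cuntz_krieger_family P S. Proof. by case: CKr. Qed.
Let Pp v : projection (P v). Proof. by have [[]] := CK. Qed.
Let Ps v : star (P v) = P v. Proof. by have [] := Pp v. Qed.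
Let PP v : P v ** P v = P v. Proof. by have [] := Pp v. Qed.
Let Po v w : v != w -> P v ** P w = 0.
Proof. by have [[_ h] _ _ _ _] := CK; move=> vw; exact: h. Qed.
Let SS e : star (S e) ** S e = P (src e).
Proof. by have [_ _ h _ _] := CK; apply: h. Qed.
Let hU : unitary_rep U. Proof. by case: CKr. Qed.
Let UP g v : U g ** toM (P v) = toM (P (actv act g v)) ** U g.
Proof. by have [_ _ h _ _] := CKr; apply: h. Qed.
Let act1 v : actv act 1%g v = v. Proof. by have [h _] := actv_action act. Qed.
Let actK g v : actv act g (actv act g^-1%g v) = v.
Proof. by have [_ h] := actv_action act; rewrite -h mulgV act1. Qed.
Let UPx g v x : U g (P v ** x) = P (actv act g v) ** (U g x : D) :> D.
Proof. by rewrite -toME -aopME UP. Qed.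

Let PUx g v x : P v ** (U g x : D) = U g (P (actv act g^-1%g v) ** x).
Proof. by rewrite UPx actK. Qed.

Let SP e : S e ** P (src e) = S e.
Proof. by rewrite -SS smulA; have [_ h _ _ _] := CK; apply: h. Qed.

(** Each generator, and each adjoint of a generator, is [P v] times an element,
    where [v] is a vertex computed from the action and the range or source map. *)
Lemma ck_span : closed_span [set p ** x | p in range P & x in [set: D]] = setT.
Proof.
have [_ _ _ _ genT] := CKr.
apply: right_ideal_span genT _; set W := closed_span _.
have WP v x : W (P v ** x) by apply: sub_closed_span; exists (P v) => //; exists x.
move=> _ [[v _ [g _ <-]]|[e _ [g _ <-]]]; rewrite toM_mulr toMK ?starK.
- split; last by rewrite Ps urepV// -PP UPx; apply: WP.
  by rewrite Ps -{1}PP mul_smul starM Ps; apply: WP.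
- split.
    by rewrite -(ck_range CK rf) starM Ps mul_smul starM Ps; apply: WP.
  by rewrite urepV// -SP starM Ps UPx; apply: WP.
Qed.

Lemma ck_faithful d : (forall v, P v ** d = 0) -> d = 0.
Proof.
by move=> h; apply: (right_ideal_faithful ck_span) => _ [v _ <-]; rewrite Ps h.
Qed.

Lemma ck_faithful_eq d d' : (forall v, P v ** d = P v ** d') -> d = d'.
Proof.
move=> h; apply/eqP; rewrite -subr_eq0; apply/eqP/ck_faithful => v.
by rewrite smulBr h subrr.
Qed.

(** The sum of the [a v *: P v], described by its products with the projections,
    from which its algebraic properties follow by [ck_faithful]. *)
Definition vertex_rep (a : c0 R (vert E)) : D :=
  xget 0 [set d | forall v, P v ** d = a v *: P v].

Lemma vertex_repP a v : P v ** vertex_rep a = a v *: P v.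
Proof.
rewrite /vertex_rep; case: xgetP => [d _ //|/= h].
by have [d hd] := c0_sum Pp Po a; case: (h d).
Qed.

Lemma vertex_rep_unique (a : c0 R (vert E)) d :
  (forall v, P v ** d = a v *: P v) -> vertex_rep a = d.
Proof. by move=> h; apply: ck_faithful_eq => v; rewrite h vertex_repP. Qed.

Lemma vertex_repPr a v : vertex_rep a ** P v = a v *: P v.
Proof.
apply: ck_faithful_eq => w; rewrite smulA vertex_repP smulZl smulZr.
by have [->|wv] := eqVneq w v; rewrite ?PP// Po// !scaler0.
Qed.

Lemma vertex_rep_delta v : vertex_rep (c0_delta R v) = P v.
Proof.
apply: vertex_rep_unique => w /=; have [->|wv] := eqVneq w v.
  by rewrite PP scale1r.
by rewrite Po// scale0r.
Qed.

Lemma vertex_rep_hom : star_hom vertex_rep.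
Proof.
split=> [z a b|a b|a]; apply: vertex_rep_unique => v.
- by rewrite smulDr smulZr !vertex_repP scalerA -scalerDl.
- by rewrite smulA vertex_repP smulZl vertex_repP scalerA.
- by apply: star_inj; rewrite starM starK Ps vertex_repPr starZ Ps conjCK.
Qed.

Lemma ck_covariant : covariant_hom (c0_act act) (@toM R D \o vertex_rep) U.
Proof.
have [pil piM pis] := vertex_rep_hom.
split=> //.
- split=> [z a b|a b|a] /=; first by rewrite pil toM_linear.
    by rewrite piM toM_mul.
  by rewrite pis toM_star.
- apply: closed_span_mono ck_span => _ [_ [v _ <-] [x _ <-]].
  by exists (c0_delta R v) => //; exists x => //=; rewrite vertex_rep_delta.
- move=> g a /=; apply: adjop_ext => x; apply: ck_faithful_eq => v.
  rewrite !aopME urepV// toME smulA vertex_repP /=.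
  rewrite PUx ?toME smulA vertex_repP !smulZl (linZ (@aop_lin _ _ (hself D) (U g))).
  by rewrite -PUx urepVK.
Qed.

Section CrossedProductRep.
Variables (B : cstarAlgType R) (iA : c0 R (vert E) -> multiplier B).
Variable iG : G -> multiplier B.
Hypothesis Bx : is_crossed_product (c0_act act) iA iG.

Let cov : covariant_hom (c0_act act) iA iG. Proof. by case: Bx. Qed.
Let iAh : star_hom iA. Proof. by case: cov. Qed.
Let iAZ z a : iA (z *: a) = z *: iA a.
Proof.
have [l _ _] := iAh; have i0 : iA 0 = 0.
  by have := l (- 1) 0 0; rewrite !scaleN1r !addNr.
by rewrite -[z *: a]addr0 l i0 addr0.
Qed.
Let iAM a b : iA (a ** b) = iA a ** iA b. Proof. by case: iAh. Qed.
Let iAs a : iA (star a) = star (iA a). Proof. by case: iAh. Qed.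
Let hG : unitary_rep iG. Proof. by case: cov. Qed.
Let Gcov g a : iG g ** iA a = iA (c0_act act g a) ** iG g.
Proof.
have [_ _ _ h] := cov; rewrite h -smulA urep_star//; exact: adjop_ext.
Qed.

Definition cp_elt (a : c0 R (vert E)) (g : G) : B := fromM (iA a ** iG g).

Lemma cp_eltE a g : toM (cp_elt a g) = iA a ** iG g.
Proof. by have [_ h _ _] := Bx; rewrite fromMK. Qed.

Lemma cp_elt1E a : toM (cp_elt a 1%g) = iA a.
Proof. by rewrite cp_eltE (urep1 hG); exact: adjop_ext. Qed.

Lemma cp_elt1 a : cp_elt a 1%g = fromM (iA a).
Proof. by rewrite -cp_elt1E toMK. Qed.

Lemma cp_elt_span :
  closed_span (range (fun p : c0 R (vert E) * G => cp_elt p.1 p.2)) = setT.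
Proof.
have [_ _ h _] := Bx; apply: closed_span_mono h => _ [a _ [g _ <-]].
by exists (a, g).
Qed.

Lemma cp_elt_mul1 a b g : cp_elt a 1%g ** cp_elt b g = cp_elt (a ** b) g.
Proof. by apply: toM_inj; rewrite toM_mul cp_elt1E !cp_eltE iAM smulA. Qed.

Lemma cp_elt_muld a g v : cp_elt a g ** cp_elt (c0_delta R v) 1%g =
  a (actv act g v) *: cp_elt (c0_delta R (actv act g v)) g.
Proof.
apply: toM_inj; rewrite toM_mul cp_elt1E cp_eltE -smulA Gcov smulA -iAM.
by rewrite c0_act_delta c0_mul_delta iAZ smulZl toMZ cp_eltE.
Qed.

Lemma cp_eltZ z a g : cp_elt (z *: a) g = z *: cp_elt a g.
Proof. by apply: toM_inj; rewrite toMZ !cp_eltE iAZ smulZl. Qed.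

Lemma cp_elt_star a g : star (cp_elt a g) = iG g^-1%g (cp_elt (star a) 1%g) :> B.
Proof.
apply: toM_inj; rewrite toM_star cp_eltE starM urepV// -toM_mull cp_elt1E.
by rewrite iAs.
Qed.

Lemma cp_elt_delta_star v :
  star (cp_elt (c0_delta R v) 1%g) = cp_elt (c0_delta R v) 1%g.
Proof. by rewrite cp_elt_star c0_delta_star invg1 (urep1 hG) aop1E. Qed.

Lemma cp_elt_app a g b : cp_elt a g ** b = cp_elt a 1%g ** (iG g b : B).
Proof. by rewrite -!toME cp_elt1E cp_eltE aopME. Qed.

(** The universal property gives a representation by multipliers of [D]. It
    takes the spanning elements into [D], hence all of [B]. *)
Lemma crossed_product_rep : exists zeta : B -> D,
  [/\ star_hom zeta, forall a g, toM (zeta (cp_elt a g)) = toM (vertex_rep a) ** U g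
    & forall g b, zeta (iG g b : B) = (U g (zeta b) : D)].
Proof.
have [_ _ _ /(_ _ _ _ ck_covariant) [f [hf nf fA fG]]] := Bx.
have [fl fM fs] := hf.
have fU g b x : f (iG g b) x = U g (f b x) :> D.
  have [h _ _] := mext_unitary hf nf (urep_star hG g) (urep_star' hG g).
  by rewrite -h fG.
have f1 a : f (cp_elt a 1%g) = toM (vertex_rep a).
  by rewrite -(mext_toM hf nf) cp_elt1E fA.
have fE a g : f (cp_elt a g) = toM (vertex_rep a) ** U g.
  apply: (adjop_span_ext nf) => _ [b _ [x _ <-]].
  by rewrite -aopME -fM cp_elt_app fM f1 !aopME fU.
have fD b : exists d, toM d = f b.
  apply: (multiplier_rep_range hf cp_elt_span) => _ [[a h] _ <-] /=.
  by exists (rmul (vertex_rep a) (U h)); rewrite toM_rmul fE.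
pose zeta b := fromM (f b).
have zE b : toM (zeta b) = f b by rewrite /zeta fromMK.
exists zeta; split.
- split=> [z x y|x y|x]; apply: (@toM_inj R D).
  + by rewrite toM_linear !zE fl.
  + by rewrite toM_mul !zE fM.
  + by rewrite toM_star !zE fs.
- by move=> a g; rewrite zE fE.
- move=> g b; apply: (@toM_inj R D); rewrite zE -toM_mull zE.
  by apply: adjop_ext => x; rewrite aopME fU.
Qed.

End CrossedProductRep.

End CKRepresentation.

(** * The representation of the correspondence *)

Section Correspondence.
Variables (R : realType) (G : groupType) (E : digraph).
Variables (act : digraph_action G E) (phi : G -> edge E -> G).
Hypothesis cocycle : is_cocycle act phi.
Variables (B : cstarAlgType R) (iA : c0 R (vert E) -> multiplier B).
Variable iG : G -> multiplier B.
Hypothesis Bx : is_crossed_product (c0_act act) iA iG.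
Variables (Y : hilbertModType B) (lact : B -> adjop Y) (chi : edge E -> G -> Y).
Hypothesis Yc : is_cocycle_correspondence act phi iA iG lact chi.

Local Notation delta v g := (cp_elt iA iG (c0_delta R v) g).

Let acte1 e : acte act 1%g e = e. Proof. by have [h _] := acte_action act. Qed.
Let actv1 v : actv act 1%g v = v. Proof. by have [h _] := actv_action act. Qed.
Let actvK g v : actv act g (actv act g^-1%g v) = v.
Proof. by have [_ h] := actv_action act; rewrite -h mulgV actv1. Qed.
Let phi1 e : phi 1%g e = 1%g.
Proof.
have [/(_ 1%g 1%g e) h _] := cocycle; move: h; rewrite mulg1 acte1 => h.
by apply: (mulgI (phi 1%g e)); rewrite -h mulg1.
Qed.

Let lh : star_hom lact. Proof. by case: Yc. Qed.

Lemma chi_span : closed_span (range (fun p : edge E * G => chi p.1 p.2)) = setT.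
Proof.
have [_ h _ _ _] := Yc; apply: closed_span_mono h => _ [e _ [g _ <-]].
by exists (e, g).
Qed.

Lemma lact_delta v g e h : lact (delta v g) (chi e h) =
  if v == rng (acte act g e) then chi (acte act g e) (phi g e * h)%g else 0.
Proof. by have [_ _ _ _] := Yc; apply. Qed.

Lemma hip_chi e e' g h : hip (chi e g) (chi e' h) =
  (if e == e' then delta (actv act g^-1%g (src e)) (g^-1 * h)%g else 0) :> B.
Proof. by have [_ _ h' _ _] := Yc; apply: h'. Qed.

Lemma chi_ract e h v g : ract (chi e h) (delta v g) =
  if src e == actv act h v then chi e (h * g)%g else 0.
Proof. by have [_ _ _ h' _] := Yc; apply: h'. Qed.

Lemma lact_delta_rng e h : lact (delta (rng e) 1%g) (chi e h) = chi e h.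
Proof. by rewrite lact_delta acte1 eqxx phi1 mul1g. Qed.

Lemma chi_ract_src e h :
  ract (chi e h) (delta (actv act h^-1%g (src e)) 1%g) = chi e h.
Proof. by rewrite chi_ract actvK eqxx mulg1. Qed.

Lemma chi_ract1 e g : ract (chi e 1%g) (delta (src e) g) = chi e g.
Proof. by rewrite chi_ract actv1 eqxx mul1g. Qed.

(** The left action is prescribed on the [delta v g] only; a general element of
    [B] is brought to this form by multiplying it with [delta (rng e) 1], which
    fixes [chi e h]. *)
Lemma lact_cp_elt a g e h : lact (cp_elt iA iG a g) (chi e h) =
  a (rng (acte act g e)) *: chi (acte act g e) (phi g e * h)%g.
Proof.
have [ll lM _] := lh.
rewrite -(lact_delta_rng e h) -aopME -lM (cp_elt_muld Bx).
have lZ z b : lact (z *: b) = z *: lact b.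
  have l0 : lact 0 = 0 by have := ll (- 1) 0 0; rewrite !scaleN1r !addNr.
  by rewrite -[z *: b]addr0 ll l0 addr0.
by rewrite lZ aopZE lact_delta rng_act eqxx.
Qed.

Section Representation.
Variables (D : cstarAlgType R) (P : vert E -> D) (S : edge E -> D).
Variable U : G -> multiplier D.
Hypothesis CKr : CK_representation act phi P S U.
Hypothesis rf : row_finite E.

Let CK : cuntz_krieger_family P S. Proof. by case: CKr. Qed.
Let hU : unitary_rep U. Proof. by case: CKr. Qed.
Let SS e : star (S e) ** S e = P (src e).
Proof. by have [_ _ h _ _] := CK; apply: h. Qed.
Let UP g v : U g ** toM (P v) = toM (P (actv act g v)) ** U g.
Proof. by have [_ _ h _ _] := CKr; apply: h. Qed.
Let US g e : U g ** toM (S e) = toM (S (acte act g e)) ** U (phi g e).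
Proof. by have [_ _ _ h _] := CKr; apply: h. Qed.

(** The map [psi] is determined by [psi (chi e g) = S e U g]. The relations
    between the [S e], [P v] and [U g] mirror the inner products of the [chi e
    g], so [psi] extends by continuity. For covariance, a vertex either receives
    no edge, and then [lact] kills its projection, or by row-finiteness its
    projection is the finite sum of the [S f ** star (S f)]. *)
Lemma toeplitz_rep_of_CK : exists (psi : Y -> D) (zeta : B -> D),
  [/\ cp_covariant_rep lact psi zeta,
      forall a g, zeta (cp_elt iA iG a g) = rmul (vertex_rep P a) (U g),
      forall g b, zeta (iG g b : B) = (U g (zeta b) : D)
    & forall e g, psi (chi e g) = rmul (S e) (U g)].
Proof.
have [zeta [zh zE zG]] := crossed_product_rep CKr rf Bx.
have [zl zM zs] := zh.
have zE' a g : zeta (cp_elt iA iG a g) = rmul (vertex_rep P a) (U g).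
  by apply: toM_inj; rewrite toM_rmul.
have zd v g : toM (zeta (delta v g)) = toM (P v) ** U g.
  by rewrite zE (vertex_rep_delta CKr rf).
pose w (p : edge E * G) := rmul (S p.1) (U p.2).
have wE p : toM (w p) = toM (S p.1) ** U p.2 by exact: toM_rmul.
have ww p q : star (w p) ** w q = zeta (hip (chi p.1 p.2) (chi q.1 q.2)).
  case: p q => [e g] [e' h]; apply: toM_inj.
  rewrite toM_mul toM_star !wE /= hip_chi starM -toM_star.
  rewrite -smulA [toM _ ** (toM _ ** _)]smulA -toM_mul.
  case: eqP => [<-|/eqP ee]; last first.
    rewrite (ck_orth CK rf ee) (lin0 (star_hom_bounded zh).1).
    apply: adjop_ext => x; rewrite !aopME !toME !smul0l.
    exact: (lin0 (@aop_lin _ _ (hself D) _)).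
  rewrite SS zd urepV// smulA UP -smulA; congr (_ ** _).
  by rewrite urepM.
have [|psi [psil psiE psib]] := @bounded_extension R Y D _ _ w 1 ler01 chi_span.
  move=> s; rewrite mul1r -(@ler_pXn2r _ 2)// ?nnegrE ?nrm_ge0//.
  rewrite -nrm_cstar -nrm_hip.
  suff -> : star (\sum_(p <- s) p.1 *: w p.2) ** (\sum_(p <- s) p.1 *: w p.2) =
     zeta (hip (\sum_(p <- s) p.1 *: chi p.2.1 p.2.2)
               (\sum_(p <- s) p.1 *: chi p.2.1 p.2.2)).
    exact: star_hom_contractive.
  rewrite star_sum smul_suml hip_suml (lin_sum (star_hom_bounded zh).1).
  apply: eq_bigr => p _; rewrite smul_sumr hip_sumr (lin_sum (star_hom_bounded zh).1).
  apply: eq_bigr => q _; rewrite starZ smulZl smulZr ww hipZl hipZr.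
  by rewrite !(linZ (star_hom_bounded zh).1).
have psiE' e g : psi (chi e g) = rmul (S e) (U g) by exact: (psiE (e, g)).
have bpsi : bounded_linear psi by split=> //; exists 1.
have bz := star_hom_bounded zh.
have TR : toeplitz_rep lact psi zeta.
  split=> //.
  - move=> x y; move: y; apply: (bounded_linear_eq
      (bounded_linear_comp bpsi (smul_boundedl (star (psi x))))
      (bounded_linear_comp (hip_bounded x) bz) chi_span) => _ [q _ <-] /=.
    apply: star_inj; rewrite starM starK -zs hip_star.
    move: x; apply: (bounded_linear_eq
      (bounded_linear_comp bpsi (smul_boundedl (star (psi (chi q.1 q.2)))))
      (bounded_linear_comp (hip_bounded (chi q.1 q.2)) bz) chi_span) => _ [p _ <-] /=.
    by rewrite !(psiE p) !(psiE q) ww.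
  - move=> b x; move: x; apply: (bounded_linear_eq
      (bounded_linear_comp bpsi (smul_boundedl (zeta b)))
      (bounded_linear_comp (rep_bounded_linear lh b) bpsi) chi_span) => _ [[e h] _ <-] /=.
    move: b; apply: (bounded_linear_eq
      (bounded_linear_comp bz (smul_boundedr (psi (chi e h))))
      (bounded_linear_comp (rep_bounded_linearl lh (chi e h)) bpsi)
      (cp_elt_span Bx)) => _ [[a g] _ <-] /=.
    rewrite lact_cp_elt (linZ psil) !psiE'; apply: toM_inj.
    rewrite toM_mul zE toM_rmul -smulA [U g ** _]smulA US -smulA -urepM// smulA.
    rewrite -toM_mul -{1}(ck_range CK rf) smulA (vertex_repPr CKr rf) smulZl.
    rewrite (ck_range CK rf).
    by rewrite -toM_rmul rmulZ.
exists psi, zeta; split=> //.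
have span := ck_span CKr rf.
apply: (covariant_of_local TR (Q := [set delta v 1%g | v in [set: vert E]])).
- rewrite (_ : zeta @` _ = range P)//; apply/seteqP; split=> x /=.
    move=> [_ [v _ <-] <-]; exists v => //; apply: toM_inj; rewrite zd urep1//.
    exact: adjop_ext.
  move=> [v _ <-]; exists (delta v 1%g); first by exists v.
  by apply: toM_inj; rewrite zd urep1//; exact: adjop_ext.
- by move=> _ [v _ <-]; rewrite (cp_elt_delta_star Bx).
- move=> _ [v _ <-]; have [[e ev]|ne] := pselect (exists e, rng e = v).
    right; have [s [_ _ _ hs]] := ck_sum CK rf e.
    exists [seq (chi f 1%g, chi f 1%g) | f <- s].
    have -> : zeta (delta v 1%g) = P v.
      by apply: toM_inj; rewrite zd urep1//; exact: adjop_ext.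
    rewrite -ev hs big_map; apply: eq_bigr => f _ /=.
    by rewrite psiE' (urep1 hU) rmul1.
  left; apply: (adjop_span_ext chi_span) => _ [[e h] _ <-] /=.
  rewrite lact_delta; case: eqP => // ve; case: ne; by exists (acte act 1%g e).
Qed.

End Representation.
End Correspondence.

(** * Homomorphisms from the Cuntz-Pimsner algebra *)

Section CuntzPimsnerSide.
Variables (R : realType) (G : groupType) (E : digraph).
Variables (act : digraph_action G E) (phi : G -> edge E -> G).
Hypothesis cocycle : is_cocycle act phi.
Variables (B : cstarAlgType R) (iA : c0 R (vert E) -> multiplier B).
Variable iG : G -> multiplier B.
Hypothesis Bx : is_crossed_product (c0_act act) iA iG.
Variables (Y : hilbertModType B) (lact : B -> adjop Y) (chi : edge E -> G -> Y).
Hypothesis Yc : is_cocycle_correspondence act phi iA iG lact chi.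
Variables (O : cstarAlgType R) (kY : Y -> O) (kB : B -> O).
Hypothesis OCP : is_cuntz_pimsner lact kY kB.

Local Notation cp := (cp_elt iA iG).
Local Notation delta v g := (cp_elt iA iG (c0_delta R v) g).

Let hG : unitary_rep iG. Proof. by have [[]] := Bx. Qed.
Let kT : toeplitz_rep lact kY kB. Proof. by case: OCP => -[]. Qed.
Let kh : star_hom kB. Proof. by case: kT. Qed.
Let kM x y : kB (x ** y) = kB x ** kB y. Proof. by case: kh. Qed.
Let ks x : kB (star x) = star (kB x). Proof. by case: kh. Qed.
Let kbnd := star_hom_bounded kh.
Let kYb := toeplitz_bounded kT.

Lemma comp_toM_hom (A D : cstarAlgType R) (f : A -> D) :
  star_hom f -> star_hom (@toM R D \o f).
Proof.
move=> [fl fM fs]; split=> [z x y|x y|x] /=; first by rewrite fl toM_linear.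
  by rewrite fM toM_mul.
by rewrite fs toM_star.
Qed.

Let kmh : star_hom (@toM R O \o kB). Proof. exact: comp_toM_hom. Qed.

(** By continuity it is enough to factor spanning elements. In [B] the factor
    comes from a square root in [c0]; a vector [chi e g] is fixed by [delta (rng
    e) 1] on the left and by a similar element on the right. *)
Lemma kB_nondegenerate : Defs.nondegenerate (@toM R O \o kB).
Proof.
have W1 : closed_span [set p ** x | p in range kB & x in [set: O]] = setT.
  have [_ genT _] := OCP.
  apply: right_ideal_span genT _; set W := closed_span _.
  have cW : closed_subspace W := closed_subspace_span _.
  have WB b x : W (kB b ** x).
    by apply: sub_closed_span; exists (kB b); [exists b|exists x].
  have WkB b : W (kB b).
    have : closed_span (range (fun p : c0 R (vert E) * G => cp p.1 p.2)) b.
      by rewrite (cp_elt_span Bx).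
    move: b; apply: closed_span_sub; first exact: (closed_subspace_preim kbnd cW).
    move=> _ [[a g] _ <-] /=; have [c <-] := c0_sqrt a.
    by rewrite -(cp_elt_mul1 Bx) kM.
  move=> _ [[y _ <-]|[b _ <-]]; last by rewrite -ks.
  have : closed_span (range (fun p : edge E * G => chi p.1 p.2)) y.
    by rewrite (chi_span Yc).
  have c1 := closed_subspace_preim kYb cW.
  have c2 := closed_subspace_preim kYb (closed_subspace_star cW).
  move: y; apply: (closed_span_sub (closed_subspaceI c1 c2)).
  move=> _ [[e g] _ <-] /=; split.
    rewrite -(lact_delta_rng cocycle Yc e g).
    by have [_ _ _ <-] := kT.
  by rewrite -(chi_ract_src Yc e g) (toeplitz_ract kT) starM -ks.
apply: closed_span_mono W1 => _ [_ [b _ <-] [x _ <-]].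
by exists b => //; exists x.
Qed.

Definition pimsner_unitary g : multiplier O := mext (@toM R O \o kB) (iG g).

Let uspec g : [/\ forall a x, pimsner_unitary g (kB a ** x) = kB (iG g a) ** x :> O,
  star (pimsner_unitary g) ** pimsner_unitary g = Defs.adj1 &
  pimsner_unitary g ** star (pimsner_unitary g) = Defs.adj1].
Proof.
exact: (mext_unitary kmh kB_nondegenerate (urep_star hG g) (urep_star' hG g)).
Qed.

Lemma pimsner_unitary_kB g b : pimsner_unitary g (kB b) = kB (iG g b) :> O.
Proof.
by apply: smul_inj => x; have [<- _ _] := uspec g; rewrite mul_smul.
Qed.

Lemma pimsner_hom_eq (D : cstarAlgType R) (f f' : O -> D) :
  star_hom f -> star_hom f' ->
  (forall a g, f (kB (cp a g)) = f' (kB (cp a g))) ->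
  (forall e, f (kY (chi e 1%g)) = f' (kY (chi e 1%g))) -> forall x, f x = f' x.
Proof.
move=> hf hf' hB hY x; have [_ genT _] := OCP.
have [fl fM fs] := hf; have [fl' fM' fs'] := hf'.
have bf := star_hom_bounded hf; have bf' := star_hom_bounded hf'.
have hB' b : f (kB b) = f' (kB b).
  move: b; apply: (bounded_linear_eq (bounded_linear_comp kbnd bf)
    (bounded_linear_comp kbnd bf') (cp_elt_span Bx)) => _ [[a g] _ <-] /=.
  exact: hB.
have hY' y : f (kY y) = f' (kY y).
  move: y; apply: (bounded_linear_eq (bounded_linear_comp kYb bf)
    (bounded_linear_comp kYb bf') (chi_span Yc)) => _ [[e g] _ <-] /=.
  by rewrite -(chi_ract1 Yc) (toeplitz_ract kT) fM fM' hY hB.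
have : cstar_gen (range kY `|` range kB) x by rewrite genT.
move=> /(_ [set z | f z = f' z]); apply; split; last by move=> _ [[y _ <-]|[b _ <-]] /=.
split; first exact: (closed_subspace_eq bf bf').
- by move=> y z /= hy hz; rewrite fM fM' hy hz.
- by move=> y /= hy; rewrite fs fs' hy.
Qed.

Section Homomorphisms.
Variables (D : cstarAlgType R) (P : vert E -> D) (S : edge E -> D).
Variable U : G -> multiplier D.
Hypothesis CKr : CK_representation act phi P S U.
Hypothesis rf : row_finite E.
Let hU : unitary_rep U. Proof. by case: CKr. Qed.

Section OneHomomorphism.
Variable f : O -> D.
Hypothesis hf : star_hom f.
Hypothesis fP : forall v, f (kB (delta v 1%g)) = P v.

Let fb := star_hom_bounded hf.
Let fM x y : f (x ** y) = f x ** f y. Proof. by case: hf. Qed.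
Let fs x : f (star x) = star (f x). Proof. by case: hf. Qed.

Lemma pimsner_hom_nondegenerate : Defs.nondegenerate (@toM R D \o f).
Proof.
apply: closed_span_mono (ck_span CKr rf) => _ [_ [v _ <-] [x _ <-]].
by exists (kB (delta v 1%g)) => //; exists x => //=; rewrite fP.
Qed.

(** Only the values at the [delta v 1] are prescribed, and finite combinations
    of them are not obviously dense in the image of [c0]; but products with the
    [P v] determine an element of [D]. *)
Lemma pimsner_hom_c0 a : f (kB (cp a 1%g)) = vertex_rep P a.
Proof.
symmetry; apply: (vertex_rep_unique CKr rf) => v.
rewrite -fP -fM -kM (cp_elt_mul1 Bx) c0_delta_mul.
by rewrite (cp_eltZ Bx) (linZ kbnd.1) (linZ fb.1).
Qed.

Lemma pimsner_hom_unitary g : (mext (@toM R D \o f) (pimsner_unitary g) = U g) <->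
  (forall x, f (pimsner_unitary g x : O) = (U g (f x) : D)).
Proof.
have [_ u1 u2] := uspec g; have nf := pimsner_hom_nondegenerate.
have fmh := comp_toM_hom hf.
split=> h.
  move=> x; apply: smul_inj => y; rewrite -mul_smul -h.
  by have [->] := mext_unitary fmh nf u1 u2.
by apply: (mext_unique nf) => a x /=; rewrite h mul_smul.
Qed.

(** The adjoint of [iA a ** iG g] is a unitary applied to an element of the
    image of [c0], and on such elements [f] is already known. *)
Lemma pimsner_hom_elt a g :
  (forall g x, f (pimsner_unitary g x : O) = (U g (f x) : D)) ->
  f (kB (cp a g)) = rmul (vertex_rep P a) (U g).
Proof.
move=> fU; apply: star_inj; rewrite -fs -ks (cp_elt_star Bx) -pimsner_unitary_kB fU.
by rewrite pimsner_hom_c0 /rmul starK urepV//; have [_ _ ->] := vertex_rep_hom CKr rf.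
Qed.

End OneHomomorphism.

Lemma pimsner_hom_exists : exists f : O -> D, [/\ star_hom f,
   forall a g, f (kB (cp a g)) = rmul (vertex_rep P a) (U g),
   forall e g, f (kY (chi e g)) = rmul (S e) (U g) &
   forall g x, f (pimsner_unitary g x : O) = (U g (f x) : D)].
Proof.
have [psi [zeta [cov zE zG psiE]]] := toeplitz_rep_of_CK cocycle Bx Yc CKr rf.
have [_ _ /(_ _ _ _ cov) [f [hf fY fB]]] := OCP.
have [_ fM _] := hf.
have fb := star_hom_bounded hf.
exists f; split=> // [a g|e g|g x]; rewrite ?fB ?fY ?zE ?psiE//.
have [hu u1 u2] := uspec g.
move: x; apply: (bounded_linear_eq (bounded_linear_comp (unitary_bounded u1) fb)
  (bounded_linear_comp fb (unitary_bounded (urep_star hU g))) kB_nondegenerate).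
move=> _ [b _ [x _ <-]] /=.
by rewrite hu !fM !fB zG mul_smul.
Qed.

Lemma pimsner_hom_onto (f : O -> D) : star_hom f ->
  (forall a g, f (kB (cp a g)) = rmul (vertex_rep P a) (U g)) ->
  (forall e g, f (kY (chi e g)) = rmul (S e) (U g)) -> range f = setT.
Proof.
move=> hf fB fY; have [fl fM fs] := hf; have fb := star_hom_bounded hf.
apply/seteqP; split=> // d _; have [_ _ _ _ genT] := CKr.
have : cstar_gen ([set fromM (toM (P v) ** U g) | v in [set: vert E] & g in [set: G]] `|`
         [set fromM (toM (S e) ** U g) | e in [set: edge E] & g in [set: G]]) d.
  by rewrite genT.
move=> /(_ (range f)); apply; split; last first.
  move=> _ [[v _ [g _ <-]]|[e _ [g _ <-]]] /=; rewrite -toM_rmul toMK.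
    by exists (kB (delta v g)) => //; rewrite fB (vertex_rep_delta CKr rf).
  by exists (kY (chi e g)).
split.
- split.
  + apply: closed_nrm => x hx; apply: (star_hom_closed_range hf) => e e0.
    by have [_ [a _ <-] ?] := hx e e0; exists a.
  + by exists 0 => //; rewrite (lin0 fb.1).
  + by move=> z _ _ [x _ <-] [y _ <-]; exists (z *: x + y) => //; rewrite fl.
- by move=> _ _ [x _ <-] [y _ <-]; exists (x ** y) => //; rewrite fM.
- by move=> _ [x _ <-]; exists (star x) => //; rewrite fs.
Qed.

End Homomorphisms.
End CuntzPimsnerSide.

Theorem corollary5p4 (R : realType) (G : groupType) (E : digraph)
    (act : digraph_action G E) (phi : G -> edge E -> G)
    (phi_cocycle : is_cocycle act phi)
    (B : cstarAlgType R) (iA : c0 R (vert E) -> multiplier B)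
    (iG : G -> multiplier B)
    (B_crossed : is_crossed_product (@c0_act R G E act) iA iG)
    (Y : hilbertModType B) (lact : B -> adjop Y) (chi : edge E -> G -> Y)
    (Y_corr : is_cocycle_correspondence act phi iA iG lact chi)
    (O : cstarAlgType R) (kY : Y -> O) (kB : B -> O)
    (O_CP : is_cuntz_pimsner lact kY kB)
    (D : cstarAlgType R) (P : vert E -> D) (S : edge E -> D)
    (U : G -> multiplier D)
    (PSU_CK : CK_representation act phi P S U)
    (E_row_finite : row_finite E) :
  let p' v := kB (fromM (iA (c0_delta R v))) in
  let s' e := kY (chi e 1%g) in
  let u' g := mext (@toM R O \o kB) (iG g) in
  exists! Phi : O -> D,
    [/\ star_hom Phi,
        range Phi = setT,
        forall v, Phi (p' v) = P v,
        forall e, Phi (s' e) = S e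
      & forall g, mext (@toM R D \o Phi) (u' g) = U g].
Proof.
move=> p' s' u'.
have U1 : U 1%g = Defs.adj1 by case: PSU_CK => _ [].
have p'E v : p' v = kB (cp_elt iA iG (c0_delta R v) 1%g).
  by rewrite (cp_elt1 B_crossed).
have [Phi [hf fB fY fU]] :=
  pimsner_hom_exists phi_cocycle B_crossed Y_corr O_CP PSU_CK E_row_finite.
have fP v : Phi (kB (cp_elt iA iG (c0_delta R v) 1%g)) = P v.
  by rewrite fB (vertex_rep_delta PSU_CK E_row_finite) U1 rmul1.
have fS e : Phi (s' e) = S e by rewrite fY U1 rmul1.
exists Phi; split.
  split=> //; first exact: (pimsner_hom_onto PSU_CK E_row_finite hf fB fY).
    by move=> v; rewrite p'E.
  move=> g; apply/(pimsner_hom_unitary phi_cocycle B_crossed Y_corr O_CP PSU_CK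
    E_row_finite hf fP g); exact: fU.
move=> Psi [hPsi _ PsiP PsiS PsiU]; apply/funext.
have PsiP' v : Psi (kB (cp_elt iA iG (c0_delta R v) 1%g)) = P v by rewrite -p'E.
apply: (pimsner_hom_eq B_crossed Y_corr O_CP hf hPsi) => [a g|e].
  rewrite fB (pimsner_hom_elt phi_cocycle B_crossed Y_corr O_CP PSU_CK E_row_finite hPsi PsiP')//.
  move=> h; apply/(pimsner_hom_unitary phi_cocycle B_crossed Y_corr O_CP PSU_CK
    E_row_finite hPsi PsiP' h); exact: PsiU.
by rewrite -/(s' e) fS PsiS.
Qed.
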